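(* For projection-free conjunctive queries, the query answering problem is in PTIME if $\mathcal{IC}$ consists of at most one functional dependency per relation scheme.
   Context: A PDB instance $D^p$ of a schema $\mathcal{D}^p$ is a finite set of tuples, each with a rational probability $p(t)\in[0,1]$. Possible worlds are subsets of its tuples; an interpretation is a probability distribution on possible worlds such that the total probability of worlds containing $t$ is $p(t)$. A functional dependency $X\to Y$ on relation $R$ is the denial constraint forbidding two $R$-tuples agreeing on $X$ and differing on some attribute of $Y$. A model w.r.t. $\mathcal{IC}$ is an interpretation assigning probability $0$ to every world violating $\mathcal{IC}$. A conjunctive query $Q(\vec x)=\exists\vec z.\,R_1(\vec y_1)\wedge\dots\wedge R_m(\vec y_m)\wedge\phi$ ($\phi$ a conjunction of comparisons) is projection-free if $\vec z$ is empty. For a model $M$, $p^M_Q(\vec t)=\sum_{w\models Q(\vec t)}M(w)$. $Ans(Q,D^p,\mathcal{IC})$ is the set of pairs $\langle\vec t,[p^{\min},p^{\max}]\rangle$ over ground tuples $\vec t$ satisfied in some possible world, with $p^{\min},p^{\max}$ the minimum and maximum of $p^M_Q(\vec t)$ over all models. Query answering: with $\mathcal{D}^p,\mathcal{IC},Q$ fixed, given $D^p$ consistent w.r.t. $\mathcal{IC}$, compute $Ans(Q,D^p,\mathcal{IC})$. *)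

(* Defs.v *)
From mathcomp Require Import all_boot all_order all_algebra.
Set Implicit Arguments. Unset Strict Implicit. Unset Printing Implicit Defensive.
Import Order.TTheory GRing.Theory Num.Theory.
Local Open Scope ring_scope.

(* A schema is the list of arities of its relation names 0, 1, ..., size sch - 1.
   Constants are natural numbers (a totally ordered domain). *)
Definition schema := seq nat.
Definition fact := (nat * seq nat)%type.       (* relation name, values *)
Definition pdb := seq (fact * rat).

Definition wf_fact (sch : schema) (f : fact) : bool :=
  (f.1 < size sch)%N && (size f.2 == nth 0%N sch f.1).

Definition wf_pdb (sch : schema) (D : pdb) : bool :=
  [&& uniq (map fst D), all (fun fp => wf_fact sch fp.1) D
    & all (fun fp => (0 <= fp.2) && (fp.2 <= 1)) D].

Definition dflt_tp : fact * rat := ((0%N, [::]), 0).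
Definition fact_at (D : pdb) (i : 'I_(size D)) : fact := (nth dflt_tp D i).1.
Definition prob_at (D : pdb) (i : 'I_(size D)) : rat := (nth dflt_tp D i).2.

Definition world (D : pdb) := {set 'I_(size D)}.

(* (r, X, Y) : the FD X -> Y on relation r, attributes given as positions *)
Definition fd := (nat * seq nat * seq nat)%type.
Definition fd_rel (d : fd) : nat := d.1.1.
Definition fd_lhs (d : fd) : seq nat := d.1.2.
Definition fd_rhs (d : fd) : seq nat := d.2.

Definition wf_fd (sch : schema) (d : fd) : bool :=
  (fd_rel d < size sch)%N &&
  all (fun a => a < nth 0%N sch (fd_rel d))%N (fd_lhs d ++ fd_rhs d).

Definition fd_viol (d : fd) (f g : fact) : bool :=
  [&& f.1 == fd_rel d, g.1 == fd_rel d,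
      all (fun a => nth 0%N f.2 a == nth 0%N g.2 a) (fd_lhs d)
    & has (fun b => nth 0%N f.2 b != nth 0%N g.2 b) (fd_rhs d)].

Definition violates (IC : seq fd) (D : pdb) (w : world D) : bool :=
  has (fun d => [exists i in w, exists j in w, fd_viol d (fact_at i) (fact_at j)]) IC.

Definition one_fd_per_relation (IC : seq fd) : Prop :=
  forall d1 d2, d1 \in IC -> d2 \in IC -> fd_rel d1 = fd_rel d2 -> d1 = d2.

Definition is_interp (R : realFieldType) (D : pdb) (M : {ffun world D -> R}) : Prop :=
  [/\ forall w, 0 <= M w,
      \sum_(w : world D) M w = 1
    & forall i : 'I_(size D), \sum_(w : world D | i \in w) M w = ratr (prob_at i)].

Definition is_model (R : realFieldType) (IC : seq fd) (D : pdb)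
    (M : {ffun world D -> R}) : Prop :=
  is_interp M /\ forall w, violates IC w -> M w = 0.

Definition consistent (R : realFieldType) (IC : seq fd) (D : pdb) : Prop :=
  exists M : {ffun world D -> R}, is_model IC M.

Inductive term := TVar of nat | TConst of nat.
Inductive cmpop := CEq | CNeq | CLt | CLe.

Record cq := CQ {
  cq_head  : seq nat;
  cq_atoms : seq (nat * seq term);
  cq_cmps  : seq (cmpop * term * term) }.

Definition term_vars (t : term) : seq nat :=
  if t is TVar v then [:: v] else [::].
Definition atom_vars (Q : cq) : seq nat :=
  flatten (map (fun a => flatten (map term_vars a.2)) (cq_atoms Q)).
Definition cmp_vars (Q : cq) : seq nat :=
  flatten (map (fun c => term_vars c.1.2 ++ term_vars c.2) (cq_cmps Q)).

(* projection-free: no existentially quantified variable, i.e. every variable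
   of the body is among the free (head) variables *)
Definition projection_free (Q : cq) : Prop :=
  {subset atom_vars Q ++ cmp_vars Q <= cq_head Q}.

Definition wf_cq (sch : schema) (Q : cq) : Prop :=
  all (fun a => (a.1 < size sch)%N && (size a.2 == nth 0%N sch a.1)) (cq_atoms Q)
  /\ {subset cq_head Q <= atom_vars Q}.

Definition eval_term (nu : nat -> nat) (t : term) : nat :=
  match t with TVar v => nu v | TConst c => c end.

Definition eval_cmp (nu : nat -> nat) (c : cmpop * term * term) : bool :=
  let a := eval_term nu c.1.2 in let b := eval_term nu c.2 in
  match c.1.1 with
  | CEq => a == b | CNeq => a != b | CLt => (a < b)%N | CLe => (a <= b)%N end.

Definition val_of (Q : cq) (t : seq nat) : nat -> nat :=
  fun v => nth 0%N t (index v (cq_head Q)).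

(* w |= Q(t): t matches the head and the induced valuation makes every atom
   a tuple of w and every comparison true (no existential variables since Q is
   projection-free) *)
Definition sat (Q : cq) (D : pdb) (w : world D) (t : seq nat) : bool :=
  let nu := val_of Q t in
  [&& map nu (cq_head Q) == t,
      all (fun a => [exists i in w, fact_at i == (a.1, map (eval_term nu) a.2)])
          (cq_atoms Q)
    & all (eval_cmp nu) (cq_cmps Q)].

Definition pQ (R : realFieldType) (Q : cq) (D : pdb) (M : {ffun world D -> R})
    (t : seq nat) : R :=
  \sum_(w : world D | sat Q w t) M w.

Definition is_Ans (R : realFieldType) (IC : seq fd) (Q : cq) (D : pdb)
    (L : seq (seq nat * rat * rat)) : Prop :=
  [/\ uniq (map (fun a => a.1.1) L),
      (forall t, t \in map (fun a => a.1.1) L <-> exists w : world D, sat Q w t)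
    & forall a, a \in L ->
        let: (t, lo, hi) := a in
        [/\ exists M : {ffun world D -> R}, is_model IC M /\ pQ Q M t = ratr lo,
            forall M : {ffun world D -> R}, is_model IC M -> ratr lo <= pQ Q M t,
            exists M : {ffun world D -> R}, is_model IC M /\ pQ Q M t = ratr hi
          & forall M : {ffun world D -> R}, is_model IC M -> pQ Q M t <= ratr hi]].

Definition sym0 : 'I_3 := @Ordinal 3 0 isT.
Definition sym1 : 'I_3 := @Ordinal 3 1 isT.
Definition symH : 'I_3 := @Ordinal 3 2 isT.

Fixpoint binrev (fuel n : nat) : seq bool :=
  match fuel with
  | 0 => [::]
  | f.+1 => if n == 0%N then [::] else odd n :: binrev f n./2
  end.
(* binary, most significant bit first, no leading zeros, then '#' *)
Definition enc_nat (n : nat) : seq 'I_3 :=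
  map (fun b : bool => if b then sym1 else sym0) (rev (binrev n n)) ++ [:: symH].
Definition enc_int (z : int) : seq 'I_3 :=
  match z with Posz n => sym0 :: enc_nat n | Negz n => sym1 :: enc_nat n.+1 end.
Definition enc_rat (q : rat) : seq 'I_3 :=
  enc_int (numq q) ++ enc_nat (absz (denq q)).
Definition enc_list (A : Type) (f : A -> seq 'I_3) (s : seq A) : seq 'I_3 :=
  enc_nat (size s) ++ flatten (map f s).
Definition enc_fact (f : fact) : seq 'I_3 := enc_nat f.1 ++ enc_list enc_nat f.2.
Definition enc_pdb (D : pdb) : seq 'I_3 :=
  enc_list (fun fp : fact * rat => enc_fact fp.1 ++ enc_rat fp.2) D.
Definition enc_ans (L : seq (seq nat * rat * rat)) : seq 'I_3 :=
  enc_list (fun a : seq nat * rat * rat =>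
              enc_list enc_nat a.1.1 ++ enc_rat a.1.2 ++ enc_rat a.2) L.

(* states 'I_(Q+1) (start state 0); tape symbols 'I_(S+4): 0 = blank,
   1,2,3 = the input/output letters 0,1,#; delta = None means halt;
   direction true = right, false = left (staying put at cell 0). *)
Record TM := MkTM {
  tm_Q : nat; tm_S : nat;
  tm_delta : 'I_tm_Q.+1 -> 'I_tm_S.+4 -> option ('I_tm_Q.+1 * 'I_tm_S.+4 * bool) }.

Record config (M : TM) := Config {
  c_state : 'I_(tm_Q M).+1; c_pos : nat; c_tape : nat -> 'I_(tm_S M).+4 }.

Definition step (M : TM) (c : config M) : option (config M) :=
  match tm_delta (c_state c) (c_tape c (c_pos c)) with
  | None => None
  | Some (q', b, d) =>
      Some (Config q' (if d then (c_pos c).+1 else (c_pos c).-1)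
                   (fun i => if i == c_pos c then b else c_tape c i))
  end.

Definition halted (M : TM) (c : config M) : bool :=
  if step c is None then true else false.

Fixpoint run (M : TM) (n : nat) (c : config M) : config M :=
  match n with
  | 0 => c
  | n'.+1 => match step c with None => c | Some c' => run n' c' end
  end.

Definition letter (M : TM) (a : 'I_3) : 'I_(tm_S M).+4 := inord a.+1.
Definition blank (M : TM) : 'I_(tm_S M).+4 := ord0.

Definition init (M : TM) (s : seq 'I_3) : config M :=
  Config ord0 0 (fun i => if (i < size s)%N then letter M (nth sym0 s i) else blank M).

Definition output_is (M : TM) (c : config M) (s : seq 'I_3) : Prop :=
  (forall i, (i < size s)%N -> c_tape c i = letter M (nth sym0 s i))
  /\ c_tape c (size s) = blank M.

(* Main.v *)
(** Let [S] be the set of tuples that an answer [t] needs; since the query is projection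
    free, [Q(t)] holds in a world iff the world contains [S]. One functional dependency
    splits a relation into groups (equal left sides) and each group into classes (equal
    right sides); two tuples conflict iff they lie in one group but in different classes.
    If two tuples of [S] conflict, both bounds are 0. Otherwise the maximum is the least
    probability in [S] (all tuples of [S] can be nested), and the minimum is
    [max 0 (1 - loss)], where [loss] is the sum over [f] in [S] of [1 - p f - c f]; here
    [c f] is 0 for one member of [S] per group, and for the other members it is the sum, over
    the classes conflicting with [f], of the largest probability in the class. For the
    lower bound, [1 - p f - c f] is the expectation of a nonnegative function of the world,
    and these functions sum to at least 1 when the world misses a tuple of [S]. For
    attainment, work on a uniform sample space of [N] points, [N] a common denominator, and
    make the events "f is absent" as disjoint as possible.

    For the complexity, call a function on tree-coded data polynomial-time if a program
    over a store of stacks computes it in polynomially many steps. This class is closed under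
    composition and under iteration with polynomially bounded intermediate results, hence
    contains binary arithmetic and the evaluation of these formulas; a stack program runs
    on a one-tape Turing machine with one track per stack, with quadratic overhead. *)

Require Import Defs.
From mathcomp Require Import all_boot all_order all_algebra.
From mathcomp Require Import zify ring lra.
From Stdlib Require Import FunctionalExtensionality.
Set Implicit Arguments. Unset Strict Implicit. Unset Printing Implicit Defensive.
Import Order.TTheory GRing.Theory Num.Theory.

(** * Stack programs and their Turing machines *)

(** The two inequalities hold for every model over every real field, by taking expectations, while
    the attaining models are uniform on [N] points. Their values are rational, hence extremal over
    every [R] at once, and one machine serves all fields. For conflict-free [S], consistency enters
    only through [room]: in a model, a tuple and the leaders of the classes conflicting with it
    exclude each other pairwise, so their masses sum to at most 1. Conversely this is all that a
    layout needs: each group sets aside a region of size [blocked], and each class fits into the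
    slot of its leader, with the other members nested in it. The region also explains [c f]: all
    members of [S] in one group are absent there, so their absences overlap in it, and it can be
    charged only once per group. On the machine side the obstacle is iterated growth, since a loop
    that may double its value in every round is not polynomial. Folds therefore admit only rounds
    that add an amount depending on the input and the current element, and a count written in binary
    never drives a loop. *)

Definition store := nat -> seq 'I_3.
Definition upd (s : store) i w : store := fun j => if j == i then w else s j.

Inductive com :=
  | Skip
  | Push of nat & 'I_3
  | Pop of nat
  | Seq of com & com
  | If of nat & option 'I_3 & com & com
  | While of nat & com.

(** The costs are exactly those of the compiled code: [comp] places the else branch first, so that
    branch alone pays for a jump over the other, and each round of a loop pays for its test and its
    jump back. *)
Inductive exec : com -> store -> nat -> store -> Prop :=
  | ExSkip s : exec Skip s 0 s
  | ExPush i a s : exec (Push i a) s 1 (upd s i (a :: s i))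
  | ExPop i s : exec (Pop i) s 1 (upd s i (behead (s i)))
  | ExSeq c1 c2 s1 s2 s3 t1 t2 :
      exec c1 s1 t1 s2 -> exec c2 s2 t2 s3 -> exec (Seq c1 c2) s1 (t1 + t2) s3
  | ExThen i a c1 c2 s s' t :
      ohead (s i) = a -> exec c1 s t s' -> exec (If i a c1 c2) s t.+1 s'
  | ExElse i a c1 c2 s s' t :
      ohead (s i) <> a -> exec c2 s t s' -> exec (If i a c1 c2) s t.+2 s'
  | ExDone i c s : s i = [::] -> exec (While i c) s 1 s
  | ExLoop i c s1 s2 s3 t1 t2 :
      s1 i <> [::] -> exec c s1 t1 s2 -> exec (While i c) s2 t2 s3 ->
      exec (While i c) s1 (t1 + t2).+2 s3.

Inductive instr :=
  | IPush of nat & 'I_3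
  | IPop of nat
  | IIf of nat & option 'I_3 & nat
  | IJmp of nat
  | IHalt.

Fixpoint clen (c : com) : nat :=
  match c with
  | Skip => 0
  | Push _ _ | Pop _ => 1
  | Seq c1 c2 => clen c1 + clen c2
  | If _ _ c1 c2 => (clen c2 + clen c1).+2
  | While _ c => (clen c).+2
  end.

Fixpoint comp (c : com) (p : nat) : seq instr :=
  match c with
  | Skip => [::]
  | Push i a => [:: IPush i a]
  | Pop i => [:: IPop i]
  | Seq c1 c2 => comp c1 p ++ comp c2 (p + clen c1)
  | If i a c1 c2 =>
      IIf i a (p + clen c2).+2 :: comp c2 p.+1 ++
      IJmp (p + clen c2 + clen c1).+2 :: comp c1 (p + clen c2).+2
  | While i c => IIf i None (p + clen c).+2 :: comp c p.+1 ++ [:: IJmp p]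
  end.

Lemma size_comp c p : size (comp c p) = clen c.
Proof.
elim: c p => //= [c1 IH1 c2 IH2|_ _ c1 IH1 c2 IH2|_ c IH] p.
- by rewrite size_cat IH1 IH2.
- by rewrite size_cat /= IH1 IH2 addnS.
- by rewrite size_cat /= IH addn1.
Qed.

Definition fstep (prog : seq instr) (x : nat * store) : nat * store :=
  let: (pc, s) := x in
  match nth IHalt prog pc with
  | IPush i a => (pc.+1, upd s i (a :: s i))
  | IPop i => (pc.+1, upd s i (behead (s i)))
  | IIf i a l => (if ohead (s i) == a then l else pc.+1, s)
  | IJmp l => (l, s)
  | IHalt => (pc, s)
  end.

Definition code_at (prog : seq instr) p (code : seq instr) :=
  forall k, k < size code -> nth IHalt prog (p + k) = nth IHalt code k.

Lemma code_at_cat prog p c1 c2 :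
  code_at prog p (c1 ++ c2) -> code_at prog p c1 /\ code_at prog (p + size c1) c2.
Proof.
move=> H; split=> k lt_k.
- by rewrite H ?size_cat ?ltn_addr // nth_cat lt_k.
- by rewrite -addnA H ?size_cat ?ltn_add2l // nth_cat ltnNge leq_addr /= addKn.
Qed.

Lemma code_at_cons prog p i c :
  code_at prog p (i :: c) -> nth IHalt prog p = i /\ code_at prog p.+1 c.
Proof.
by rewrite -cat1s => /code_at_cat [/(_ 0 isT)]; rewrite addn0 addn1.
Qed.

Lemma exec_fstep prog c s t s' : exec c s t s' -> forall p,
  code_at prog p (comp c p) -> iter t (fstep prog) (p, s) = (p + clen c, s').
Proof.
elim=> {c s t s'} /=.
- by move=> s p _; rewrite addn0.
- by move=> i a s p /code_at_cons[-> _]; rewrite addn1.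
- by move=> i s p /code_at_cons[-> _]; rewrite addn1.
- move=> c1 c2 s1 s2 s3 t1 t2 _ IH1 _ IH2 p /code_at_cat[/IH1 H1].
  by rewrite size_comp => /IH2 H2; rewrite addnC iterD H1 H2 addnA.
- move=> i a c1 c2 s s' t Ha _ IH p /code_at_cons[Hp /code_at_cat[_]].
  rewrite size_comp => /code_at_cons[_]; rewrite addSn => /IH {}IH.
  by rewrite -iterS iterSr /= Hp Ha eqxx IH; congr pair; lia.
- move=> i a c1 c2 s s' t /eqP/negPf Ha _ IH p.
  move=> /code_at_cons[Hp /code_at_cat[/IH {}IH]].
  rewrite size_comp => /code_at_cons[Hj _].
  rewrite -[fstep prog (iter _ _ _)]iterS -iterS iterSr /= Hp Ha IH /= Hj.
  by congr pair; lia.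
- by move=> i c s Hs p /code_at_cons[Hp _]; rewrite Hp Hs eqxx; congr pair; lia.
- move=> i c s1 s2 s3 t1 t2 Hs _ IH1 _ IH2 p Hc.
  have {}IH2 := IH2 _ Hc; move: Hc.
  move=> /code_at_cons[Hp /code_at_cat[/IH1 {}IH1]].
  rewrite size_comp => /code_at_cons[Hj _].
  rewrite -[fstep prog (iter _ _ _)]iterS -iterS.
  have -> : (t1 + t2).+2 = t2 + (1 + (t1 + 1)) by lia.
  rewrite !iterD /= Hp; case: (s1 i) Hs => // a w _ /=; rewrite IH1 /= Hj.
  by rewrite IH2.
Qed.

Definition ireg (i : instr) : nat :=
  match i with IPush i _ | IPop i | IIf i _ _ => i | _ => 0 end.

Definition itarget (i : instr) : nat :=
  match i with IIf _ _ l | IJmp l => l | _ => 0 end.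

Lemma comp_target c p n :
  p + clen c <= n -> all (fun i => itarget i <= n) (comp c p).
Proof.
elim: c p => //= [c1 IH1 c2 IH2|_ _ c1 IH1 c2 IH2|_ c IH] p Hn;
  rewrite all_cat /= ?IH1 ?IH2 ?IH //=; lia.
Qed.

(** * The machine that simulates a program *)

Section Machine.
Variables (prog : seq instr) (K : nat).

(* A cell holds the mark of position 0 and one track per register; the bottom of
   every stack is at position 0. *)
Definition cell : finType := (bool * {ffun 'I_K.+1 -> option 'I_3})%type.
Definition tsym : finType := ('I_4 + cell)%type.
(* [None] is the start state: it must be encoded as [ord0]. A program counter comes
   with [None] when the head moves to the top of a track, [Some false] when it reads
   that top, [Some true] when it returns to the marked cell 0. *)
Definition mstate := (option ('I_(size prog).+1 * option bool + bool))%type.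

Definition st_load : mstate := Some (inr false).
Definition st_done : mstate := Some (inr true).
Definition st_go (pc : nat) : mstate := Some (inl (inord pc, None)).
Definition st_take (pc : nat) : mstate := Some (inl (inord pc, Some false)).
Definition st_ret (pc : nat) : mstate := Some (inl (inord pc, Some true)).

(** Cells never visited still carry a raw blank; reading them as unmarked cells with empty tracks
    spares any initialisation of the tape. *)
Definition view (x : tsym) : cell :=
  if x is inr c then c else (false, [ffun=> None]).
Definition track (x : tsym) (i : nat) : option 'I_3 := (view x).2 (inord i).
Definition wr (x : tsym) (i : nat) (a : option 'I_3) : tsym :=
  inr ((view x).1, [ffun j => if j == inord i then a else (view x).2 j]).
Definition raw (a : 'I_3) : tsym := inl (lift ord0 a).
Definition unraw (x : tsym) : option 'I_3 :=
  if x is inl a then unlift ord0 a else None.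

Definition delta (q : mstate) (x : tsym) : option (mstate * tsym * bool) :=
  match q with
  | None =>
      Some (if unraw x is Some a then st_load else st_ret 0,
            inr (true, [ffun j => if j == ord0 then unraw x else None]),
            isSome (unraw x))
  | Some (inr false) =>
      if unraw x is Some a then Some (st_load, wr (inl ord0) 0 (Some a), true)
      else Some (st_ret 0, x, false)
  | Some (inr true) => None
  | Some (inl (pc, None)) =>
      match nth IHalt prog pc with
      | IPush i a =>
          if track x i is None then Some (st_ret pc.+1, wr x i (Some a), false)
          else Some (q, x, true)
      | IPop i | IIf i _ _ =>
          if track x i is None then Some (st_take pc, x, false)
          else Some (q, x, true)
      | IJmp l => Some (st_ret l, x, false)
      | IHalt =>
          if track x 0 is Some a then Some (q, raw a, true)
          else Some (st_done, inl ord0, true)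
      end
  | Some (inl (pc, Some false)) =>
      match nth IHalt prog pc with
      | IPop i => Some (st_ret pc.+1, wr x i None, false)
      | IIf i a l => Some (st_ret (if track x i == a then l else pc.+1), x, false)
      | _ => None
      end
  | Some (inl (pc, Some true)) =>
      Some (if (view x).1 then st_go pc else q, x, false)
  end.

(** [unsplit] numbers the left summand first, so blank and letters keep the numbers 0 to 3
    prescribed by [init] and [output_is]. *)
Definition esym (x : tsym) : 'I_(4 + #|cell|) :=
  unsplit (match x with inl a => inl a | inr c => inr (enum_rank c) end).
Definition dsym (x : 'I_(4 + #|cell|)) : tsym :=
  match split x with inl a => inl a | inr c => inr (enum_val c) end.

Lemma esymK : cancel esym dsym.
Proof. by case=> [a|c]; rewrite /esym /dsym unsplitK // enum_rankK. Qed.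

Definition nst := #|{: 'I_(size prog).+1 * option bool + bool}|.
Definition est (q : mstate) : 'I_nst.+1 :=
  if q is Some q' then lift ord0 (enum_rank q') else ord0.
Definition dst (q : 'I_nst.+1) : mstate := omap enum_val (unlift ord0 q).

Lemma estK : cancel est dst.
Proof.
case=> [q|]; rewrite /est /dst; last by rewrite unlift_none.
by rewrite liftK /= enum_rankK.
Qed.

Definition mach : TM :=
  @MkTM nst #|cell| (fun q x =>
    omap (fun r => (est r.1.1, esym r.1.2, r.2)) (delta (dst q) (dsym x))).

Definition aconf := (mstate * nat * (nat -> tsym))%type.
Definition astep (c : aconf) : option aconf :=
  let: (q, p, T) := c in
  omap (fun r : mstate * tsym * bool => let: (q', b, d) := r in
    (q', if d then p.+1 else p.-1, fun i => if i == p then b else T i))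
   (delta q (T p)).
Fixpoint arun n c := if n is n'.+1 then
  if astep c is Some c' then arun n' c' else c else c.

Definition conf_of (c : aconf) : config mach :=
  @Config mach (est c.1.1) c.1.2 (fun i => esym (c.2 i)).

Lemma step_conf_of c : step (conf_of c) = omap conf_of (astep c).
Proof.
case: c => [[q p] T]; rewrite /step /= estK esymK.
case: (delta q (T p)) => //= [[[q' b] d]] /=; congr Some.
rewrite /conf_of /=; congr Config.
by apply: functional_extensionality => i; case: eqP.
Qed.

Lemma run_conf_of n c : run n (conf_of c) = conf_of (arun n c).
Proof.
elim: n c => //= n IH c; rewrite step_conf_of.
by case: (astep c) => //= c'; apply: IH.
Qed.

Lemma arunD m n c : arun (m + n) c = arun n (arun m c).
Proof.
elim: m c => //= m IH c; case E: (astep c) => [c'|]; first exact: IH.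
by case: n {IH} => //= n; rewrite E.
Qed.

Lemma updT (A : Type) (T : nat -> A) p : (fun i => if i == p then T p else T i) = T.
Proof. by apply: functional_extensionality => i; case: eqP => [->|]. Qed.

Definition repr (T : nat -> tsym) (s : store) := forall j,
  (view (T j)).1 = (j == 0) /\
  forall i, i <= K -> track (T j) i = onth (rev (s i)) j.

Lemma val_inord_pc pc : pc <= size prog -> (inord pc : 'I_(size prog).+1) = pc :> nat.
Proof. by move=> H; rewrite inordK. Qed.

(** The last of the [p.+1] steps reads the mark at cell 0 and, moving left, stays there. The count
    is a variable with an equation so that simplification does not unfold [arun] at the call
    sites. *)
Lemma run_ret pc p n T s : n = p.+1 -> repr T s ->
  arun n (st_ret pc, p, T) = (st_go pc, 0, T).
Proof.
move=> -> HT; elim: p => [|p IH].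
  by rewrite /= (HT 0).1 /= updT /st_go inord_val.
have E : arun 1 (st_ret pc, p.+1, T) = (st_ret pc, p, T).
  by rewrite /= (HT _).1 updT.
by rewrite -[p.+2]add1n arunD E.
Qed.

Lemma run_go (pc i : nat) T s h : pc <= size prog ->
  repr T s -> i <= K -> ireg (nth IHalt prog pc) = i ->
  match nth IHalt prog pc with IPush _ _ | IPop _ | IIf _ _ _ => True | _ => False end ->
  h <= size (s i) -> arun h (st_go pc, 0, T) = (st_go pc, h, T).
Proof.
move=> Hpc HT Hi Hr Hk; elim: h => // h IH Hh.
rewrite -addn1 arunD IH 1?ltnW //= val_inord_pc //.
have := (HT h).2 _ Hi; rewrite onthE (nth_map (sym0)) ?size_rev //.
case: (nth _ prog pc) Hr Hk => [j a|j|j a l|l|] //= -> _ -> //=; rewrite addn1; congr pair; exact: updT.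
Qed.

Lemma onth_rev_top (w : seq 'I_3) : onth (rev w) (size w).-1 = ohead w.
Proof.
case: w => // a w /=; rewrite onthE (nth_map sym0) ?size_rev //.
by rewrite nth_rev // subSS subnn.
Qed.

Lemma onth_size (w : seq 'I_3) : onth (rev w) (size w) = None.
Proof. by rewrite onthE nth_default // size_map size_rev. Qed.

Lemma inord_inj i i' : i <= K -> i' <= K -> ((inord i' : 'I_K.+1) == inord i) = (i' == i).
Proof. by move=> Hi Hi'; rewrite -val_eqE /= !inordK. Qed.

Lemma repr_wr T s p i a (w : seq 'I_3) : i <= K -> repr T s ->
  (forall j, onth (rev w) j = if j == p then a else onth (rev (s i)) j) ->
  repr (fun j => if j == p then wr (T p) i a else T j) (upd s i w).
Proof.
move=> Hi HT Hw j; case: (HT j) => Hm Ht; split; first by case: eqP => // H; rewrite -H.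
move=> i' Hi'; rewrite /upd; case: (i' =P i) => [->|/eqP ne].
  rewrite Hw; case: eqP => [_|_]; last exact: Ht.
  by rewrite /track ffunE eqxx.
by rewrite -Ht //; case: (j =P p) => [->|//]; rewrite /track /= ffunE inord_inj // (negPf ne).
Qed.

Lemma onth_rev_cons (a : 'I_3) w j :
  onth (rev (a :: w)) j = if j == size w then Some a else onth (rev w) j.
Proof.
rewrite rev_cons !onthE map_rcons nth_rcons size_map size_rev.
case: ltngtP => // H; rewrite nth_default // size_map size_rev; exact: ltnW.
Qed.

Lemma onth_rev_behead (w : seq 'I_3) j :
  onth (rev (behead w)) j = if j == (size w).-1 then None else onth (rev w) j.
Proof.
case: w => [|a w] /=; first by rewrite !onthE /= !nth_nil if_same.
rewrite onth_rev_cons; case: eqP => // ->; exact: onth_size.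
Qed.

Definition inT (inp : seq 'I_3) : nat -> tsym :=
  fun i => if i < size inp then raw (nth sym0 inp i) else inl ord0.

Definition T0 (inp : seq 'I_3) p : nat -> tsym := fun i =>
  if i < p then inr (i == 0, [ffun j => if j == ord0 then onth inp i else None])
  else inT inp i.

Lemma init_conf_of inp : init mach inp = conf_of (None, 0, inT inp).
Proof.
rewrite /init /conf_of /=; congr Config.
apply: functional_extensionality => i; rewrite /inT.
case: ifP => Hi; apply: val_inj => /=; last by [].
by rewrite inordK //= ltnS; apply: leq_trans (ltn_ord _) _; rewrite leq_addr.
Qed.

Lemma inT_raw inp p : unraw (inT inp p) = onth inp p.
Proof.
rewrite /inT; case: ltnP => H; last by rewrite /= unlift_none onthE nth_default ?size_map.
by rewrite /= liftK onthE (nth_map sym0).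
Qed.

Lemma T0_step inp p b :
  b = inr (p == 0, [ffun j => if j == ord0 then onth inp p else None]) ->
  (fun i => if i == p then b else T0 inp p i) = T0 inp p.+1.
Proof.
move=> ->; apply: functional_extensionality => i; rewrite /T0 ltnS.
by case: (ltngtP i p) => // ->.
Qed.

Lemma run_load inp p : 0 < p <= size inp ->
  arun p (None, 0, inT inp) = (st_load, p, T0 inp p).
Proof.
elim: p => // p IH /andP[_ Hp]; case: p => [|p] in IH Hp *.
  rewrite /= inT_raw onthE (nth_map sym0) //=; congr pair.
  by rewrite -(@T0_step _ 0 _ erefl) onthE (nth_map sym0).
have E : onth inp p.+1 = Some (nth sym0 inp p.+1) by rewrite onthE (nth_map sym0).
have E1 : arun 1 (st_load, p.+1, T0 inp p.+1) = (st_load, p.+2, T0 inp p.+2).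
  have E2 : T0 inp p.+1 p.+1 = inT inp p.+1 by rewrite /T0 ltnn.
  rewrite /= E2 inT_raw E /=; congr pair; apply: T0_step.
  rewrite /wr E /=; congr (inr (_, _)); apply/ffunP => j; rewrite !ffunE.
  by rewrite -!val_eqE /= inordK.
have Hp1 : 0 < p.+1 <= size inp by rewrite (ltnW Hp).
by rewrite -{1}[p.+2]addn1 arunD (IH Hp1) E1.

Qed.

(** The first input letter becomes the bottom of track 0, which is why register 0 starts as the
    reversed input; in the same way the output is read off reversed. *)
Lemma run_init inp : exists n T, [/\ n <= (size inp).*2 + 2,
  arun n (None, 0, inT inp) = (st_go 0, 0, T)
  & repr T (upd (fun=> [::]) 0 (rev inp))].
Proof.
have Hr n : size inp <= n.+1 -> repr (T0 inp n.+1) (upd (fun=> [::]) 0 (rev inp)).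
  move=> Hn j; rewrite /T0; case: ltnP => Hj; split=> //.
  - move=> i Hi; rewrite /track ffunE /upd -val_eqE /= inordK //.
    by case: (i =P 0) => _; rewrite ?revK // onthE nth_nil.
  - by rewrite /inT ltnNge (leq_trans Hn Hj) /= ; case: j Hj.
  - move=> i Hi; rewrite /inT ltnNge (leq_trans Hn Hj) /track /= ffunE /upd.
    case: eqP => _; rewrite onthE ?nth_nil // revK nth_default ?size_map //.
    exact: leq_trans Hj.
case: (posnP (size inp)) => [/size0nil E0|Hinp].
  subst inp.
  exists (1 + 1), (T0 [::] 1); split; [by []| |exact: Hr].
  have E1 : arun 1 (None, 0, inT [::]) = (st_ret 0, 0, T0 [::] 1).
    by rewrite /= unlift_none /=; congr pair; apply: (@T0_step [::] 0).
  by rewrite (arunD 1 1) E1 (run_ret _ erefl (Hr 0 _)).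
have [r Er] : exists r, r = (size inp).-1.+1 by eexists.
exists (size inp + (1 + r)), (T0 inp (size inp)); split; first lia.
  have E1 : arun 1 (st_load, size inp, T0 inp (size inp)) =
      (st_ret 0, (size inp).-1, T0 inp (size inp)).
    have E2 : T0 inp (size inp) (size inp) = inT inp (size inp) by rewrite /T0 ltnn.
    rewrite /= E2 inT_raw onth_default //= -E2; congr pair; exact: updT.
  rewrite !arunD run_load ?Hinp ?leqnn // E1.
  by rewrite -[in T0 _ _](prednK Hinp) (run_ret _ Er (Hr _ _)) ?prednK.
by rewrite -{1}(prednK Hinp); apply: Hr; rewrite prednK.
Qed.

Definition Tout (T : nat -> tsym) (w : seq 'I_3) p : nat -> tsym := fun i =>
  if i < p then raw (nth sym0 w i) else T i.

Lemma run_out pc T s p : nth IHalt prog pc = IHalt -> pc <= size prog -> repr T s ->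
  p <= size (s 0) ->
  arun p (st_go pc, 0, T) = (st_go pc, p, Tout T (rev (s 0)) p).
Proof.
move=> Hh Hpc HT; elim: p => // p IH Hp.
have E2 : Tout T (rev (s 0)) p p = T p by rewrite /Tout ltnn.
rewrite -addn1 arunD IH 1?ltnW // addn1.
rewrite /= val_inord_pc // Hh E2 (HT p).2 // onthE (nth_map (sym0)) ?size_rev //=.
congr pair; apply: functional_extensionality => i; rewrite /Tout ltnS.
by case: (ltngtP i p) => // ->.
Qed.

Lemma run_halt pc T s : nth IHalt prog pc = IHalt -> pc <= size prog -> repr T s ->
  let c := conf_of (arun (size (s 0)).+1 (st_go pc, 0, T)) in
  halted c /\ output_is c (rev (s 0)).
Proof.
move=> Hh Hpc HT.
have E2 : Tout T (rev (s 0)) (size (s 0)) (size (s 0)) = T (size (s 0)).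
  by rewrite /Tout ltnn.
set w := s 0 in E2 *.
have -> : arun (size w).+1 (st_go pc, 0, T) =
    (st_done, (size w).+1,
     fun i => if i == size w then inl ord0 else Tout T (rev w) (size w) i).
  rewrite -addn1 arunD (run_out Hh Hpc HT) // addn1 /=.
  by rewrite val_inord_pc // Hh E2 (HT (size w)).2 // onth_size.
split; first by rewrite /halted step_conf_of.
rewrite /output_is /= size_rev eqxx; split=> [i Hi|]; last exact: val_inj.
rewrite /Tout (ltn_eqF Hi) Hi; apply: val_inj => /=.
rewrite inordK //= ltnS; apply: leq_trans (ltn_ord _) _; by rewrite leq_addr.
Qed.

Lemma size_fstep x i : size ((fstep prog x).2 i) <= (size (x.2 i)).+1.
Proof.
case: x => pc s /=; case: (nth _ _ _) => [j a|j|j a l|l|] //=; rewrite /upd.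
  by case: eqP => [->|].
by case: eqP => [->|] //; rewrite size_behead; lia.
Qed.

Hypothesis prog_reg : all (fun i => ireg i <= K) prog.
Hypothesis prog_target : all (fun i => itarget i <= size prog) prog.

(** One instruction is a trip to the top of one stack and back, hence twice its height. *)
Lemma sim_fstep pc s T : pc < size prog -> nth IHalt prog pc <> IHalt -> repr T s ->
  let h := size (s (ireg (nth IHalt prog pc))) in
  exists n T', [/\ n <= h.*2 + 4,
    arun n (st_go pc, 0, T) = (st_go (fstep prog (pc, s)).1, 0, T'),
    repr T' (fstep prog (pc, s)).2 & (fstep prog (pc, s)).1 <= size prog].
Proof.
move=> Hpc Hh HT /=.
have Hpc' := ltnW Hpc; have := val_inord_pc Hpc' => Vpc.
have := all_nthP IHalt prog_reg _ Hpc; have := all_nthP IHalt prog_target _ Hpc.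
have := @run_go pc _ T s _ Hpc' HT.
case E: (nth IHalt prog pc) Hh => [i a|i|i a l|l|] //= _ Hgo Ht Hr.
- have {}Hgo := Hgo _ _ Hr erefl I (leqnn _).
  have HT' := repr_wr Hr HT (onth_rev_cons a (s i)).
  have [r Er] : exists r, r = (size (s i)).-1.+1 by eexists.
  exists (size (s i) + (1 + r)); eexists; split; last by []; first lia.
    rewrite !arunD Hgo /= Vpc E.
    have := (HT (size (s i))).2 _ Hr; rewrite onth_size => -> /=.
    by rewrite (run_ret _ Er HT').
  exact: HT'.
- have {}Hgo := Hgo _ _ Hr erefl I (leqnn _).
  have HT' := repr_wr Hr HT (onth_rev_behead (s i)).
  have [r Er] : exists r, r = (size (s i)).-2.+1 by eexists.
  exists (size (s i) + (1 + (1 + r))); eexists; split; last by []; first lia.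
    have E1 : arun 1 (st_go pc, size (s i), T) = (st_take pc, (size (s i)).-1, T).
      by rewrite /= Vpc E (HT _).2 // onth_size /= updT.
    by rewrite !arunD Hgo E1 /= Vpc E /= (run_ret _ Er HT').
  exact: HT'.
- have {}Hgo := Hgo _ _ Hr erefl I (leqnn _).
  have [r Er] : exists r, r = (size (s i)).-2.+1 by eexists.
  exists (size (s i) + (1 + (1 + r))), T; split => //; first lia.
    have E1 : arun 1 (st_go pc, size (s i), T) = (st_take pc, (size (s i)).-1, T).
      by rewrite /= Vpc E (HT _).2 // onth_size /= updT.
    rewrite !arunD Hgo E1 /= Vpc E /= (HT (size (s i)).-1).2 // onth_rev_top updT.
    by rewrite (run_ret _ Er HT).
  by case: ifP.
- exists 2, T; split=> //; first lia.
  by rewrite /= Vpc E /= updT (HT 0).1 /= updT /st_go inord_val.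
Qed.

(** A stack gains at most one letter per instruction, so no trip climbs higher than [m + t]. Once
    the program has halted, [fstep] is the identity and costs no machine step. *)
Lemma sim_iter t pc s T m : repr T s -> pc <= size prog ->
  (forall i, size (s i) <= m) ->
  exists n T' , [/\ n <= t * ((m + t).*2 + 4),
    arun n (st_go pc, 0, T) = (st_go (iter t (fstep prog) (pc, s)).1, 0, T')
    & repr T' (iter t (fstep prog) (pc, s)).2 ].
Proof.
elim: t pc s T m => [|t IH] pc s T m HT Hpc Hm; first by exists 0, T.
case: (boolP (isSome (if nth IHalt prog pc is IHalt then None else Some tt))) => Hh.
  have Hpc' : pc < size prog.
    by rewrite ltnNge; apply: contraTN Hh => Hlt; rewrite nth_default.
  have Hh' : nth IHalt prog pc <> IHalt by move=> E; rewrite E in Hh.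
  have [n1 [T1 [Hn1 Hr1 HT1 Hp1]]] := sim_fstep Hpc' Hh' HT.
  have Hm1 i : size ((fstep prog (pc, s)).2 i) <= m.+1.
    by apply: leq_trans (size_fstep _ _) _; rewrite ltnS Hm.
  have [n2 [T2 [Hn2 Hr2 HT2]]] := IH _ _ _ _ HT1 Hp1 Hm1.
  rewrite iterSr; rewrite -surjective_pairing in Hr2 HT2.
  exists (n1 + n2), T2; split=> //; last by rewrite arunD Hr1 Hr2.
  rewrite mulSn leq_add //; last by rewrite addSnnS in Hn2.
  apply: leq_trans Hn1 _; have := Hm (ireg (nth IHalt prog pc)); lia.
have E : fstep prog (pc, s) = (pc, s) by rewrite /=; case: (nth _ _ _) Hh.
have [n2 [T2 [Hn2 Hr2 HT2]]] := IH _ _ _ _ HT Hpc Hm.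
rewrite iterSr E; exists n2, T2; split=> //.
apply: leq_trans Hn2 _; apply: leq_mul; lia.
Qed.

End Machine.

Theorem TM_of_com (c : com) : exists M : TM, forall inp t s,
  exec c (upd (fun=> [::]) 0 (rev inp)) t s ->
  exists T, [/\ T <= 10 * (size inp + t + 1) ^ 2,
    halted (run T (init M inp)) & output_is (run T (init M inp)) (rev (s 0))].
Proof.
pose prog := comp c 0; pose K := \max_(i <- map ireg prog) i.
have HK : all (fun i => ireg i <= K) prog.
  elim: prog @K => //= i p IH; rewrite big_cons leq_maxl /=.
  by apply: sub_all IH => j Hj; apply: leq_trans Hj _; rewrite leq_maxr.
have Hl : all (fun i => itarget i <= size prog) prog.
  by apply: comp_target; rewrite size_comp.
exists (mach prog K) => inp t s He.
have Hf : iter t (fstep prog) (0, upd (fun=> [::]) 0 (rev inp)) = (size prog, s).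
  by rewrite (exec_fstep He) ?size_comp // => k.
have [n1 [T1 [Hn1 Hr1 HT1]]] := run_init prog K inp.
have Hm i : size (upd (fun=> [::]) 0 (rev inp) i) <= size inp.
  by rewrite /upd; case: eqP; rewrite ?size_rev.
have [n2 [T2 [Hn2 Hr2 HT2]]] := sim_iter HK Hl t HT1 (leq0n _) Hm.
rewrite Hf /= in Hr2 HT2.
have [Hh Ho] := run_halt (nth_default IHalt (leqnn (size prog))) (leqnn _) HT2.
exists (n1 + (n2 + (size (s 0)).+1)); rewrite init_conf_of run_conf_of !arunD Hr1 Hr2.
split=> //.
have Hs : size (s 0) <= size inp + t.
  have -> : s = (iter t (fstep prog) (0, upd (fun=> [::]) 0 (rev inp))).2 by rewrite Hf.
  elim: t {He Hf Hn2 Hr2 HT2} => [|t IH]; first by rewrite addn0; apply: Hm.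
  by rewrite iterS addnS; apply: leq_trans (size_fstep _ _ _) _.
apply: leq_trans (_ : (size inp).*2 + 2 + (t * ((size inp + t).*2 + 4) + (size inp + t).+1) <= _).
  by rewrite leq_add // leq_add.
rewrite expnS expn1; nia.
Qed.


(** * Polynomial-time functions on tree-coded data *)

(** Time bounds are syntactic polynomials with natural coefficients: they are monotone by
    construction and compose by substitution. *)
Inductive pexp := PX | PC of nat | PA of pexp & pexp | PM of pexp & pexp.
Fixpoint ev (p : pexp) (n : nat) : nat :=
  match p with
  | PX => n | PC c => c
  | PA p q => ev p n + ev q n | PM p q => ev p n * ev q n
  end.
Fixpoint psubst (p q : pexp) : pexp :=
  match p with
  | PX => q | PC c => PC c
  | PA p1 p2 => PA (psubst p1 q) (psubst p2 q)
  | PM p1 p2 => PM (psubst p1 q) (psubst p2 q)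
  end.

Lemma ev_psubst p q n : ev (psubst p q) n = ev p (ev q n).
Proof. by elim: p => //= p1 -> p2 ->. Qed.

Lemma ev_mono p m n : m <= n -> ev p m <= ev p n.
Proof. by move=> H; elim: p => //= p1 H1 p2 H2; [apply: leq_add|apply: leq_mul]. Qed.

Lemma ev_monomial p : exists c k, forall n, ev p n <= c * n ^ k + c.
Proof.
have [c [k H]] : exists c k, forall n, ev p n <= c * n.+1 ^ k.
  elim: p => /= [|c|p [c1 [k1 H1]] q [c2 [k2 H2]]|p [c1 [k1 H1]] q [c2 [k2 H2]]].
  - by exists 1, 1 => n; rewrite mul1n expn1.
  - by exists c, 0 => n; rewrite muln1.
  - exists (c1 + c2), (k1 + k2) => n; rewrite mulnDl leq_add //.
      by apply: leq_trans (H1 n) _; rewrite leq_mul // leq_pexp2l ?leq_addr.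
    by apply: leq_trans (H2 n) _; rewrite leq_mul // leq_pexp2l ?leq_addl.
  - exists (c1 * c2), (k1 + k2) => n; rewrite expnD mulnACA.
    exact: leq_mul.
(* For positive [n], [n.+1 <= 2 * n] accounts for the factor [2 ^ k]; the additive constant covers
   [n = 0]. *)
exists (c * 2 ^ k), k => n; apply: leq_trans (H n) _.
case: n => [|n]; first by rewrite exp1n muln1; apply: leq_trans (leq_addl _ _); rewrite leq_pmulr ?expn_gt0.
apply: leq_trans (leq_addr _ _); rewrite -mulnA leq_mul // -expnMn.
case: k {H} => // k; rewrite leq_exp2r //; lia.
Qed.

Inductive tree := Leaf | Node of tree & tree.

(* Polish notation; the top of a stack is the head of the list. *)
Fixpoint fl (t : tree) : seq 'I_3 :=
  if t is Node l r then sym1 :: fl l ++ fl r else [:: sym0].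
Definition tsz t := size (fl t).

Lemma tsz_node l r : tsz (Node l r) = (tsz l + tsz r).+1.
Proof. by rewrite /tsz /= size_cat. Qed.

Lemma tsz_gt0 t : 0 < tsz t. Proof. by case: t. Qed.

Lemma fl_cat_inj t1 t2 r1 r2 : fl t1 ++ r1 = fl t2 ++ r2 -> t1 = t2 /\ r1 = r2.
Proof.
elim: t1 t2 r1 r2 => [|l1 IHl r1 IHr] [|l2 r2] e1 e2 //=; first by case.
by rewrite -!catA => -[] /IHl[-> /IHr[-> ->]].
Qed.

Lemma fl_inj : injective fl.
Proof. by move=> t1 t2 E; case: (@fl_cat_inj t1 t2 [::] [::]); rewrite ?E. Qed.

(** * Timed runs and a calling convention for registers *)

Definition runs c s T s' := exists2 t, t <= T & exec c s t s'.

Lemma runs_le c s T T' s' : T <= T' -> runs c s T s' -> runs c s T' s'.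
Proof. by move=> H [t Ht He]; exists t => //; apply: leq_trans H. Qed.

Lemma runs_to c s T T' s1 s2 : runs c s T s1 -> s1 = s2 -> T <= T' -> runs c s T' s2.
Proof. by move=> H <- /runs_le; apply. Qed.

Lemma runs_seq c1 c2 s1 s2 s3 T1 T2 :
  runs c1 s1 T1 s2 -> runs c2 s2 T2 s3 -> runs (Seq c1 c2) s1 (T1 + T2) s3.
Proof.
by move=> [t1 H1 E1] [t2 H2 E2]; exists (t1 + t2); [apply: leq_add|apply: ExSeq E2].
Qed.

Lemma runs_skip s : runs Skip s 0 s. Proof. by exists 0 => //; constructor. Qed.
Lemma runs_push i a s : runs (Push i a) s 1 (upd s i (a :: s i)).
Proof. by exists 1 => //; constructor. Qed.
Lemma runs_pop i s : runs (Pop i) s 1 (upd s i (behead (s i))).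
Proof. by exists 1 => //; constructor. Qed.

Lemma runs_then i a c1 c2 s T s' :
  ohead (s i) = a -> runs c1 s T s' -> runs (If i a c1 c2) s (T + 2) s'.
Proof. by move=> Ha [t Ht He]; exists t.+1; [lia|apply: ExThen]. Qed.

Lemma runs_else i a c1 c2 s T s' :
  ohead (s i) <> a -> runs c2 s T s' -> runs (If i a c1 c2) s (T + 2) s'.
Proof. by move=> Ha [t Ht He]; exists t.+2; [lia|apply: ExElse]. Qed.

Lemma runs_done i c s : s i = [::] -> runs (While i c) s 1 s.
Proof. by move=> H; exists 1 => //; constructor. Qed.

Lemma runs_loop i c s1 s2 s3 T1 T2 : s1 i <> [::] ->
  runs c s1 T1 s2 -> runs (While i c) s2 T2 s3 -> runs (While i c) s1 (T1 + T2 + 2) s3.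
Proof.
by move=> H [t1 H1 E1] [t2 H2 E2]; exists (t1 + t2).+2; [lia|apply: ExLoop E2].
Qed.

Lemma exec_grow c s t s' j : exec c s t s' -> size (s' j) <= size (s j) + t.
Proof.
by elim=> {c s t s'} // *; rewrite /upd; try case: eqP => [->|]; rewrite /= ?size_behead; lia.
Qed.

(** A stack frame with base [b]. A subprogram started at a higher base sees the registers in use as
    part of the protected store, and finds only empty scratch registers above its arguments. *)
Definition fr (s : store) b (ws : seq (seq 'I_3)) : store :=
  fun j => if j < b then s j else nth [::] ws (j - b).

Lemma fr_at s b ws i : fr s b ws (b + i) = nth [::] ws i.
Proof. by rewrite /fr ltnNge leq_addr addKn. Qed.

Lemma fr_upd s b ws i w : upd (fr s b ws) (b + i) w = fr s b (set_nth [::] ws i w).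
Proof.
apply: functional_extensionality => j; rewrite /upd /fr nth_set_nth /=.
case: ltnP => Hj; first by case: eqP => // H; lia.
by case: eqP => H; case: eqP => // H'; lia.
Qed.

Lemma fr_eq s b ws ws' : (forall k, nth [::] ws k = nth [::] ws' k) -> fr s b ws = fr s b ws'.
Proof. by move=> H; apply: functional_extensionality => j; rewrite /fr H. Qed.

Ltac fr_tac :=
  apply: fr_eq => ?; repeat (rewrite nth_set_nth /=);
  repeat match goal with |- context [?x == ?y] =>
    let H := fresh in case: (x =P y) => H /=; try congruence end.

Lemma fr_shift s b ws ws' : fr s b (ws ++ ws') = fr (fr s b ws) (b + size ws) ws'.
Proof.
apply: functional_extensionality => j; rewrite /fr nth_cat.
by case: (ltnP j b) => H1; case: (ltnP j (b + size ws)) => H2;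
  case: (ltnP (j - b) (size ws)) => H3 //; try lia; rewrite subnDA.
Qed.

Definition branch i (F : 'I_3 -> com) :=
  If i (Some sym0) (F sym0) (If i (Some sym1) (F sym1) (F symH)).

Lemma runs_branch i F s a w T s' : s i = a :: w ->
  runs (F a) s T s' -> runs (branch i F) s (T + 4) s'.
Proof.
move=> E; have Eh : ohead (s i) = Some a by rewrite E.
case: a {E} Eh => [[|[|[|//]]] Ha] Eh.
- rewrite (_ : Ordinal Ha = sym0) in Eh *; last exact: val_inj.
  by move=> H; apply: runs_le (runs_then _ Eh H); lia.
- rewrite (_ : Ordinal Ha = sym1) in Eh *; last exact: val_inj.
  move=> H; apply: runs_le (runs_else _ _ (runs_then _ Eh H)); rewrite ?Eh //; lia.
- rewrite (_ : Ordinal Ha = symH) in Eh *; last exact: val_inj.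
  move=> H; apply: runs_le (runs_else _ _ (runs_else _ _ H)); rewrite ?Eh //; lia.
Qed.

Lemma runs_wb i F a w s1 s2 s3 T1 T2 : s1 i = a :: w -> runs (F a) s1 T1 s2 ->
  runs (While i (branch i F)) s2 T2 s3 ->
  runs (While i (branch i F)) s1 (T1 + T2 + 6) s3.
Proof.
move=> E H1 H2; apply: runs_le (runs_loop _ (runs_branch E H1) H2); first lia.
by rewrite E.
Qed.

Definition mv i j := While i (branch i (fun a => Seq (Pop i) (Push j a))).
Definition mv2 k i j :=
  While k (branch k (fun a => Seq (Pop k) (Seq (Push i a) (Push j a)))).
Definition clr i := While i (Pop i).
Definition pushes i w := foldr (fun a c => Seq c (Push i a)) Skip w.

Lemma runs_mv s b ws i j : i != j ->
  runs (mv (b + i) (b + j)) (fr s b ws) (9 * size (nth [::] ws i) + 1)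
    (fr s b (set_nth [::] (set_nth [::] ws i [::]) j
                     (catrev (nth [::] ws i) (nth [::] ws j)))).
Proof.
move=> ne; move E: (nth _ _ i) => w; elim: w ws E => [|a w IH] ws E.
  rewrite (@fr_eq _ _ _ ws); first by apply: runs_le (runs_done _ _); rewrite ?fr_at // E.
  by move=> k; rewrite !nth_set_nth /= ?nth_set_nth /=; do 2?[case: eqP => [->|_]]; rewrite ?E.
apply: (@runs_le _ _ (1 + 1 + (9 * size w + 1) + 6)); first by rewrite /=; lia.
eapply runs_wb with (a := a) (w := w); first by rewrite fr_at.
  eapply runs_seq; [exact: runs_pop|exact: runs_push].
  rewrite !fr_upd !fr_at !nth_set_nth /= eq_sym (negPf ne).
  set ws1 := set_nth _ _ j _; have E1 : nth [::] ws1 i = w.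
    by rewrite /ws1 !nth_set_nth /= (negPf ne) ?nth_set_nth /= ?eqxx ?E.
  by apply: runs_to (IH ws1 E1) _ _ => //; rewrite {IH E1}/ws1; fr_tac.
Qed.

Lemma runs_mv2 s b ws k i j : i != j -> k != i -> k != j ->
  runs (mv2 (b + k) (b + i) (b + j)) (fr s b ws) (10 * size (nth [::] ws k) + 1)
    (fr s b (set_nth [::] (set_nth [::] (set_nth [::] ws k [::]) i
        (catrev (nth [::] ws k) (nth [::] ws i))) j
        (catrev (nth [::] ws k) (nth [::] ws j)))).
Proof.
move=> ne n1 n2; move E: (nth _ _ k) => w; elim: w ws E => [|a w IH] ws E.
  rewrite (@fr_eq _ _ _ ws); first by apply: runs_le (runs_done _ _); rewrite ?fr_at // E.
  by move=> l; rewrite !nth_set_nth /= !nth_set_nth /= !nth_set_nth /=; do 3?[case: eqP => [->|_]]; rewrite ?E.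
pose ws1 := set_nth [::] (set_nth [::] (set_nth [::] ws k w) i
  (a :: nth [::] ws i)) j (a :: nth [::] ws j).
have E1 : nth [::] ws1 k = w.
  by rewrite /ws1; do 3!rewrite ?nth_set_nth /= ?(negPf n1) ?(negPf n2) ?eqxx.
have step : runs (Seq (Pop (b + k)) (Seq (Push (b + i) a) (Push (b + j) a)))
    (fr s b ws) (1 + (1 + 1)) (fr s b ws1).
  eapply runs_to; [eapply runs_seq; [exact: runs_pop|eapply runs_seq; exact: runs_push]| |by []].
  rewrite !fr_upd !fr_at /ws1 E; move/eqP: ne => ?; move/eqP: n1 => ?; move/eqP: n2 => ?; fr_tac.
apply: (@runs_le _ _ (1 + (1 + 1) + (10 * size w + 1) + 6)); first by rewrite /=; lia.
eapply runs_wb with (a := a) (w := w); [by rewrite fr_at|exact: step|].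
by apply: runs_to (IH ws1 E1) _ _ => //; rewrite {IH E1 step}/ws1; fr_tac.
Qed.

Lemma runs_clr s b ws i :
  runs (clr (b + i)) (fr s b ws) (3 * size (nth [::] ws i) + 1)
    (fr s b (set_nth [::] ws i [::])).
Proof.
move E: (nth _ _ i) => w; elim: w ws E => [|a w IH] ws E.
  rewrite (@fr_eq _ _ _ ws); first by apply: runs_le (runs_done _ _); rewrite ?fr_at // E.
  by move=> l; rewrite !nth_set_nth /=; case: eqP => [->|_]; rewrite ?E.
apply: (@runs_le _ _ (1 + (3 * size w + 1) + 2)); first by rewrite /=; lia.
eapply runs_loop; first by rewrite fr_at E.
  exact: runs_pop.
  rewrite fr_at !fr_upd E /=; set ws1 := set_nth _ _ _ w.
  have E1 : nth [::] ws1 i = w by rewrite /ws1 !nth_set_nth /= eqxx.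
  by apply: runs_to (IH ws1 E1) _ _ => //; rewrite {IH E1}/ws1; fr_tac.
Qed.

Lemma runs_pushes s b ws i w :
  runs (pushes (b + i) w) (fr s b ws) (size w)
    (fr s b (set_nth [::] ws i (w ++ nth [::] ws i))).
Proof.
elim: w => [|a w IH] /=.
  rewrite (@fr_eq _ _ _ ws); first exact: runs_skip.
  by move=> l; rewrite !nth_set_nth /=; case: eqP => [->|].
eapply runs_to; [eapply runs_seq; [exact: IH|exact: runs_push]| |lia].
rewrite fr_upd fr_at nth_set_nth /= eqxx; fr_tac.
Qed.


Definition skip1 i k m :=
  Seq (Push k sym1) (While k (Seq (Pop k)
    (If i (Some sym0) (Seq (Pop i) (Push m sym0))
       (Seq (Pop i) (Seq (Push m sym1) (Seq (Push k sym1) (Push k sym1))))))).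

(* Stack [k] counts in unary the subtrees still to be read from stack [i]. *)
Lemma runs_skip1 s i k m t x : i != k -> i != m -> k != m ->
  s k = [::] -> s i = fl t ++ x ->
  runs (skip1 i k m) s (12 * tsz t + 2) (upd (upd s i x) m (catrev (fl t) (s m))).
Proof.
move=> nik nim nkm Hk Hi.
pose st x c y := upd (upd (upd s i x) k c) m y.
have sti x' c y : st x' c y i = x' by rewrite /st /upd (negPf nim) (negPf nik) eqxx.
have stk x' c y : st x' c y k = c by rewrite /st /upd (negPf nkm) eqxx.
have stm x' c y : st x' c y m = y by rewrite /st /upd eqxx.
have ui x' c y z : upd (st x' c y) i z = st z c y.
  apply: functional_extensionality => j; rewrite /st /upd.
  by case: (j =P i) => // ->; rewrite (negPf nim) (negPf nik).
have uk x' c y z : upd (st x' c y) k z = st x' z y.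
  apply: functional_extensionality => j; rewrite /st /upd.
  by case: (j =P k) => // ->; rewrite (negPf nkm).
have um x' c y z : upd (st x' c y) m z = st x' c z.
  by apply: functional_extensionality => j; rewrite /st /upd; case: (j =P m).
rewrite /skip1; set body := (X in While k X); pose loop := While k body.
(* In continuation style: the rest of the run, of cost [T], is given, and reading [u] is put in
   front of it. This lets the two subtrees of a node be chained. *)
have main u : forall x' c y T s', runs loop (st x' c (catrev (fl u) y)) T s' ->
    runs loop (st (fl u ++ x') (sym1 :: c) y) (T + 12 * tsz u) s'.
  elim: u => [|l IHl r IHr] x' c y T s' H.
    eapply runs_le; last (eapply runs_loop; [by rewrite stk| |exact: H]).
      instantiate (1 := 1 + (1 + 1 + 2)); rewrite /tsz /=; lia.
    eapply runs_seq; [exact: runs_pop|rewrite stk uk].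
    apply: runs_then; first by rewrite sti.
    eapply runs_to; [eapply runs_seq; [exact: runs_pop|exact: runs_push]| |by []].
    by rewrite sti ui stm um.
  eapply runs_le; last (eapply runs_loop; [by rewrite stk| |]).
  - instantiate (1 := (T + 12 * tsz r) + 12 * tsz l).
    instantiate (1 := 1 + (1 + (1 + (1 + 1)) + 2)); rewrite tsz_node; lia.
  - eapply runs_seq; [exact: runs_pop|rewrite stk uk].
    apply: runs_else; first by rewrite sti.
    eapply runs_seq; [exact: runs_pop|rewrite sti ui].
    eapply runs_seq; [exact: runs_push|rewrite stm um].
    eapply runs_seq; [exact: runs_push|rewrite stk uk; exact: runs_push].
  - rewrite /= stk uk -catA; apply: IHl; apply: IHr.
    by rewrite /= catrev_catl in H.
have := main t x [::] (s m) 1 (st x [::] (catrev (fl t) (s m))) (runs_done _ (stk _ _ _)).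
rewrite -Hi => H.
eapply runs_to; first (eapply runs_seq; [exact: runs_push|]).
- suff -> : upd s k (sym1 :: s k) = st (s i) [:: sym1] (s m) by exact: H.
  rewrite Hk; apply: functional_extensionality => j; rewrite /st /upd.
  by case: (j =P m) => [->|]; rewrite ?(negPf nkm) 1?eq_sym ?(negPf nkm) //;
    case: (j =P k) => // _; case: (j =P i) => // ->.
- apply: functional_extensionality => j; rewrite /st /upd.
  by case: (j =P m) => // _; case: (j =P k) => // ->; rewrite eq_sym (negPf nik).
- lia.
Qed.

(* The registers above [b] serve as scratch space: they are empty before and after. *)
Definition computes (c : nat -> com) (p : pexp) (t u : tree) :=
  forall b s, runs (c b) (fr s b [:: fl t]) (ev p (tsz t)) (fr s b [:: fl u]).

(** A run pushes at most one letter per step, so every time bound is also a size bound; composition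
    rests on this. *)
Lemma computes_size c p t u : computes c p t u -> tsz u <= tsz t + ev p (tsz t).
Proof.
move=> /(_ 0 (fun=> [::])) [n Hn /(exec_grow 0)]; rewrite /fr /= => H.
by apply: leq_trans H _; rewrite leq_add2l.
Qed.

Lemma computes_at c p t u s b ws : computes c p t u ->
  runs (c (b + size ws)) (fr s b (ws ++ [:: fl t])) (ev p (tsz t))
    (fr s b (ws ++ [:: fl u])).
Proof. by move=> H; rewrite !fr_shift; apply: H. Qed.

Ltac trim := by apply: fr_eq => [[|[|[|[|[|[|?]]]]]]]; rewrite /= ?nth_nil.

Definition cp i j k := Seq (mv i k) (mv2 k i j).

Lemma runs_cp1 s b x : runs (cp (b + 0) (b + 1) (b + 2)) (fr s b [:: x])
   (20 * size x + 2) (fr s b [:: x; x]).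
Proof.
eapply runs_to; first (eapply runs_seq; [exact: runs_mv|exact: runs_mv2]).
  by rewrite /= !catrevE !cats0 !revK; trim.
by rewrite /= catrevE cats0 size_rev; lia.
Qed.

Lemma runs_mv' s b ws i j ws' T : i != j ->
  fr s b (set_nth [::] (set_nth [::] ws i [::]) j
                     (catrev (nth [::] ws i) (nth [::] ws j))) = fr s b ws' ->
  9 * size (nth [::] ws i) + 1 <= T ->
  runs (mv (b + i) (b + j)) (fr s b ws) T (fr s b ws').
Proof. by move=> ne E H; apply: runs_to E H; apply: runs_mv. Qed.

Lemma runs_at c p t u s b ws k : computes c p t u -> k = size ws ->
  runs (c (b + k)) (fr s b (ws ++ [:: fl t])) (ev p (tsz t)) (fr s b (ws ++ [:: fl u])).
Proof. by move=> H ->; apply: computes_at. Qed.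

Lemma computes_comp c1 p1 c2 p2 t u v : computes c1 p1 t u -> computes c2 p2 u v ->
  computes (fun b => Seq (c1 b) (c2 b)) (PA p1 (psubst p2 (PA PX p1))) t v.
Proof.
move=> H1 H2 b s; apply: runs_le (runs_seq (H1 b s) (H2 b s)).
by rewrite /= ev_psubst /= leq_add2l ev_mono // (computes_size H1).
Qed.

(** Each subprogram must find its argument in the topmost register in use, with the other tree saved
    below it. Every transfer takes two moves because [mv] reverses. *)
Definition pairc (c1 c2 : nat -> com) b :=
  Seq (cp (b + 0) (b + 1) (b + 2)) (Seq (c1 (b + 1))
  (Seq (mv (b + 1) (b + 2)) (Seq (mv (b + 0) (b + 3)) (Seq (mv (b + 3) (b + 1))
  (Seq (mv (b + 2) (b + 0)) (Seq (c2 (b + 1))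
  (Seq (mv (b + 0) (b + 2)) (Seq (mv (b + 1) (b + 3)) (Seq (mv (b + 3) (b + 0))
  (Seq (mv (b + 2) (b + 0)) (Push (b + 0) sym1))))))))))).

Ltac mvstep := eapply runs_seq;
  [eapply runs_mv'; [by []|rewrite /= ?catrevE ?cats0 ?revK; reflexivity|exact: leqnn]|].


(** The factor is merely generous: it absorbs the constant number of linear passes that the macros
    make over their data. *)
Definition lin (p : pexp) : pexp := PM (PC 100) (PA p (PC 1)).

Lemma computes_pair c1 p1 c2 p2 t u v : computes c1 p1 t u -> computes c2 p2 t v ->
  computes (pairc c1 c2) (lin (PA PX (PA p1 p2))) t (Node u v).
Proof.
move=> H1 H2 b s.
eapply runs_to; first (eapply runs_seq; [exact: runs_cp1|]).
eapply runs_seq; first exact: (runs_at (ws := [:: _]) s b H1 erefl).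
rewrite /=.
mvstep. mvstep. mvstep. mvstep.
rewrite (_ : fr s b _ = fr s b [:: fl u; fl t]); last trim.
eapply runs_seq; first exact: (runs_at (ws := [:: _]) s b H2 erefl).
rewrite /=; mvstep. mvstep. mvstep. mvstep. exact: runs_push.
  by rewrite fr_upd fr_at /=; trim.
have := computes_size H1; have := computes_size H2.
rewrite /= !size_rev -!/(tsz _); lia.
Qed.

Lemma runs_skipf s b ws i k m t x : i != k -> i != m -> k != m ->
  nth [::] ws k = [::] -> nth [::] ws i = fl t ++ x ->
  runs (skip1 (b + i) (b + k) (b + m)) (fr s b ws) (12 * tsz t + 2)
    (fr s b (set_nth [::] (set_nth [::] ws i x) m (catrev (fl t) (nth [::] ws m)))).
Proof.
move=> n1 n2 n3 Hk Hi; rewrite -!fr_upd -(fr_at s b ws m).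
by apply: runs_skip1; rewrite ?eqn_add2l ?fr_at.
Qed.

Ltac skipstep := eapply runs_seq; [eapply runs_skipf;
  [by []|by []|by []|by []|rewrite /= ?cats0; reflexivity]|].
Ltac clrstep := eapply runs_seq; [exact: runs_clr|].
Ltac popstep := eapply runs_seq; [exact: runs_pop|rewrite fr_upd fr_at].

Definition constc v (b : nat) := Seq (clr (b + 0)) (pushes (b + 0) (fl v)).

Lemma computes_const v t : computes (constc v) (lin (PA PX (PC (tsz v)))) t v.
Proof.
move=> b s; eapply runs_to; first (clrstep; exact: runs_pushes).
  by rewrite /= cats0; trim.
rewrite /= -/(tsz t) -/(tsz v); lia.
Qed.

Definition thd t := if t is Node l _ then l else Leaf.
Definition ttl t := if t is Node _ r then r else Leaf.
Definition isnode t := if t is Node _ _ then true else false.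

Definition hdc b :=
  If (b + 0) (Some sym1) (Seq (Pop (b + 0)) (Seq (skip1 (b + 0) (b + 1) (b + 2))
    (Seq (clr (b + 0)) (mv (b + 2) (b + 0))))) Skip.
Definition tlc b :=
  If (b + 0) (Some sym1) (Seq (Pop (b + 0)) (Seq (skip1 (b + 0) (b + 1) (b + 2))
    (clr (b + 2)))) Skip.

Lemma computes_hd t : computes hdc (lin PX) t (thd t).
Proof.
move=> b s; case: t => [|l r].
  by apply: runs_le (runs_else _ _ (runs_skip _)); rewrite ?fr_at.
eapply runs_to; first (apply: runs_then; first by rewrite fr_at).
- popstep; skipstep; rewrite /=; clrstep; exact: runs_mv.
- by rewrite /= !catrevE !cats0 revK; trim.
- by rewrite /= tsz_node catrevE cats0 size_rev -!/(tsz _); lia.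
Qed.

Lemma computes_tl t : computes tlc (lin PX) t (ttl t).
Proof.
move=> b s; case: t => [|l r].
  by apply: runs_le (runs_else _ _ (runs_skip _)); rewrite ?fr_at.
eapply runs_to; first (apply: runs_then; first by rewrite fr_at).
- popstep; skipstep; rewrite /=; exact: runs_clr.
- by rewrite /=; trim.
- by rewrite /= tsz_node catrevE cats0 size_rev -!/(tsz _); lia.
Qed.

Definition ifc (c f g : nat -> com) b :=
  Seq (cp (b + 0) (b + 1) (b + 2)) (Seq (c (b + 1))
   (If (b + 1) (Some sym1) (Seq (clr (b + 1)) (f (b + 0)))
      (Seq (clr (b + 1)) (g (b + 0))))).

Lemma computes_if c pc f pf g pg t w u : computes c pc t w ->
  (isnode w -> computes f pf t u) -> (~~ isnode w -> computes g pg t u) ->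
  computes (ifc c f g) (lin (PA PX (PA pc (PA pf pg)))) t u.
Proof.
move=> Hc Hf Hg b s.
have Hw := computes_size Hc.
have H : runs (If (b + 1) (Some sym1) (Seq (clr (b + 1)) (f (b + 0)))
      (Seq (clr (b + 1)) (g (b + 0)))) (fr s b [:: fl t; fl w])
    (3 * tsz w + 1 + (ev pf (tsz t) + ev pg (tsz t)) + 2) (fr s b [:: fl u]).
  have E w' : fr s b (set_nth [::] [:: fl t; w'] 1 [::]) = fr s b [:: fl t] by trim.
  case: w {Hw Hc} Hf Hg => [|l r] Hf Hg.
    apply: runs_else; first by rewrite fr_at.
    eapply runs_le; last (clrstep; rewrite E; exact: (runs_at (ws := [::]) s b (Hg isT) erefl)).
    by rewrite leq_add2l leq_addl.
  apply: runs_then; first by rewrite fr_at.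
  eapply runs_le; last (clrstep; rewrite E; exact: (runs_at (ws := [::]) s b (Hf isT) erefl)).
  by rewrite leq_add2l leq_addr.
eapply runs_le; last (eapply runs_seq; [exact: runs_cp1|]).
  2: by eapply runs_seq; [exact: (runs_at (ws := [:: _]) s b Hc erefl)|exact: H].
rewrite /= -/(tsz t); lia.
Qed.

(* Both truth values have the same size, so that the size of a coded numeral is
   an affine function of its number of bits. *)
Definition btree (x : bool) :=
  if x then Node Leaf (Node Leaf Leaf) else Node (Node Leaf Leaf) Leaf.

Definition setc b w := Seq (clr (b + 0)) (Seq (clr (b + 2)) (pushes (b + 0) w)).

(** The loop never pops register [b + 0], which collects mismatched letters of the right tree;
    unmatched letters of the left tree remain in [b + 2]. The trees agree iff both registers end
    empty. *)
Definition eqc b :=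
  If (b + 0) (Some sym1)
  (Seq (Pop (b + 0)) (Seq (skip1 (b + 0) (b + 1) (b + 2)) (Seq (mv (b + 0) (b + 1))
  (Seq (While (b + 1) (branch (b + 1) (fun a =>
          Seq (Pop (b + 1)) (If (b + 2) (Some a) (Pop (b + 2)) (Push (b + 0) a)))))
  (If (b + 0) None (If (b + 2) None (setc b (fl (btree true))) (setc b (fl (btree false))))
    (setc b (fl (btree false)))))))) Skip.

Lemma runs_eqloop s b w z y : exists z' y',
  [/\ runs (While (b + 1) (branch (b + 1) (fun a =>
          Seq (Pop (b + 1)) (If (b + 2) (Some a) (Pop (b + 2)) (Push (b + 0) a)))))
        (fr s b [:: z; w; y]) (10 * size w + 1) (fr s b [:: z'; [::]; y']),
      nilp z' && nilp y' = nilp z && (w == y),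
      size z' <= size z + size w & size y' <= size y].
Proof.
elim: w z y => [|a w IH] z y.
  exists z, y; split; rewrite ?leq_addr //; first by apply: runs_done; rewrite fr_at.
  by case: y.
case: y => [|a' y].
- have [z' [y' [H1 H2 H3 H4]]] := IH (a :: z) [::].
  exists z', y'; split; rewrite ?H2 ?andbF //; last by move: H3 => /=; lia.
  eapply runs_le; last (eapply runs_wb; [by rewrite fr_at| |]).
  + instantiate (1 := 10 * size w + 1); instantiate (1 := 1 + (1 + 2)); rewrite /=; lia.
  + popstep; apply: runs_else; [by rewrite fr_at|exact: runs_push].
  + by rewrite fr_upd fr_at.
- case: (eqVneq a a') => [<-|ne].
  + have [z' [y' [H1 H2 H3 H4]]] := IH z y.
    exists z', y'; split; rewrite ?H2 ?eqseq_cons ?eqxx // ?leqW //;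
      last by move: H3 => /=; lia.
    eapply runs_le; last (eapply runs_wb; [by rewrite fr_at| |]).
    * instantiate (1 := 10 * size w + 1); instantiate (1 := 1 + (1 + 2)); rewrite /=; lia.
    * popstep; apply: runs_then; [by rewrite fr_at|exact: runs_pop].
    * by rewrite fr_upd fr_at.
  + have [z' [y' [H1 H2 H3 H4]]] := IH (a :: z) (a' :: y).
    exists z', y'; split; rewrite ?H2 ?eqseq_cons ?(negPf ne) ?andbF //;
      last by move: H3 => /=; lia.
    eapply runs_le; last (eapply runs_wb; [by rewrite fr_at| |]).
    * instantiate (1 := 10 * size w + 1); instantiate (1 := 1 + (1 + 2)); rewrite /=; lia.
    * popstep; apply: runs_else; last exact: runs_push.
      by rewrite fr_at /= => -[] H; rewrite H eqxx in ne.
    * by rewrite fr_upd fr_at.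
Qed.

Lemma runs_setc s b z y w : runs (setc b w) (fr s b [:: z; [::]; y])
  (3 * size z + 3 * size y + size w + 2) (fr s b [:: w]).
Proof.
eapply runs_to; first (clrstep; clrstep; exact: runs_pushes).
  by rewrite /= cats0; trim.
rewrite /=; lia.
Qed.

Lemma computes_eq l r (e : bool) : e = true <-> l = r ->
  computes eqc (lin PX) (Node l r) (btree e).
Proof.
move=> He b s.
have [z' [y' [H1 H2 H3 H4]]] := runs_eqloop s b (rev (fl r)) [::] (rev (fl l)).
have Ee : nilp z' && nilp y' = e.
  rewrite H2 /=; apply/eqP/idP => [H|/He ->] //; apply/He/fl_inj.
  by rewrite -[LHS]revK -H revK.
rewrite size_rev /= in H3; rewrite size_rev in H4.
have H5 : runs (If (b + 0) None (If (b + 2) None (setc b (fl (btree true)))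
      (setc b (fl (btree false)))) (setc b (fl (btree false))))
    (fr s b [:: z'; [::]; y']) (3 * size z' + 3 * size y' + 13) (fr s b [:: fl (btree e)]).
  rewrite -Ee; case: z' {H1 H2 H3 Ee} => [|a z'] /=.
    apply: (@runs_le _ _ (3 * size y' + 9 + 2 + 2)); first by rewrite /=; lia.
    apply: runs_then; first by rewrite fr_at.
    case: y' {H4} => [|a y'] /=.
      apply: runs_then; first by rewrite fr_at.
      by apply: runs_le (runs_setc _ _ _ _ _); rewrite /=; lia.
    apply: runs_else; first by rewrite fr_at.
    by apply: runs_le (runs_setc _ _ _ _ _); rewrite /=; lia.
  apply: (@runs_le _ _ (3 * (size z').+1 + 3 * size y' + 8 + 2)); first lia.
  apply: runs_else; first by rewrite fr_at.
  by apply: runs_le (runs_setc _ _ _ _ _); rewrite /=; lia.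
eapply runs_to; first (apply: runs_then; first by rewrite fr_at).
- popstep; skipstep; rewrite /=; mvstep.
  eapply runs_seq; first exact: H1.
  exact: H5.
- by [].
- by rewrite /= tsz_node size_rev -!/(tsz _) in H3 H4 *; lia.
Qed.

Fixpoint slen t := if t is Node _ r then (slen r).+1 else 0.

Lemma slen_tsz t : slen t <= tsz t.
Proof. elim: t => //= l _ r IH; rewrite tsz_node; lia. Qed.

Definition iter_body (f : nat -> com) b :=
  If (b + 0) (Some sym1)
    (Seq (Pop (b + 0)) (Seq (skip1 (b + 0) (b + 2) (b + 3)) (Seq (clr (b + 3)) (f (b + 1)))))
    (Pop (b + 0)).

Definition iterc f b :=
  Seq (Pop (b + 0)) (Seq (skip1 (b + 0) (b + 1) (b + 2)) (Seq (mv (b + 0) (b + 3))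
  (Seq (mv (b + 2) (b + 0)) (Seq (mv (b + 3) (b + 1))
  (Seq (While (b + 0) (iter_body f b)) (Seq (mv (b + 1) (b + 2)) (mv (b + 2) (b + 0)))))))).

Lemma runs_iterloop f p s b l B y :
  (forall k, k < slen l -> computes f p (y k) (y k.+1)) ->
  (forall k, k <= slen l -> tsz (y k) <= B) ->
  runs (While (b + 0) (iter_body f b)) (fr s b [:: fl l; fl (y 0)])
    (15 * tsz l + slen l * (ev p B + 10) + 10) (fr s b [:: [::]; fl (y (slen l))]).
Proof.
elim: l y => [|a _ r IH] y Hy HB.
  eapply runs_to; first (eapply runs_loop; [by rewrite fr_at| |]).
  - apply: runs_else; [by rewrite fr_at|exact: runs_pop].
  - by rewrite fr_upd fr_at; apply: runs_done; rewrite fr_at.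
  - by [].
  - by [].
eapply runs_to; first (eapply runs_loop; [by rewrite fr_at| |]).
- apply: runs_then; first by rewrite fr_at.
  popstep; skipstep; rewrite /=; clrstep; rewrite /=.
  rewrite (_ : fr s b _ = fr s b [:: fl r; fl (y 0)]); last trim.
  exact: (runs_at (ws := [:: _]) s b (Hy 0 isT) erefl).
- rewrite /=; apply: (IH (fun k => y k.+1)) => k Hk; [exact: Hy|exact: HB].
- by [].
- have H0 : ev p (tsz (y 0)) <= ev p B by apply/ev_mono/HB.
  rewrite /= tsz_node catrevE cats0 size_rev -!/(tsz _); lia.
Qed.

Lemma computes_iter f p q l y :
  (forall k, k < slen l -> computes f p (y k) (y k.+1)) ->
  (forall k, k <= slen l -> tsz (y k) <= ev q (tsz (Node l (y 0)))) ->
  computes (iterc f) (lin (PA (PM PX (psubst p q)) (PA PX q))) (Node l (y 0)) (y (slen l)).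
Proof.
move=> Hy HB b s.
eapply runs_to.
- popstep; skipstep; rewrite /=. mvstep. mvstep. mvstep.
  rewrite (_ : fr s b _ = fr s b [:: fl l; fl (y 0)]); last trim.
  eapply runs_seq; first exact: (runs_iterloop s b Hy HB).
  mvstep. exact: runs_mv.
- by rewrite /= !catrevE !cats0 !revK; trim.
- rewrite /= ev_psubst !size_rev -!/(tsz _).
  have := HB _ (leqnn _); have := HB 0 isT; have := slen_tsz l.
  set B := ev q _; set P := ev p B; rewrite tsz_node => H1 H2 H3.
  have H4 : slen l * P <= tsz l * P by rewrite leq_mul2r H1 orbT.
  have H5 : tsz l * P <= (tsz l + tsz (y 0)).+1 * P by rewrite leq_mul2r; apply/orP; right; lia.
  rewrite mulnDr; lia.
Qed.


(** * Coded types and closure properties of polynomial time *)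

Class Coded (A : Type) := { code : A -> tree; code_inj : injective code }.

Lemma btree_inj : injective btree. Proof. by case; case. Qed.
#[export] Instance coded_bool : Coded bool := {| code := btree; code_inj := btree_inj |}.

Definition ltree (a : 'I_3) : tree :=
  match val a with 0 => Leaf | 1 => Node Leaf Leaf | _ => Node (Node Leaf Leaf) Leaf end.
Lemma ltree_inj : injective ltree.
Proof.
by move=> [[|[|[|//]]] Ha] [[|[|[|//]]] Hb] // _; apply: val_inj.
Qed.
#[export] Instance coded_letter : Coded 'I_3 := {| code := ltree; code_inj := ltree_inj |}.

Section Pairs.
Context {A B : Type} {cA : Coded A} {cB : Coded B}.
Definition ptree (x : A * B) := Node (code x.1) (code x.2).
Lemma ptree_inj : injective ptree.
Proof.
by move=> [a b] [a' b'] [Ha Hb]; rewrite (code_inj Ha) (code_inj Hb).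
Qed.
Fixpoint stree (s : seq A) := if s is a :: s' then Node (code a) (stree s') else Leaf.
Lemma stree_inj : injective stree.
Proof. by elim=> [|a s IH] [|b s'] //= [Ha /IH ->]; rewrite (code_inj Ha). Qed.
End Pairs.
#[export] Instance coded_prod A B (cA : Coded A) (cB : Coded B) : Coded (A * B) :=
  {| code := ptree; code_inj := ptree_inj |}.
#[export] Instance coded_seq A (cA : Coded A) : Coded (seq A) :=
  {| code := stree; code_inj := stree_inj |}.

Definition csize {A} {cA : Coded A} (x : A) := tsz (code x).

Definition PT {A B} {cA : Coded A} {cB : Coded B} (f : A -> B) :=
  exists c p, forall x, computes c p (code x) (code (f x)).

Lemma csize_pair A B {cA : Coded A} {cB : Coded B} (a : A) (b : B) :
  csize (a, b) = (csize a + csize b).+1.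
Proof. exact: tsz_node. Qed.
Lemma csize_cons A {cA : Coded A} (a : A) s : csize (a :: s) = (csize a + csize s).+1.
Proof. exact: tsz_node. Qed.
Lemma csize_nil A {cA : Coded A} : csize (Nil A) = 1. Proof. by []. Qed.
Lemma csize_bool (x : bool) : csize x = 5. Proof. by case: x. Qed.
Lemma slen_code A {cA : Coded A} (s : seq A) : slen (code s) = size s.
Proof. by elim: s => //= a s ->. Qed.
Lemma size_csize A {cA : Coded A} (s : seq A) : size s <= csize s.
Proof. by rewrite -slen_code slen_tsz. Qed.

Section Basic1.
Context {X A B C : Type} {cX : Coded X} {cA : Coded A} {cB : Coded B} {cC : Coded C}.

Lemma PT_csize (f : X -> A) : PT f -> exists q, forall x, csize (f x) <= ev q (csize x).
Proof. by case=> c [p H]; exists (PA PX p) => x; apply: computes_size (H x). Qed.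

(** Programs see only codes. Types that share codes, such as numbers and their digit lists or pairs
    and nonempty lists, are thus exchanged at no cost. *)
Lemma PT_recode (f : X -> A) (g : X -> B) :
  (forall x, code (f x) = code (g x)) -> PT f -> PT g.
Proof. by move=> E [c [p H]]; exists c, p => x; rewrite -E. Qed.

End Basic1.

Section Basic2.
Context {X A B C : Type} {cX : Coded X} {cA : Coded A} {cB : Coded B} {cC : Coded C}.

Lemma PT_ext (f g : X -> A) : f =1 g -> PT f -> PT g.
Proof. by move=> E; apply: PT_recode => x; rewrite E. Qed.

Lemma PT_id : PT (fun x : X => x).
Proof. by exists (fun=> Skip), (PC 0) => x b s; apply: runs_skip. Qed.

Lemma PT_comp (g : A -> B) (f : X -> A) : PT g -> PT f -> PT (fun x => g (f x)).
Proof.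
move=> [c1 [p1 H1]] [c2 [p2 H2]]; eexists; eexists => x; exact: computes_comp.
Qed.

End Basic2.

Section Basic3.
Context {X A B C : Type} {cX : Coded X} {cA : Coded A} {cB : Coded B} {cC : Coded C}.

Lemma PT_const (v : A) : PT (fun _ : X => v).
Proof. by eexists; eexists => x; apply: computes_const. Qed.

Lemma PT_pair (f : X -> A) (g : X -> B) : PT f -> PT g -> PT (fun x => (f x, g x)).
Proof.
move=> [c1 [p1 H1]] [c2 [p2 H2]]; eexists; eexists => x; exact: computes_pair.
Qed.

Lemma PT_fst (f : X -> A * B) : PT f -> PT (fun x => (f x).1).
Proof.
move=> [c [p H]]; eexists; eexists => x; apply: computes_comp (H x) _.
exact: computes_hd.
Qed.

Lemma PT_snd (f : X -> A * B) : PT f -> PT (fun x => (f x).2).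
Proof.
move=> [c [p H]]; eexists; eexists => x; apply: computes_comp (H x) _.
exact: computes_tl.
Qed.

Lemma PT_if (c : X -> bool) (f g : X -> A) :
  PT c -> PT f -> PT g -> PT (fun x => if c x then f x else g x).
Proof.
move=> [c1 [p1 H1]] [c2 [p2 H2]] [c3 [p3 H3]].
eexists (ifc _ c2 c3), _ => x.
(* Both truth values are coded by nodes, so the test is made on the tail, which is a node only for
   [true]. *)
by apply: (computes_if (computes_comp (H1 x) (computes_tl _))); rewrite /=; case: (c x).
Qed.

End Basic3.

Section Basic4.
Context {X A B C : Type} {cX : Coded X} {cA : Coded A} {cB : Coded B} {cC : Coded C}.

Lemma PT_cons (f : X -> A) (g : X -> seq A) : PT f -> PT g -> PT (fun x => f x :: g x).
Proof. move=> Hf Hg.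
by apply (PT_recode (f := fun x => (f x, g x))); [|apply: PT_pair]. Qed.

Lemma PT_behead (f : X -> seq A) : PT f -> PT (fun x => behead (f x)).
Proof.
move=> [c [p H]]; eexists; eexists => x; apply: computes_comp (H x) _.
rewrite (_ : code (behead (f x)) = ttl (code (f x))); first exact: computes_tl.
by case: (f x).
Qed.

(** The code of [a :: s] is literally that of [(a, s)], so the scrutinee serves unchanged as the
    argument of the second branch. *)
Lemma PT_case (l : X -> seq A) (f : X -> B) (g : X * (A * seq A) -> B) :
  PT l -> PT f -> PT g -> PT (fun x => if l x is a :: s then g (x, (a, s)) else f x).
Proof.
move=> [c1 [p1 H1]] [c2 [p2 H2]] [c3 [p3 H3]].
have [c [p H]] := @PT_id X _.
pose pp := lin (PA PX (PA p p1)).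
exists (ifc c1 (fun b => Seq (pairc c c1 b) (c3 b)) c2),
  (lin (PA PX (PA p1 (PA (PA pp (psubst p3 (PA PX pp))) p2)))) => x.
move: (H1 x) (H2 x); case: (l x) => [|a s] Hl Hf; apply: (computes_if Hl) => // _.
by apply: computes_comp (H3 (x, (a, s))); apply: computes_pair.
Qed.

(** By injectivity of codes, the single letterwise comparison [eqc] decides equality at every coded
    type. *)
Lemma PT_eq (E : eqType) {cE : Coded E} (f g : X -> E) :
  PT f -> PT g -> PT (fun x => f x == g x).
Proof.
move=> Hf Hg; have [c [p H]] := PT_pair Hf Hg; eexists; eexists => x.
apply: computes_comp (H x) _; apply: computes_eq.
by split=> [/eqP -> //|H']; apply/eqP/code_inj.
Qed.

End Basic4.

Lemma PT_iter X B C {cX : Coded X} {cB : Coded B} {cC : Coded C}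
    (g : X -> seq C) (i : X -> B) (f : X -> B -> B) q :
  PT g -> PT i -> PT (fun z : X * B => f z.1 z.2) ->
  (forall x k, k <= size (g x) -> csize (iter k (f x) (i x)) <= ev q (csize x)) ->
  PT (fun x => iter (size (g x)) (f x) (i x)).
Proof.
move=> Hg Hi Hf Hq.
have [c1 [p1 H1]] := PT_pair Hg (PT_pair (@PT_id X _) Hi).
have [c [p H]] := PT_pair (PT_fst (@PT_id (X * B) _)) Hf.
(* The loop body receives one tree only, so the parameter [x] has to travel with the state. *)
enough (H' : PT (fun x => (x, iter (size (g x)) (f x) (i x)))) by exact (PT_snd H').
eexists; eexists => x; apply: computes_comp (H1 x) _.
rewrite -(slen_code (g x)).
apply: (@computes_iter _ p (PA PX (PA q (PC 1))) _
  (fun k => code (x, iter k (f x) (i x)))) => k Hk.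
  exact: H.
rewrite slen_code in Hk; have Hk' := Hq x k Hk.
have E1 : csize (x, iter k (f x) (i x)) = (csize x + csize (iter k (f x) (i x))).+1.
  exact: csize_pair.
have E2 : csize (g x, (x, i x)) = (csize (g x) + (csize x + csize (i x)).+1).+1.
  by rewrite !csize_pair.
have H3 : ev q (csize x) <= ev q (csize (g x, (x, i x))) by apply: ev_mono; lia.
change (csize (x, iter k (f x) (i x)) <= ev (PA PX (PA q (PC 1))) (csize (g x, (x, i x)))).
rewrite E1 /= E2 in H3 *; lia.
Qed.

(** A round may enlarge the accumulator by an amount that does not depend on the accumulator; summed
    over the list this stays polynomial. The remaining list is part of the loop state. *)
Lemma PT_foldl X A B {cX : Coded X} {cA : Coded A} {cB : Coded B}
    (l : X -> seq A) (i : X -> B) (h : X -> B -> A -> B) q :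
  PT l -> PT i -> PT (fun z : X * (B * A) => h z.1 z.2.1 z.2.2) ->
  (forall x b a, csize (h x b a) <= csize b + ev q (csize x + csize a)) ->
  PT (fun x => foldl (h x) (i x) (l x)).
Proof.
move=> Hl Hi Hh Hq.
pose f x (z : seq A * B) := if z.1 is a :: s then (s, h x z.2 a) else z.
have Ef x k s b : iter k (f x) (s, b) = (drop k s, foldl (h x) b (take k s)).
  elim: k s b => [|k IH] s b; first by rewrite drop0 take0.
  by rewrite iterSr {1}/f; case: s => [|a s] /=; rewrite IH.
have Hs x s b : csize (foldl (h x) b s) <= csize b + size s * ev q (csize x + csize s).
  elim: s b => [|a s IH] b; first by rewrite addn0.
  rewrite [foldl _ _ _]/=; apply: leq_trans (IH _) _; rewrite mulSn addnA.
  apply: leq_add; last by rewrite leq_mul2l ev_mono ?orbT // csize_cons; lia.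
  by apply: leq_trans (Hq _ _ _) _; rewrite leq_add2l ev_mono // csize_cons; lia.
have Hcat (s : seq A) k : csize (drop k s) <= csize s /\ csize (take k s) <= csize s.
  elim: s k => [|a s IH] [|k] //=; rewrite ?csize_cons ?csize_nil //.
  have := IH k; lia.
have [ql Hql] := PT_csize Hl; have [qi Hqi] := PT_csize Hi.
apply: (@PT_ext _ _ _ _ (fun x => (iter (size (l x)) (f x) (l x, i x)).2)).
  by move=> x; rewrite Ef take_size.
apply: PT_snd.
apply: (@PT_iter _ _ _ _ _ _ l (fun x => (l x, i x)) f
   (PA (PC 1) (PA ql (PA qi (PM ql (psubst q (PA PX ql))))))) => //.
- exact: PT_pair.
- apply: (@PT_ext _ _ _ _ (fun z : X * (seq A * B) =>
    if z.2.1 is a :: s then (fun y => (y.2.2, h y.1.1 y.1.2.2 y.2.1)) (z, (a, s)) else z.2)).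
    by [].
  apply: (PT_case (g := fun y => (y.2.2, h y.1.1 y.1.2.2 y.2.1))).
  + exact/PT_fst/PT_snd/PT_id.
  + exact/PT_snd/PT_id.
  + apply: PT_pair; first exact/PT_snd/PT_snd/PT_id.
    apply: (PT_comp (g := fun z : X * (B * A) => h z.1 z.2.1 z.2.2)
      (f := fun y => (y.1.1, (y.1.2.2, y.2.1)))) => //.
    apply: PT_pair; first exact/PT_fst/PT_fst/PT_id.
    apply: PT_pair; first exact/PT_snd/PT_snd/PT_fst/PT_id.
    exact/PT_fst/PT_snd/PT_id.
- move=> x k Hk; rewrite Ef csize_pair /= ev_psubst /=.
  have [H1 H2] := Hcat (l x) k; have H3 := Hql x; have H4 := Hqi x.
  have H5 := Hs x (take k (l x)) (i x).
  have H6 : size (take k (l x)) * ev q (csize x + csize (take k (l x))) <=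
      ev ql (csize x) * ev q (csize x + ev ql (csize x)).
    apply: leq_mul; last by apply: ev_mono; lia.
    pose proof (size_csize (take k (l x))); lia.
  lia.
Qed.

Section Lists.
Context {X A B : Type} {cX : Coded X} {cA : Coded A} {cB : Coded B}.

Lemma PT_rev (l : X -> seq A) : PT l -> PT (fun x => rev (l x)).
Proof.
move=> Hl; apply: (@PT_ext _ _ _ _ (fun x => foldl (fun s a => a :: s) [::] (l x))).
  by move=> x; rewrite /rev; elim: (l x) [::] => /=.
apply: (@PT_foldl _ _ _ _ _ _ l (fun=> [::]) (fun _ s a => a :: s) (PA PX (PC 1))) => //.
- exact: PT_const.
- by apply: PT_cons; [exact/PT_snd/PT_snd/PT_id|exact/PT_fst/PT_snd/PT_id].
- move=> x s a; rewrite csize_cons /=; lia.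
Qed.

Lemma PT_foldr (l : X -> seq A) (i : X -> B) (h : X -> A -> B -> B) q :
  PT l -> PT i -> PT (fun z : X * (A * B) => h z.1 z.2.1 z.2.2) ->
  (forall x b a, csize (h x a b) <= csize b + ev q (csize x + csize a)) ->
  PT (fun x => foldr (h x) (i x) (l x)).
Proof.
move=> Hl Hi Hh Hq.
apply: (@PT_ext _ _ _ _ (fun x => foldl (fun b a => h x a b) (i x) (rev (l x)))).
  by move=> x; rewrite foldl_rev.
apply: (@PT_foldl _ _ _ _ _ _ (fun x => rev (l x)) i (fun x b a => h x a b) q) => //.
  exact: PT_rev.
apply: (PT_comp (g := fun z : X * (A * B) => h z.1 z.2.1 z.2.2)
  (f := fun y : X * (B * A) => (y.1, (y.2.2, y.2.1)))) => //.
apply: PT_pair; first exact/PT_fst/PT_id.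
by apply: PT_pair; [exact/PT_snd/PT_snd/PT_id|exact/PT_fst/PT_snd/PT_id].
Qed.

End Lists.


Lemma PT_app2 {X Y A B} {cX : Coded X} {cY : Coded Y} {cA : Coded A} {cB : Coded B}
    (f : X -> A -> B) (u : Y -> X) (v : Y -> A) :
  PT (fun z : X * A => f z.1 z.2) -> PT u -> PT v -> PT (fun y => f (u y) (v y)).
Proof. by move=> Hf Hu Hv; apply (PT_comp Hf (PT_pair Hu Hv)). Qed.

Lemma PT_app3 {X Y A B C} {cX : Coded X} {cY : Coded Y} {cA : Coded A} {cB : Coded B}
    {cC : Coded C} (f : X -> A -> B -> C) (u : Y -> X) (v : Y -> A) (w : Y -> B) :
  PT (fun z : X * (A * B) => f z.1 z.2.1 z.2.2) -> PT u -> PT v -> PT w ->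
  PT (fun y => f (u y) (v y) (w y)).
Proof. by move=> Hf Hu Hv Hw; apply (PT_comp Hf (PT_pair Hu (PT_pair Hv Hw))). Qed.

(** A hook, extended each time new closure lemmas become available, so that [pt] decomposes ever
    more functions along their syntax. *)
Ltac pt_ext := fail.
Ltac pt_step := first
  [ assumption
  | lazymatch goal with
    | |- PT (fun x => x) => apply PT_id
    | |- PT (fun _ => ?v) => apply PT_const
    | |- PT (fun x => fst (@?f x)) => apply PT_fst
    | |- PT (fun x => snd (@?f x)) => apply PT_snd
    | |- PT (fun x => pair (@?f x) (@?g x)) => apply PT_pair
    | |- PT (fun x => cons (@?f x) (@?g x)) => apply PT_cons
    | |- PT (fun x => behead (@?f x)) => apply PT_behead
    | |- PT (fun x => rev (@?f x)) => apply PT_rev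
    | |- PT (fun x => eq_op (@?f x) (@?g x)) => refine (PT_eq _ _)
    end
  | match goal with H : PT ?a |- PT (fun x => ?a _) => apply (PT_comp H) end
  | match goal with H : PT (fun z => ?f z.1 z.2) |- PT (fun x => ?f _ _) => apply (PT_app2 H) end
  | match goal with H : PT (fun z => ?f z.1 z.2.1 z.2.2) |- PT (fun x => ?f _ _ _) => apply (PT_app3 H) end
  | pt_ext
  | lazymatch goal with
    | |- PT (fun x => if _ then _ else _) => apply PT_if
    | |- PT (fun x => _) => fail
    | |- PT ?f => change (PT (fun x => f x))
    end ].
Ltac pt := cbn beta; repeat (pt_step; cbn beta).

Section Bool.
Context {X : Type} {cX : Coded X}.
Implicit Types p q : X -> bool.
Lemma PT_negb p : PT p -> PT (fun x => ~~ p x).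
Proof. by move=> Hp; apply (PT_ext (f := fun x => if p x then false else true)) => //; pt. Qed.
Lemma PT_andb p q : PT p -> PT q -> PT (fun x => p x && q x).
Proof. by move=> Hp Hq; apply (PT_ext (f := fun x => if p x then q x else false)) => //; pt. Qed.
Lemma PT_orb p q : PT p -> PT q -> PT (fun x => p x || q x).
Proof. by move=> Hp Hq; apply (PT_ext (f := fun x => if p x then true else q x)) => //; pt. Qed.
Lemma PT_implb p q : PT p -> PT q -> PT (fun x => p x ==> q x).
Proof. by move=> Hp Hq; apply (PT_ext (f := fun x => if p x then q x else true)) => //; pt. Qed.
End Bool.
Ltac pt_bool := lazymatch goal with
  | |- PT (fun x => negb _) => apply PT_negb
  | |- PT (fun x => andb _ _) => apply PT_andb
  | |- PT (fun x => orb _ _) => apply PT_orb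
  | |- PT (fun x => implb _ _) => apply PT_implb
  end.
Ltac pt_ext ::= pt_bool.

Section ListOps.
Context {X A B : Type} {cX : Coded X} {cA : Coded A} {cB : Coded B}.

Lemma PT_map (l : X -> seq A) (f : X -> A -> B) :
  PT l -> PT (fun z : X * A => f z.1 z.2) -> PT (fun x => map (f x) (l x)).
Proof.
move=> Hl Hf; have [q Hq] := PT_csize Hf.
apply (PT_ext (f := fun x => foldr (fun a s => f x a :: s) [::] (l x))).
  by move=> x; elim: (l x) => //= a s ->.
apply (PT_foldr (h := fun x a s => f x a :: s)
  (q := PA (PC 1) (psubst q (PA PX (PC 1))))); pt.
move=> x s a; rewrite csize_cons /= ev_psubst /=.
move: (Hq (x, a)); rewrite csize_pair /= addn1; lia.
Qed.

Lemma PT_filter (l : X -> seq A) (p : X -> A -> bool) :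
  PT l -> PT (fun z : X * A => p z.1 z.2) -> PT (fun x => filter (p x) (l x)).
Proof.
move=> Hl Hp.
apply (PT_foldr (h := fun x a s => if p x a then a :: s else s) (q := PA PX (PC 1))); pt.
by move=> x s a; case: ifP => _; rewrite ?csize_cons /=; lia.
Qed.

Lemma PT_has (l : X -> seq A) (p : X -> A -> bool) :
  PT l -> PT (fun z : X * A => p z.1 z.2) -> PT (fun x => has (p x) (l x)).
Proof.
move=> Hl Hp.
apply (PT_ext (f := fun x => foldr (fun a s => p x a || s) false (l x))).
  by move=> x; elim: (l x) => //= a s ->.
apply (PT_foldr (h := fun x a s => p x a || s) (q := PC 5)); pt.
move=> x s a; pose proof (csize_bool (p x a || s)); rewrite /=; lia.
Qed.

Lemma PT_all (l : X -> seq A) (p : X -> A -> bool) :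
  PT l -> PT (fun z : X * A => p z.1 z.2) -> PT (fun x => all (p x) (l x)).
Proof.
move=> Hl Hp.
apply (PT_ext (f := fun x => ~~ has (fun a => ~~ p x a) (l x))).
  by move=> x; rewrite -all_predC; apply: eq_all => a /=; rewrite negbK.
by apply/PT_negb/PT_has => //; pt.
Qed.

Lemma PT_cat (s t : X -> seq A) : PT s -> PT t -> PT (fun x => s x ++ t x).
Proof.
move=> Hs Ht.
apply (PT_ext (f := fun x => foldr (fun a s => a :: s) (t x) (s x))).
  by move=> x; elim: (s x) => //= a u ->.
apply (PT_foldr (h := fun x a s => a :: s) (q := PA PX (PC 1))); pt.
by move=> x u a; rewrite csize_cons /=; lia.
Qed.

Lemma csize_cat (s t : seq A) : csize (s ++ t) < csize s + csize t.
Proof. by elim: s => //= a s IH; rewrite !csize_cons; lia. Qed.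

Lemma PT_isnil (s : X -> seq A) : PT s -> PT (fun x => nilp (s x)).
Proof.
move=> Hs; apply (PT_ext (f := fun x => if s x is a :: s' then (fun=> false) (x, (a, s')) else true)).
  by move=> x; case: (s x).
by apply (PT_case (g := fun=> false)); pt.
Qed.

Lemma PT_head (d : X -> A) (s : X -> seq A) : PT d -> PT s -> PT (fun x => head (d x) (s x)).
Proof.
move=> Hd Hs; apply (PT_ext (f := fun x => if s x is a :: s' then (fun z => z.2.1) (x, (a, s')) else d x)).
  by move=> x; case: (s x).
by apply (PT_case (g := fun z => z.2.1)); pt.
Qed.
End ListOps.

Section ListOps2.
Context {X A : Type} {cX : Coded X} {cA : Coded A}.
Lemma PT_flatten (s : X -> seq (seq A)) : PT s -> PT (fun x => flatten (s x)).
Proof.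
move=> Hs.
apply (PT_foldr (h := fun x a s => a ++ s) (i := fun=> [::]) (q := PX)); pt.
  by apply PT_cat; pt.
move=> x u a; pose proof (csize_cat a u); rewrite /=; lia.
Qed.
End ListOps2.

Section EqListOps.
Context {X : Type} {A : eqType} {cX : Coded X} {cA : Coded A}.
Lemma PT_mem (a : X -> A) (s : X -> seq A) : PT a -> PT s -> PT (fun x => a x \in s x).
Proof.
move=> Ha Hs; apply (PT_ext (f := fun x => has (fun b => b == a x) (s x))).
  by move=> x; rewrite -[RHS](has_pred1 (a x)).
by apply PT_has; pt.
Qed.

End EqListOps.

Section EqListOps2.
Context {X : Type} {A : eqType} {cX : Coded X} {cA : Coded A}.
Lemma PT_undup (s : X -> seq A) : PT s -> PT (fun x => undup (s x)).
Proof.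
move=> Hs; apply (PT_ext (f := fun x => foldr (fun (a : A) (s : seq A) => if a \in s then s else a :: s) [::] (s x))).
  by move=> x; elim: (s x) => //= a u ->; rewrite mem_undup.
apply (PT_foldr (h := fun x (a : A) (s : seq A) => if a \in s then s else a :: s) (q := PA PX (PC 1))); pt.
  by apply PT_mem; pt.
by move=> x u a; case: ifP => _; rewrite ?csize_cons /=; lia.
Qed.
End EqListOps2.

Ltac pt_list := lazymatch goal with
  | |- PT (fun x => map _ _) => apply PT_map
  | |- PT (fun x => filter _ _) => apply PT_filter
  | |- PT (fun x => has _ _) => apply PT_has
  | |- PT (fun x => all _ _) => apply PT_all
  | |- PT (fun x => cat _ _) => apply PT_cat
  | |- PT (fun x => nilp _) => apply PT_isnil
  | |- PT (fun x => head _ _) => apply PT_head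
  | |- PT (fun x => flatten _) => apply PT_flatten
  | |- PT (fun x => in_mem _ (mem _)) => refine (PT_mem _ _)
  | |- PT (fun x => undup _) => refine (PT_undup _)
  end.
Ltac pt_ext ::= first [pt_bool | pt_list].


(** * Arithmetic on binary numerals *)

(* Least significant digit first, in spite of the name [binrev]. *)
Definition bits n := binrev n n.
(* Most significant digit first. *)
Definition msbv (s : seq bool) : nat := foldl (fun n (b : bool) => b + n.*2) 0 s.

Lemma binrev_fuel f n : n <= f -> binrev f n = bits n.
Proof.
rewrite /bits; elim: f {-2}f n (leqnn f) => [|k IH] f n Hf Hn.
  by move: Hf Hn; case: f => //; case: n.
case: f Hf Hn => [|f]; case: n => [|n] //= Hf Hn; congr cons.
rewrite IH; [|lia|lia]; rewrite (IH n) //; lia.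
Qed.

Lemma bitsE n : bits n = if n == 0 then [::] else odd n :: bits n./2.
Proof.
case: n => //= n; rewrite -[bits n.+1]/(odd n.+1 :: binrev n (uphalf n)).
by rewrite binrev_fuel //; lia.
Qed.

Lemma bits_cons (b : bool) n : bits (b + n.*2) = if b || (n != 0) then b :: bits n else [::].
Proof.
rewrite bitsE addn_eq0 double_eq0 eqb0 oddD odd_double addbF oddb half_bit_double.
by case: b => //=; case: (n == 0).
Qed.

Lemma msbv_rcons s b : msbv (rcons s b) = b + (msbv s).*2.
Proof. by rewrite /msbv foldl_rcons. Qed.

Lemma msbv_cons (b : bool) s : msbv (b :: s) = b * 2 ^ size s + msbv s.
Proof.
elim/last_ind: s => [|s c IH]; first by rewrite /msbv /= muln1 addn0.
by rewrite -rcons_cons !msbv_rcons IH size_rcons expnS; lia.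
Qed.

Lemma bitsK n : msbv (rev (bits n)) = n.
Proof.
elim/ltn_ind: n => n IH; rewrite bitsE; case: eqP => [->|n0] //.
by rewrite rev_cons msbv_rcons IH ?odd_double_half //; lia.
Qed.

Lemma bits_inj : injective (fun n => code (bits n)).
Proof. by move=> m n E; rewrite -(bitsK m) (code_inj E) bitsK. Qed.
#[export] Instance coded_nat : Coded nat := {| code := fun n => code (bits n); code_inj := bits_inj |}.

Definition nb n := size (bits n).

Lemma csize_nat n : csize n = (6 * nb n).+1.
Proof.
rewrite -[csize n]/(csize (bits n)) /nb.
by elim: (bits n) => // b s IH; rewrite csize_cons IH csize_bool /=; lia.
Qed.

(** The adjunction that reduces bounds on bit lengths to comparisons with powers of two. *)
Lemma nbP n k : (nb n <= k) = (n < 2 ^ k).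
Proof.
rewrite /nb; elim: k n => [|k IH] n; rewrite bitsE; case: eqP => [->|n0] //=.
- by rewrite expn0; lia.
- by rewrite expn_gt0.
- by rewrite ltnS IH expnS; lia.
Qed.

Lemma nb_lt n : n < 2 ^ nb n. Proof. by rewrite -nbP. Qed.

Lemma nb_le m n : m <= n -> nb m <= nb n.
Proof. by move=> H; rewrite nbP; apply: leq_ltn_trans H (nb_lt n). Qed.

Lemma nb_add m n : nb (m + n) <= nb m + nb n + 1.
Proof.
have Hm := nb_lt m; have Hn := nb_lt n; rewrite nbP addn1 expnS expnD.
have := expn_gt0 2 (nb m); have := expn_gt0 2 (nb n) => /=.
by move: (2 ^ nb m) (2 ^ nb n) Hm Hn => a b; nia.
Qed.

Lemma nb_mul m n : nb (m * n) <= nb m + nb n.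
Proof. by rewrite nbP expnD; apply: ltn_mul; apply: nb_lt. Qed.

Lemma nb_bit (b : bool) n : nb (b + n.*2) <= (nb n).+1.
Proof. by rewrite /nb bits_cons; case: ifP. Qed.

Lemma nb_half n : nb n./2 <= nb n. Proof. by apply: nb_le; lia. Qed.

Section Bits.
Context {X : Type} {cX : Coded X}.

Lemma PT_bits (n : X -> nat) : PT n -> PT (fun x => bits (n x)).
Proof. exact: PT_recode. Qed.

Lemma PT_bit (b : X -> bool) (n : X -> nat) : PT b -> PT n -> PT (fun x => b x + (n x).*2).
Proof.
move=> Hb Hn; have Hs := PT_bits Hn.
(* Numerals are canonical: a zero digit put before the empty numeral must leave it empty. *)
apply (PT_recode (f := fun x => if b x || ~~ nilp (bits (n x)) then b x :: bits (n x) else [::])).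
  move=> x; change (code (if b x || ~~ nilp (bits (n x)) then b x :: bits (n x) else [::])
    = code (bits (b x + (n x).*2))).
  rewrite bits_cons; suff -> : nilp (bits (n x)) = (n x == 0) by [].
  by rewrite bitsE; case: eqP.
by pt.
Qed.

Lemma PT_half (n : X -> nat) : PT n -> PT (fun x => (n x)./2).
Proof.
move=> Hn; have Hs := PT_bits Hn.
apply (PT_recode (f := fun x => behead (bits (n x)))); last by pt.
move=> x; change (code (behead (bits (n x))) = code (bits (n x)./2)).
by rewrite [in LHS]bitsE; case: eqP => [->|].
Qed.

Lemma PT_odd (n : X -> nat) : PT n -> PT (fun x => odd (n x)).
Proof.
move=> Hn; have Hs := PT_bits Hn.
apply (PT_ext (f := fun x => head false (bits (n x)))); last by pt.
by move=> x; rewrite bitsE; case: eqP => [->|].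
Qed.

Lemma PT_addb (p q : X -> bool) : PT p -> PT q -> PT (fun x => p x (+) q x).
Proof.
move=> Hp Hq; apply (PT_ext (f := fun x => if p x then ~~ q x else q x)); last by pt.
by move=> x; case: (p x).
Qed.

End Bits.

Lemma PT_msbv {X} {cX : Coded X} (s : X -> seq bool) : PT s -> PT (fun x => msbv (s x)).
Proof.
move=> Hs.
apply (PT_foldl (i := fun=> 0) (h := fun _ (n : nat) (b : bool) => b + n.*2) (q := PC 6)); pt.
  by apply PT_bit; pt.
by move=> x n b; rewrite !csize_nat /=; have := nb_bit b n; lia.
Qed.

Ltac pt_bits := lazymatch goal with
  | |- PT (fun x => addn (nat_of_bool _) (double _)) => apply PT_bit
  | |- PT (fun x => half _) => apply PT_half
  | |- PT (fun x => odd _) => apply PT_odd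
  | |- PT (fun x => addb _ _) => apply PT_addb
  | |- PT (fun x => bits _) => apply PT_bits
  | |- PT (fun x => msbv _) => apply PT_msbv
  end.
Ltac pt_ext ::= first [pt_bool | pt_list | pt_bits].

Definition bstate := (bool * (nat * nat) * seq bool)%type.
Definition add_step (z : bstate) : bstate :=
  let: (c, (m, n), o) := z in
  ((odd m && odd n) || (c && (odd m || odd n)), (m./2, n./2), (odd m (+) odd n (+) c) :: o).
Definition sub_step (z : bstate) : bstate :=
  let: (c, (m, n), o) := z in
  ((~~ odd m && (odd n || c)) || (odd n && c), (m./2, n./2), (odd m (+) odd n (+) c) :: o).

(* Digit-serial addition and subtraction; the output digits pile up most significant
   digit first. *)
Lemma add_stepP (s : seq bool) (c : bool) m n o : m < 2 ^ size s -> n < 2 ^ size s ->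
  exists c' o', [/\ foldl (fun z _ => add_step z) (c, (m, n), o) s = (c', (0, 0), o' ++ o),
    size o' = size s & c + m + n = c' * 2 ^ size s + msbv o'].
Proof.
elim: s c m n o => [|b s IH] c m n o.
  by rewrite !ltnS !leqn0 => /eqP -> /eqP ->; exists c, [::]; rewrite /msbv /= !addn0 muln1.
rewrite /= expnS => Hm Hn.
set c1 := (_ || _ : bool); set d := _ (+) c.
have [||c' [o' [-> Ho E]]] := IH c1 m./2 n./2 (d :: o); [lia|lia|].
exists c', (rcons o' d); rewrite cat_rcons size_rcons Ho msbv_rcons; split=> //.
have : odd m + odd n + c = c1.*2 + d by rewrite /c1 /d; case: (odd m); case: (odd n); case: (c).
have := odd_double_half m; have := odd_double_half n.
rewrite mulnCA mul2n; move: (c' * _) E => Q; lia.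
Qed.

(** Here the carried bit is a borrow. If it survives the last digit, the difference is negative;
    [PT_sub] then returns 0, as truncated subtraction demands. *)
Lemma sub_stepP (s : seq bool) (c : bool) m n o : m < 2 ^ size s -> n < 2 ^ size s ->
  exists c' o', [/\ foldl (fun z _ => sub_step z) (c, (m, n), o) s = (c', (0, 0), o' ++ o),
    size o' = size s & m + c' * 2 ^ size s = n + c + msbv o'].
Proof.
elim: s c m n o => [|b s IH] c m n o.
  by rewrite !ltnS !leqn0 => /eqP -> /eqP ->; exists c, [::]; rewrite /msbv /= !addn0 muln1.
rewrite /= expnS => Hm Hn.
set c1 := (_ || _ : bool); set d := _ (+) c.
have [||c' [o' [-> Ho E]]] := IH c1 m./2 n./2 (d :: o); [lia|lia|].
exists c', (rcons o' d); rewrite cat_rcons size_rcons Ho msbv_rcons; split=> //.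
have : odd m + c1.*2 = odd n + c + d by rewrite /c1 /d; case: (odd m); case: (odd n); case: (c).
have := odd_double_half m; have := odd_double_half n.
rewrite mulnCA mul2n; move: (c' * _) E => Q; lia.
Qed.

Lemma msbv_lt s : msbv s < 2 ^ size s.
Proof.
elim/last_ind: s => // s b IH; rewrite msbv_rcons size_rcons expnS; case: b; lia.
Qed.

Section Add.
Context {X : Type} {cX : Coded X}.
Implicit Types m n : X -> nat.

Lemma PT_bstate (step : bstate -> bstate) m n : PT step -> PT m -> PT n ->
  (forall z, csize (step z) <= csize z + 6) ->
  PT (fun x => foldl (fun z _ => step z) (false, (m x, n x), [::]) (bits (m x) ++ bits (n x))).
Proof.
move=> Hs Hm Hn Hz.
apply (PT_foldl (l := fun x => bits (m x) ++ bits (n x)) (i := fun x => (false, (m x, n x), [::]))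
  (h := fun _ (z : bstate) (_ : bool) => step z) (q := PC 6)); pt.
intros x z b; exact (Hz z).
Qed.

Lemma csize_bstate (c c' b : bool) (m n : nat) (o : seq bool) :
  csize (c', (m./2, n./2), b :: o) <= csize (c, (m, n), o) + 6.
Proof.
rewrite !csize_pair csize_cons !csize_bool !csize_nat.
have := nb_half m; have := nb_half n; lia.
Qed.

(** Concatenation provides enough rounds for both operands without comparing their lengths. *)
Lemma fuel_lt (m n : nat) : m < 2 ^ size (bits m ++ bits n) /\ n < 2 ^ size (bits m ++ bits n).
Proof. by rewrite size_cat -!nbP leq_addr leq_addl. Qed.

Lemma PT_add m n : PT m -> PT n -> PT (fun x => m x + n x).
Proof.
move=> Hm Hn.
apply (PT_ext (f := fun x => (fun z : bstate => msbv (z.1.1 :: z.2))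
  (foldl (fun z _ => add_step z) (false, (m x, n x), [::]) (bits (m x) ++ bits (n x))))).
  move=> x; have [Fm Fn] := fuel_lt (m x) (n x).
  have [c' [o [-> Ho /= E]]] := add_stepP false [::] Fm Fn.
  by rewrite cats0 msbv_cons Ho -E add0n.
refine (PT_comp (g := fun z : bstate => msbv (z.1.1 :: z.2)) _ _); first by pt.
apply PT_bstate => //; last by case=> [[c [? ?]] o]; apply: csize_bstate.
apply (PT_ext (f := fun z : bstate =>
  ((odd z.1.2.1 && odd z.1.2.2) || (z.1.1 && (odd z.1.2.1 || odd z.1.2.2)),
   (z.1.2.1./2, z.1.2.2./2), (odd z.1.2.1 (+) odd z.1.2.2 (+) z.1.1) :: z.2))).
  by case=> [[c [? ?]] o].
by pt.
Qed.

Lemma PT_sub m n : PT m -> PT n -> PT (fun x => m x - n x).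
Proof.
move=> Hm Hn.
apply (PT_ext (f := fun x => (fun z : bstate => if z.1.1 then 0 else msbv z.2)
  (foldl (fun z _ => sub_step z) (false, (m x, n x), [::]) (bits (m x) ++ bits (n x))))).
  move=> x; have [Fm Fn] := fuel_lt (m x) (n x).
  have [c' [o [-> Ho /= E]]] := sub_stepP false [::] Fm Fn.
  by rewrite cats0; have := msbv_lt o; rewrite Ho; case: c' E => /= E; lia.
refine (PT_comp (g := fun z : bstate => if z.1.1 then 0 else msbv z.2) _ _); first by pt.
apply PT_bstate => //; last by case=> [[c [? ?]] o]; apply: csize_bstate.
apply (PT_ext (f := fun z : bstate =>
  ((~~ odd z.1.2.1 && (odd z.1.2.2 || z.1.1)) || (odd z.1.2.2 && z.1.1),
   (z.1.2.1./2, z.1.2.2./2), (odd z.1.2.1 (+) odd z.1.2.2 (+) z.1.1) :: z.2))).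
  by case=> [[c [? ?]] o].
by pt.
Qed.

End Add.


Section Arith1.
Context {X : Type} {cX : Coded X}.
Implicit Types m n : X -> nat.

Lemma PT_leq m n : PT m -> PT n -> PT (fun x => m x <= n x).
Proof.
move=> Hm Hn; apply (PT_ext (f := fun x => (m x - n x) == 0)) => //.
by refine (PT_eq _ _); [apply PT_sub|pt].
Qed.

Lemma PT_succ n : PT n -> PT (fun x => (n x).+1).
Proof.
by move=> Hn; apply (PT_ext (f := fun x => n x + 1)); [move=> x; rewrite addn1|apply PT_add; pt].
Qed.
End Arith1.

Ltac pt_add := lazymatch goal with
  | |- PT (fun x => addn _ _) => apply PT_add
  | |- PT (fun x => subn _ _) => apply PT_sub
  | |- PT (fun x => leq _ _) => apply PT_leq
  | |- PT (fun x => S _) => apply PT_succ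
  end.
Ltac pt_ext ::= first [pt_bool | pt_list | pt_bits | pt_add].

Lemma PT_mul_aux : PT (fun z : nat * nat => z.1 * z.2).
Proof.
apply (PT_ext (f := fun z : nat * nat =>
  foldl (fun acc (b : bool) => (false + acc.*2) + (if b then z.2 else 0)) 0 (rev (bits z.1)))).
  move=> [m n] /=; rewrite -[in RHS](bitsK m); elim/last_ind: (rev _) => // s b IH.
  by rewrite foldl_rcons msbv_rcons IH mulnDl; case: b; lia.
apply (PT_foldl (i := fun=> 0) (h := fun (z : nat * nat) acc (b : bool) =>
  (false + acc.*2) + (if b then z.2 else 0)) (q := PA (PM (PC 6) PX) (PC 12))); pt.
move=> [m n] acc b; rewrite csize_pair !csize_nat csize_bool [ev _ _]/=.
set y := _ + (if b then _ else _).
have : nb y <= _ := nb_add (false + acc.*2) (if b then n else 0).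
have := nb_bit false acc; have : nb (if b then n else 0) <= nb n by apply: nb_le; case: (b).
lia.
Qed.

Definition div_step (d : nat) (z : nat * nat) (b : bool) : nat * nat :=
  if d <= b + z.2.*2 then (true + z.1.*2, b + z.2.*2 - d) else (false + z.1.*2, b + z.2.*2).

(** Long division: the remainder stays below [d], so after one more digit it is below [2 * d] and a
    single trial subtraction yields the next quotient digit. *)
Lemma div_stepP d s q r : 0 < d -> foldl (div_step d) (0, 0) s = (q, r) ->
  msbv s = q * d + r /\ r < d.
Proof.
move=> d0; elim/last_ind: s q r => [|s b IH] q r; first by case=> <- <-.
rewrite foldl_rcons msbv_rcons; case: (foldl _ _ s) IH => q0 r0 /(_ _ _ erefl) [-> Hr].
rewrite /div_step /=; case: (leqP d (b + _)) => H [<- <-]; nia.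
Qed.

Lemma PT_divmod_aux : PT (fun z : nat * nat => (z.1 %/ z.2, z.1 %% z.2)).
Proof.
apply (PT_ext (f := fun z : nat * nat => if z.2 == 0 then (0, z.1) else
  foldl (div_step z.2) (0, 0) (rev (bits z.1)))).
  move=> [m d] /=; case: eqP => [->|/eqP d0]; first by rewrite divn0 modn0.
  rewrite -lt0n in d0; case E: (foldl _ _ _) => [q r]; have [Em Hr] := div_stepP d0 E.
  by rewrite bitsK in Em; rewrite Em divnMDl // modnMDl divn_small // modn_small // addn0.
apply PT_if; [by pt|by pt|].
apply (PT_foldl (l := fun z : nat * nat => rev (bits z.1)) (i := fun=> (0, 0)) (h := fun (z : nat * nat) => div_step z.2) (q := PC 12)); pt.
  by unfold div_step; pt.
move=> [m d] [q r] b; rewrite /div_step [ev _ _]/=.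
have Hq c := nb_bit c q; have Hr := nb_bit b r.
case: ifP => _; rewrite !csize_pair !csize_nat; last first.
  by move: (nb (false + _)) (Hq false) => u; move: (nb (b + _)) Hr => v; lia.
have : nb (b + r.*2 - d) <= nb (b + r.*2) by apply/nb_le/leq_subr.
move: (nb (_ - d)) => w; move: (nb (true + _)) (Hq true) => u; move: (nb (b + _)) Hr => v; lia.
Qed.

Definition gcd_step (z : nat * nat) : nat * nat :=
  if z.2 == 0 then z else (z.2, z.1 %% z.2).

(** Two rounds of Euclid at least halve the second argument: with [r = a %% b] nonzero,
    [b >= r + b %% r > 2 * (b %% r)]. Hence two rounds per bit suffice. *)
Lemma gcd_stepP k (s : seq bool) a b : b < 2 ^ k -> k.*2 <= size s ->
  foldl (fun z _ => gcd_step z) (a, b) s = (gcdn a b, 0).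
Proof.
have fix0 c (t : seq bool) : foldl (fun z _ => gcd_step z) (c, 0) t = (c, 0).
  by elim: t.
elim: k s a b => [|k IH] s a b.
  by rewrite ltnS leqn0 => /eqP -> _; rewrite fix0 gcdn0.
rewrite expnS; case: s => [|x [|y s]] //= Hb Hs.
rewrite {3}/gcd_step /=; case: eqP => [->|/eqP b0].
  by rewrite /gcd_step /= fix0 gcdn0.
rewrite gcdnC -gcdn_modr {2}/gcd_step /=; case: eqP => [->|/eqP r0].
  by rewrite fix0 gcdn0.
rewrite -lt0n in b0; rewrite -lt0n in r0; have Hr := ltn_pmod a b0.
rewrite IH //.
  by rewrite gcdn_modr gcdnC.
have := ltn_pmod b r0; have := divn_eq b (a %% b).
have : 0 < b %/ (a %% b) by rewrite divn_gt0 // ltnW.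
move: (b %/ _) (b %% _) => u v Hu E Hv.
have : a %% b <= u * (a %% b) by rewrite leq_pmull.
lia.
Qed.

Section Arith2.
Context {X : Type} {cX : Coded X}.
Implicit Types m n : X -> nat.

Lemma PT_mul m n : PT m -> PT n -> PT (fun x => m x * n x).
Proof. by move=> Hm Hn; apply (PT_comp PT_mul_aux (PT_pair Hm Hn)). Qed.
Lemma PT_div m n : PT m -> PT n -> PT (fun x => m x %/ n x).
Proof. by move=> Hm Hn; apply (PT_fst (PT_comp PT_divmod_aux (PT_pair Hm Hn))). Qed.
Lemma PT_mod m n : PT m -> PT n -> PT (fun x => m x %% n x).
Proof. by move=> Hm Hn; apply (PT_snd (PT_comp PT_divmod_aux (PT_pair Hm Hn))). Qed.
Lemma PT_min m n : PT m -> PT n -> PT (fun x => minn (m x) (n x)).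
Proof. by move=> Hm Hn; apply PT_if => //; apply PT_leq => //; apply PT_succ. Qed.
End Arith2.

Lemma PT_gcd_aux : PT (fun z : nat * nat => gcdn z.1 z.2).
Proof.
apply (PT_ext (f := fun z : nat * nat =>
  (foldl (fun z _ => gcd_step z) z (bits z.2 ++ bits z.2)).1)).
  move=> [a b] /=; rewrite (@gcd_stepP (nb b)) // ?nb_lt // size_cat addnn.
  exact: leqnn.
apply PT_fst.
apply (PT_foldl (l := fun z : nat * nat => bits z.2 ++ bits z.2) (i := id)
  (h := fun _ (z : nat * nat) (_ : bool) => gcd_step z) (q := PC 0)); pt.
  by unfold gcd_step; pt; apply PT_mod; pt.
move=> w [a b] c; rewrite /gcd_step /= addn0; case: eqP => // _.
by rewrite !csize_pair !csize_nat; have := nb_le (leq_mod a b); lia.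
Qed.

Section Arith3.
Context {X A : Type} {cX : Coded X} {cA : Coded A}.

Lemma PT_gcd (m n : X -> nat) : PT m -> PT n -> PT (fun x => gcdn (m x) (n x)).
Proof. by move=> Hm Hn; apply (PT_comp PT_gcd_aux (PT_pair Hm Hn)). Qed.

Lemma PT_size (s : X -> seq A) : PT s -> PT (fun x => size (s x)).
Proof.
move=> Hs; apply (PT_ext (f := fun x => foldr (fun _ n => n.+1) 0 (s x))).
  by move=> x; elim: (s x) => //= a u ->.
apply (PT_foldr (i := fun=> 0) (h := fun _ (_ : A) n => n.+1) (q := PC 12)); pt.
move=> w n a; rewrite !csize_nat /=; have := nb_add n 1.
by rewrite addn1 (_ : nb 1 = 1) //; lia.
Qed.

Definition drop_step (z : nat * seq A) : nat * seq A :=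
  if z.1 == 0 then z else (z.1 - 1, behead z.2).

(** [k] is written in binary and may be exponential in its size, so the list rather than [k]
    supplies the rounds. *)
Lemma PT_drop (k : X -> nat) (s : X -> seq A) : PT k -> PT s -> PT (fun x => drop (k x) (s x)).
Proof.
move=> Hk Hs.
apply (PT_ext (f := fun x => (foldl (fun z _ => drop_step z) (k x, s x) (s x)).2)).
  have main (t u : seq A) i : size u <= size t ->
      (foldl (fun z _ => drop_step z) (i, u) t).2 = drop i u.
    elim: t u i => [|a t IH] u i /=; first by case: u.
    rewrite {2}/drop_step /=; case: eqP => [->|]; last first.
      case: i => // i _; case: u => [|b u] Hu; rewrite IH //= ?subn1 //.
    case: u => [|b u] Hu; first by rewrite IH.
    suff -> v : foldl (fun z _ => drop_step z) (0, v) t = (0, v) by [].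
    by elim: (t).
  by move=> x; apply: main.
apply PT_snd.
apply (PT_foldl (l := s) (i := fun x => (k x, s x))
  (h := fun _ (z : nat * seq A) (_ : A) => drop_step z) (q := PC 0)); pt.
  by unfold drop_step; pt.
move=> w [i u] c; rewrite /drop_step /= addn0; case: eqP => // _.
have := nb_le (leq_subr 1 i).
by case: u => [|a u] /=; rewrite !csize_pair !csize_nat ?csize_cons; lia.
Qed.

End Arith3.

Lemma PT_nth {X A} {cX : Coded X} {cA : Coded A} (d : X -> A) (k : X -> nat) (s : X -> seq A) :
  PT d -> PT k -> PT s -> PT (fun x => nth (d x) (s x) (k x)).
Proof.
move=> Hd Hk Hs; apply (PT_ext (f := fun x => head (d x) (drop (k x) (s x)))).
  by move=> x; rewrite -nth0 nth_drop addn0.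
by apply PT_head => //; apply PT_drop.
Qed.

Lemma PT_take {X A} {cX : Coded X} {cA : Coded A} (k : X -> nat) (s : X -> seq A) :
  PT k -> PT s -> PT (fun x => take (k x) (s x)).
Proof.
move=> Hk Hs; apply (PT_ext (f := fun x => rev (drop (size (s x) - k x) (rev (s x))))).
  move=> x; rewrite drop_rev revK; case: (leqP (k x) (size (s x))) => H.
    by rewrite subKn.
  by rewrite (eqP (_ : size (s x) - k x == 0)) ?subn0 ?take_size ?take_oversize // ?subn_eq0 ltnW.
by apply PT_rev, PT_drop; [apply PT_sub => //; apply PT_size|apply PT_rev].
Qed.

Lemma PT_sumn {X} {cX : Coded X} (s : X -> seq nat) : PT s -> PT (fun x => sumn (s x)).
Proof.
move=> Hs; apply (PT_foldr (i := fun=> 0) (h := fun _ a b => a + b) (q := PA PX (PC 6))); pt.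
by move=> x b a; rewrite !csize_nat /=; have := nb_add a b; lia.
Qed.

Definition prodn (s : seq nat) := foldr muln 1 s.
Lemma PT_prodn {X} {cX : Coded X} (s : X -> seq nat) : PT s -> PT (fun x => prodn (s x)).
Proof.
move=> Hs; apply (PT_foldr (i := fun=> 1) (h := fun _ a b => a * b) (q := PX)); pt.
  by apply PT_mul; pt.
by move=> x b a; rewrite !csize_nat /=; have := nb_mul a b; lia.
Qed.

Ltac pt_arith := lazymatch goal with
  | |- PT (fun x => muln _ _) => apply PT_mul
  | |- PT (fun x => divn _ _) => apply PT_div
  | |- PT (fun x => modn _ _) => apply PT_mod
  | |- PT (fun x => gcdn _ _) => apply PT_gcd
  | |- PT (fun x => minn _ _) => apply PT_min
  | |- PT (fun x => size _) => apply PT_size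
  | |- PT (fun x => drop _ _) => apply PT_drop
  | |- PT (fun x => take _ _) => apply PT_take
  | |- PT (fun x => nth _ _ _) => apply PT_nth
  | |- PT (fun x => sumn _) => apply PT_sumn
  | |- PT (fun x => prodn _) => apply PT_prodn
  end.
Ltac pt_ext ::= first [pt_bool | pt_list | pt_bits | pt_add | pt_arith].


(** * From words to coded lists and back *)

Definition read_loop b := While (b + 0) (branch (b + 0) (fun a =>
  Seq (Pop (b + 0)) (pushes (b + 1) (sym1 :: fl (ltree a))))).
Definition readc b := Seq (Push (b + 1) sym0)
  (Seq (read_loop b) (Seq (mv (b + 1) (b + 2)) (mv (b + 2) (b + 0)))).

(** A coded list grows at its head, so the letters must arrive last one first; this is the order in
    which the reversed input is popped. *)
Lemma runs_read_loop s b w (l : seq 'I_3) :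
  runs (read_loop b) (fr s b [:: w; fl (code l)]) (13 * size w + 1)
    (fr s b [:: [::]; fl (code (catrev w l))]).
Proof.
elim: w l => [|a w IH] l; first by apply: runs_done; rewrite fr_at.
eapply runs_le; last (eapply runs_wb; [by rewrite fr_at| |]).
- instantiate (1 := 13 * size w + 1); instantiate (1 := 1 + 6); rewrite /=; lia.
- popstep; eapply runs_le; last exact: runs_pushes.
  by rewrite /=; case: a => [[|[|[|?]]] ?].
- rewrite /= (_ : _ :: fl (ltree a) ++ fl (stree l) = fl (code (a :: l))) //.
Qed.

Lemma csize_letters (w : seq 'I_3) : csize w <= 6 * size w + 1.
Proof.
elim: w => // a w IH; rewrite csize_cons [size _]/=.
have : csize a <= 5 by case: a => [[|[|[|?]]] ?].
lia.
Qed.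

Lemma runs_readc s b (w : seq 'I_3) :
  runs (readc b) (fr s b [:: rev w]) (200 * size w + 100) (fr s b [:: fl (code w)]).
Proof.
have E : catrev (rev w) [::] = w by rewrite -[RHS]revK.
eapply runs_to.
- eapply runs_seq; [exact: runs_push|rewrite fr_upd fr_at].
  eapply runs_seq; first exact: (runs_read_loop s b (rev w) [::]).
  rewrite E; mvstep; exact: runs_mv.
- by rewrite /= catrevE cats0 revK; trim.
- have := csize_letters w; rewrite /csize /tsz /= !size_rev; lia.
Qed.

(** The letters have the codes 0, 100 and 11000, each preceded by the 1 of its list node, so the
    number of leading ones identifies the letter. *)
Definition write_loop b := While (b + 0) (If (b + 0) (Some sym0) (Pop (b + 0))
  (Seq (Pop (b + 0)) (If (b + 0) (Some sym0) (Seq (Pop (b + 0)) (Push (b + 1) sym0))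
  (Seq (Pop (b + 0)) (If (b + 0) (Some sym0)
     (Seq (Pop (b + 0)) (Seq (Pop (b + 0)) (Push (b + 1) sym1)))
     (Seq (Pop (b + 0)) (Seq (Pop (b + 0)) (Seq (Pop (b + 0)) (Seq (Pop (b + 0))
        (Push (b + 1) symH)))))))))).
Definition writec b := Seq (write_loop b) (Seq (mv (b + 1) (b + 2)) (mv (b + 2) (b + 0))).

Lemma runs_write_loop s b (l : seq 'I_3) y :
  runs (write_loop b) (fr s b [:: fl (code l); y]) (20 * size l + 10)
    (fr s b [:: [::]; catrev l y]).
Proof.
elim: l y => [|a l IH] y.
  eapply runs_to; first (eapply runs_loop; [by rewrite fr_at| |]).
  - apply: runs_then; [by rewrite fr_at|exact: runs_pop].
  - by rewrite fr_upd fr_at; apply: runs_done; rewrite fr_at.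
  - by [].
  - by [].
eapply runs_le; last (eapply runs_loop; [by rewrite fr_at| |exact: IH]).
  instantiate (1 := 1 + (1 + (1 + (1 + (1 + (1 + 1))) + 2) + 2) + 2); rewrite /=; lia.
apply: runs_else; first by rewrite fr_at.
popstep; case: a => [[|[|[|//]]] Ha]; rewrite /= ?cat0s.
- apply: (@runs_le _ _ (1 + 1 + 2)); first lia.
  apply: runs_then; first by rewrite fr_at.
  eapply runs_to; first (popstep; exact: runs_push).
    by rewrite fr_upd fr_at /= (_ : sym0 = Ordinal Ha) //; apply: val_inj.
  by [].
- apply: (@runs_le _ _ (1 + (1 + (1 + 1) + 2) + 2)); first lia.
  apply: runs_else; first by rewrite fr_at.
  popstep; apply: runs_then; first by rewrite fr_at.
  eapply runs_to; first (popstep; popstep; exact: runs_push).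
    by rewrite fr_upd fr_at /= (_ : sym1 = Ordinal Ha) //; apply: val_inj.
  by [].
- apply: (@runs_le _ _ (1 + (1 + (1 + (1 + (1 + 1))) + 2) + 2)); first lia.
  apply: runs_else; first by rewrite fr_at.
  popstep; apply: runs_else; first by rewrite fr_at.
  eapply runs_to; first (popstep; popstep; popstep; popstep; exact: runs_push).
    by rewrite fr_upd fr_at /= (_ : symH = Ordinal Ha) //; apply: val_inj.
  by [].
Qed.

Lemma runs_writec s b (l : seq 'I_3) :
  runs (writec b) (fr s b [:: fl (code l)]) (200 * size l + 100) (fr s b [:: rev l]).
Proof.
eapply runs_to.
- rewrite (_ : fr s b _ = fr s b [:: fl (code l); [::]]); last trim.
  eapply runs_seq; first exact: runs_write_loop.
  mvstep; exact: runs_mv.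
- by rewrite /= ?catrevE ?cats0 ?revK; trim.
- by rewrite /= ?catrevE ?cats0 ?size_rev ?size_cat /=; lia.
Qed.

Theorem TM_of_PT (f : seq 'I_3 -> seq 'I_3) : PT f ->
  exists M c k, forall inp, exists T,
    [/\ T <= c * (size inp) ^ k + c, halted (run T (init M inp))
      & output_is (run T (init M inp)) (f inp)].
Proof.
move=> [c0 [p H]]; pose prog := Seq (readc 0) (Seq (c0 0) (writec 0)).
have [M HM] := TM_of_com prog.
(* [cs] bounds the size of the coded input; [pt] adds the costs of reading, computing and writing,
   the length of the output being at most [cs] plus the time spent computing; [pT] applies the
   quadratic simulation. *)
pose cs := PA (PM (PC 6) PX) (PC 1).
pose pt := PA (PA (PM (PC 200) PX) (PC 100)) (PA (psubst p cs)
  (PA (PM (PC 200) (PA cs (psubst p cs))) (PC 100))).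
pose pT := PM (PC 10) (PM (PA (PA PX pt) (PC 1)) (PA (PA PX pt) (PC 1))).
have [c [k Hck]] := ev_monomial pT.
exists M, c, k => inp.
pose s0 : store := fun=> [::].
have E0 w : upd s0 0 w = fr s0 0 [:: w].
  by apply: functional_extensionality => -[|j]; rewrite /upd /fr /= ?nth_nil.
have [t Ht He] : runs prog (fr s0 0 [:: rev inp]) (ev pt (size inp)) (fr s0 0 [:: rev (f inp)]).
  apply: runs_le (runs_seq (runs_readc _ _ _) (runs_seq (H inp 0 s0) (runs_writec _ _ _))).
  have Hi := csize_letters inp; have Hf := computes_size (H inp).
  pose proof (size_csize (f inp)) as Hs.
  have Hp : ev p (tsz (code inp)) <= ev p (6 * size inp + 1) by apply: ev_mono.
  rewrite -!/(csize _) in Hf Hp *.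
  rewrite /= !ev_psubst /=; lia.
rewrite -E0 in He; have [T [H1 H2 H3]] := HM _ _ _ He.
exists T; rewrite [fr _ _ _ _]/= revK in H3; split=> //.
apply: leq_trans H1 _; apply: leq_trans (Hck _).
have Hu : size inp + t + 1 <= size inp + ev pt (size inp) + 1 by lia.
by rewrite expnS expn1; apply: leq_mul (leqnn 10) (leq_mul Hu Hu).
Qed.


(** * Layouts of tuples on a finite uniform sample space *)

Section Slices.
Variable T : finType.
Implicit Types A C : {set T}.

(** Blocks of a fixed enumeration turn disjointness and nesting of events into statements about
    intervals of positions. *)
Definition slice A a p : {set T} := [set x in take p (drop a (enum A))].

Lemma card_slice A a p : a + p <= #|A| -> #|slice A a p| = p.
Proof.
move=> H; rewrite cardsE; have /card_uniqP -> : uniq (take p (drop a (enum A))).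
  by rewrite take_uniq // drop_uniq // enum_uniq.
by rewrite size_takel // size_drop -cardE; lia.
Qed.

Lemma slice_sub A a p : slice A a p \subset A.
Proof.
apply/subsetP => x; rewrite inE => /mem_take /mem_drop.
by rewrite mem_enum.
Qed.

Lemma slice_disjoint A a p a' p' : a + p <= a' -> [disjoint slice A a p & slice A a' p'].
Proof.
move=> H; rewrite disjoint_subset; apply/subsetP => x; rewrite !inE => Hx.
apply/negP => /mem_take Hx'.
have := enum_uniq A; rewrite -(cat_take_drop a' (enum A)) cat_uniq => /and3P[_ /hasPn Hn _].
move: (Hn x Hx'); rewrite /= -[take a' _]/(take a' (enum A)).
have : x \in take (a + p) (enum A).
  by rewrite take_drop addnC in Hx; apply: mem_drop Hx.
move=> Hx2; suff -> : x \in take a' (enum A) by [].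
by rewrite -(subnKC H) takeD mem_cat Hx2.
Qed.

Lemma slice0_sub A p q : p <= q -> slice A 0 p \subset slice A 0 q.
Proof.
move=> H; apply/subsetP => x; rewrite !inE drop0 => Hx.
by rewrite -(subnKC H) takeD mem_cat Hx.
Qed.

(** Fill [A :\: C] first and enter [C] only with what is left over. *)
Lemma avoid_subset A C p : p <= #|A| ->
  exists E : {set T}, [/\ E \subset A, #|E| = p & #|E :&: C| <= p - #|A :\: C|].
Proof.
move=> Hp; case: (leqP p #|A :\: C|) => H.
  exists (slice (A :\: C) 0 p); split.
  - exact: subset_trans (slice_sub _ _ _) (subsetDl _ _).
  - exact: card_slice.
  - suff -> : slice (A :\: C) 0 p :&: C = set0 by rewrite cards0.
    apply/eqP; rewrite setI_eq0; apply: disjointWl (slice_sub _ _ _) _.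
    by rewrite -setI_eq0; apply/eqP/setP => x; rewrite !inE; case: (x \in C); rewrite ?andbF.
have Hc := cardsID C A.
exists (A :\: C :|: slice (A :&: C) 0 (p - #|A :\: C|)).
have Hs := slice_sub (A :&: C) 0 (p - #|A :\: C|).
have Hd : (A :\: C) :&: slice (A :&: C) 0 (p - #|A :\: C|) = set0.
  apply/eqP; rewrite setI_eq0; apply: disjointWr Hs _.
  by rewrite -setI_eq0 setIC -setIA; apply/eqP/setP => x; rewrite !inE; case: (x \in C); rewrite ?andbF.
have Hcs : #|slice (A :&: C) 0 (p - #|A :\: C|)| = p - #|A :\: C| by apply: card_slice; lia.
split.
- by rewrite subUset subsetDl (subset_trans Hs) // subsetIl.
- by rewrite cardsU Hd cards0 Hcs; lia.
- rewrite -{2}Hcs subset_leq_card //; apply/subsetP => x; rewrite !inE.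
  by case: (x \in C); rewrite /= ?andbF ?andbT.
Qed.

End Slices.

(** * Layouts in which conflicting tuples are disjoint *)

Section Layouts.
Variables (n N : nat) (P : 'I_n -> nat) (K1 K2 : eqType) (gk : 'I_n -> K1) (ck : 'I_n -> K2).
Variable ld : 'I_n -> 'I_n.

Definition grp i j := gk i == gk j.
Definition conf i j := (gk i == gk j) && (ck i != ck j).
Definition cls i j := (gk i == gk j) && (ck i == ck j).
(* Total mass of the leaders (heaviest members) of the classes conflicting with [i]. *)
Definition blocked i := \sum_(l | (ld l == l) && conf i l) P l.
Fixpoint loss (s : seq 'I_n) : nat :=
  if s is f :: s' then (N - P f - (if has (grp f) s' then blocked f else 0)) + loss s' else 0.

Hypothesis ld_cls : forall i, cls i (ld i).
Hypothesis ld_max : forall i, P i <= P (ld i).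
Hypothesis ld_eq : forall i j, cls i j -> ld i = ld j.
Hypothesis room : forall i, P i + blocked i <= N.

Definition layout (E : 'I_n -> {set 'I_N}) :=
  (forall i, #|E i| = P i) /\ (forall i j, conf i j -> [disjoint E i & E j]).

Lemma conf_sym i j : conf i j = conf j i.
Proof. by rewrite /conf eq_sym (eq_sym (ck i)). Qed.

Lemma cls_conf i j k : cls i j -> conf i k = conf j k.
Proof. by rewrite /conf => /andP[/eqP -> /eqP ->]. Qed.

Lemma blocked_eq i j : cls i j -> blocked i = blocked j.
Proof. by move=> H; apply: eq_bigl => l; rewrite (cls_conf _ H). Qed.

Lemma grp_cls i j : grp i j -> ~~ conf i j -> cls i j.
Proof. by rewrite /grp /conf /cls => ->; rewrite negbK. Qed.

Lemma ld_idem i : ld (ld i) = ld i.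
Proof. by rewrite -(ld_eq (ld_cls i)). Qed.

Definition free (s : seq 'I_n) := forall i j, i \in s -> j \in s -> ~~ conf i j.

(* [E i] is where tuple [i] is present, and [O i] is reserved for the classes that
   conflict with [i]. *)
Record good (E O : 'I_n -> {set 'I_N}) (s : seq 'I_n) : Prop := Good {
  good_E : forall i, i \in s -> #|E i| = P i;
  good_O : forall i, i \in s -> #|O i| = blocked i;
  good_disj : forall i, i \in s -> [disjoint E i & O i];
  good_grp : forall i j, i \in s -> j \in s -> grp i j -> O i = O j }.

Definition inter (E : 'I_n -> {set 'I_N}) (s : seq 'I_n) := \bigcap_(i <- s) E i.

(* Greedy step: the complement of [E' f] avoids the region where some earlier tuple is
   already absent, as far as possible. *)
Lemma good_cons E O f s : good E O s -> free (f :: s) -> f \notin s ->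
  exists E' O', [/\ good E' O' (f :: s), {in s, E' =1 E} &
    #|inter E' (f :: s)| + (N - P f - (if has (grp f) s then blocked f else 0))
      <= maxn #|inter E s| (N - P f - (if has (grp f) s then blocked f else 0)) ].
Proof.
move=> [gE gO gD gG] Hfree Hf.
have Hnf i : i \in s -> i == f = false by move=> Hi; apply: contraNF Hf => /eqP <-.
have Hr := room f.
suff [Ef [Of [H1 H2 H3 H4 H5]]] : exists Ef Of : {set 'I_N}, [/\ #|Ef| = P f,
    #|Of| = blocked f, [disjoint Ef & Of], (forall j, j \in s -> grp f j -> Of = O j) &
    #|Ef :&: inter E s| + (N - P f - (if has (grp f) s then blocked f else 0))
      <= maxn #|inter E s| (N - P f - (if has (grp f) s then blocked f else 0)) ].
  exists (fun i => if i == f then Ef else E i), (fun i => if i == f then Of else O i).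
  split.
  - split=> [i|i|i|i j]; rewrite ?inE.
    + by case/orP => [/eqP ->|Hi]; rewrite ?eqxx ?(Hnf _ Hi) //; apply: gE.
    + by case/orP => [/eqP ->|Hi]; rewrite ?eqxx ?(Hnf _ Hi) //; apply: gO.
    + by case/orP => [/eqP ->|Hi]; rewrite ?eqxx ?(Hnf _ Hi) //; apply: gD.
    + case/orP => [/eqP ->|Hi]; case/orP => [/eqP ->|Hj]; rewrite ?eqxx ?(Hnf _ Hi) ?(Hnf _ Hj) //.
      * exact: H4.
      * by rewrite /grp eq_sym => /(H4 _ Hi) ->.
      * exact: gG.
  - by move=> i /Hnf ->.
  - rewrite {1}/inter big_cons eqxx.
    suff -> : \bigcap_(i <- s) (if i == f then Ef else E i) = inter E s by [].
    by apply: eq_big_seq => i /Hnf ->.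
set C := inter E s.
case: hasP => [[g gs fg]|Hn].
- have fgc : cls f g by apply: grp_cls => //; apply: Hfree; rewrite !inE ?eqxx ?gs ?orbT.
  have cOg : #|~: O g| = N - blocked f.
    by rewrite cardsCs setCK card_ord gO // (blocked_eq fgc).
  have [|Ef [H1 H2 H3]] := @avoid_subset _ (~: O g) C (P f); first by rewrite cOg; lia.
  exists Ef, (O g); split=> //.
  + by rewrite gO // (blocked_eq fgc).
  + by rewrite disjoints_subset.
  + by move=> j js fj; apply: gG => //; rewrite /grp -(eqP fg).
  + have CO : C \subset ~: O g.
      rewrite /C /inter big_tnth; have gs' := gs; rewrite -disjoints_subset.
      move: gs'; rewrite -index_mem => gi.
      apply: (disjointWl _ (gD _ gs)).
      apply: subset_trans (bigcap_inf (Ordinal gi) isT) _.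
      by rewrite (tnth_nth f) /= nth_index.
    have := cardsID C (~: O g); rewrite (setIidPr CO) cOg => Hc.
    move: H3; lia.
- have [|Ef [H1 H2 H3]] := @avoid_subset _ setT C (P f); first by rewrite cardsT card_ord; lia.
  exists Ef, (slice (~: Ef) 0 (blocked f)); split=> //.
  + by apply: card_slice; rewrite cardsCs setCK card_ord; lia.
  + by rewrite disjoint_sym disjoints_subset slice_sub.
  + by move=> j js fj; case: Hn; exists j.
  + have := cardsID C setT; rewrite setTI cardsT card_ord => Hc.
    move: H3; lia.
Qed.

Lemma good_loss s : uniq s -> free s ->
  exists E O, good E O s /\ #|inter E s| <= N - loss s.
Proof.
elim: s => [|f s IH] /=.
  move=> _ _; exists (fun=> set0), (fun=> set0); split; first by split.
  by rewrite /inter big_nil cardsT card_ord subn0.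
move=> /andP[Hf Hu] Hfree.
have [|E [O [HG HC]]] := IH Hu.
  by move=> i j Hi Hj; apply: Hfree; rewrite inE ?Hi ?Hj orbT.
have [E' [O' [HG' _ HC']]] := good_cons HG Hfree Hf.
exists E', O'; split=> //; move: HC HC'; set t := (N - P f - _); move: t #|inter E s| #|inter E' _| (loss s) => t a b l; clear; lia.
Qed.

Lemma good_extend E O r s : uniq (r ++ s) -> free (r ++ s) -> good E O s ->
  exists E' O', good E' O' (r ++ s) /\ {in s, E' =1 E}.
Proof.
elim: r => [|f r IH] /=; first by exists E, O.
move=> /andP[Hf Hu] Hfree HG; have [|E1 [O1 [HG1 HE1]]] := IH Hu _ HG.
  by move=> i j Hi Hj; apply: Hfree; rewrite inE ?Hi ?Hj orbT.
have [E2 [O2 [HG2 HE2 _]]] := good_cons HG1 Hfree Hf.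
exists E2, O2; split=> // i Hi; rewrite HE2 ?HE1 //.
by rewrite mem_cat Hi orbT.
Qed.

(** The slots of the leaders that conflict with [f] follow one another in the order of their
    indices; this is where the slot of [l] starts. *)
Definition offset f l := \sum_(k | [&& ld k == k, conf f k & k < l]) P k.

(** A tuple outside [s] conflicts with a member of [s], so it belongs in the region reserved by its
    group. That region has size [blocked], exactly enough for one slot per conflicting class. *)
Lemma good_complete E O s : free s -> good E O s ->
  (forall i, i \notin s -> exists2 j, j \in s & conf i j) ->
  exists E', layout E' /\ {in s, E' =1 E}.
Proof.
move=> Hfree [gE gO gD gG] Hmax.
pose phi i := odflt i [pick j | (j \in s) && conf i j].
have phiP i : i \notin s -> phi i \in s /\ conf i (phi i).
  move=> /Hmax [j Hj Hc]; rewrite /phi; case: pickP => [k /andP[]|/(_ j)] //=.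
  by rewrite Hj Hc.
(* All members of a class start where the slot of their leader starts and are no longer than it, so
   the class stays inside that slot. *)
pose blk i := slice (O (phi i)) (offset (phi i) (ld i)) (P i).
exists (fun i => if i \in s then E i else blk i); split; last by move=> i ->.
have conf_grp i j : conf i j -> gk i = gk j by case/andP => /eqP.
have Hld i : i \notin s -> conf (phi i) (ld i).
  move=> Hi; have [_ Hc] := phiP _ Hi; rewrite conf_sym.
  by rewrite -(cls_conf _ (ld_cls i)).
have Hoff i k : ld k = k -> conf i k -> offset i k + P k <= blocked i.
  move=> Hk Hc; rewrite /blocked (bigD1 k) /=; last by rewrite Hk eqxx.
  rewrite addnC leq_add2l [leqRHS](bigID (fun l : 'I_n => l < k)) /=.
  apply: leq_trans (leq_addr _ _); rewrite /offset.
  rewrite [leqRHS](eq_bigl (fun l => [&& ld l == l, conf i l & l < k])) // => l.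
  case: (ltnP l k) => Hl; rewrite ?andbF ?andbT //.
  by rewrite (_ : l != k) ?andbT //; apply: contraTneq Hl => ->; rewrite ltnn.
have Hoff2 i k l : ld k = k -> conf i k -> k < l -> offset i k + P k <= offset i l.
  move=> Hk Hc Hl; rewrite /offset [leqRHS](bigD1 k) /=; last by rewrite Hk eqxx Hc.
  rewrite addnC leq_add2l big_mkcond [leqRHS]big_mkcond; apply: leq_sum => m _.
  case: ifP => // /and3P[-> -> Hm]; rewrite (ltn_trans Hm Hl) /=.
  by rewrite (_ : m != k) //; apply: contraTneq Hm => ->; rewrite ltnn.
split=> [i|i j Hij].
  case: ifP => [|/negbT] Hi; first exact: gE.
  have [H1 H2] := phiP _ Hi.
  apply: card_slice; rewrite gO //.
  by apply: leq_trans (Hoff _ _ (ld_idem i) (Hld _ Hi)); rewrite leq_add2l.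
case: ifP => [|/negbT] Hi; case: ifP => [|/negbT] Hj.
- by have := Hfree _ _ Hi Hj; rewrite Hij.
- have [H1 H2] := phiP _ Hj.
  apply: disjointWr (slice_sub _ _ _) _; rewrite -(gG i) //; first exact: gD.
  by rewrite /grp (conf_grp _ _ Hij) (conf_grp _ _ H2).
- have [H1 H2] := phiP _ Hi.
  apply: disjointWl (slice_sub _ _ _) _; rewrite disjoint_sym -(gG j) //; first exact: gD.
  by rewrite /grp -(conf_grp _ _ Hij) (conf_grp _ _ H2).
have [Hi1 Hi2] := phiP _ Hi; have [Hj1 Hj2] := phiP _ Hj.
have Hg : grp (phi i) (phi j).
  by rewrite /grp -(conf_grp _ _ Hi2) -(conf_grp _ _ Hj2) (conf_grp _ _ Hij).
have Hcl : cls (phi i) (phi j) by apply: grp_cls => //; apply: Hfree.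
rewrite /blk (gG _ _ Hi1 Hj1 Hg).
have -> : offset (phi i) (ld i) = offset (phi j) (ld i).
  by apply: eq_bigl => k; rewrite (cls_conf _ Hcl).
have Hcj : conf (phi j) (ld i) by rewrite -(cls_conf _ Hcl) Hld.
have Hne : ld i != ld j.
  apply: contraTneq Hij => E1; rewrite (cls_conf _ (ld_cls i)) E1.
  by rewrite -(cls_conf _ (ld_cls j)) /conf !eqxx andbF.
case: (ltngtP (ld i) (ld j)) => [H|H|/val_inj/eqP H]; last by rewrite (negPf Hne) in H.
- apply: slice_disjoint; apply: leq_trans (Hoff2 _ _ _ (ld_idem i) Hcj H).
  by rewrite leq_add2l.
- rewrite disjoint_sym; apply: slice_disjoint.
  apply: leq_trans (Hoff2 _ _ _ (ld_idem j) (Hld _ Hj) H).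
  by rewrite leq_add2l.
Qed.

(** Maximality provides, for every remaining tuple, a placed tuple in conflict with it, hence a
    reserved region to live in. *)
Lemma maximal_free (s : seq 'I_n) : uniq s -> free s -> exists r,
  [/\ uniq (r ++ s), free (r ++ s) &
    forall i, i \notin r ++ s -> exists2 j, j \in r ++ s & conf i j].
Proof.
move=> Hu Hs.
pose pr (A : {set 'I_n}) := [forall i in A, forall j in A, ~~ conf i j].
have [|A HA sA] := @maxset_exists _ pr [set i in s].
  apply/forall_inP => i; rewrite inE => Hi; apply/forall_inP => j; rewrite inE => Hj.
  exact: Hs.
have Hpr := maxsetp HA.
exists [seq i <- enum A | i \notin s].
have Hm i : (i \in [seq i <- enum A | i \notin s] ++ s) = (i \in A).
  rewrite mem_cat mem_filter mem_enum; case: (boolP (i \in s)) => Hi /=; last by rewrite orbF.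
  by symmetry; apply: (subsetP sA); rewrite inE.
split.
- rewrite cat_uniq Hu filter_uniq ?enum_uniq //= andbT; apply/hasPn => i Hi.
  by rewrite mem_filter Hi.
- move=> i j; rewrite !Hm => Hi Hj.
  by move/forall_inP: Hpr => /(_ _ Hi) /forall_inP /(_ _ Hj).
- move=> i; rewrite Hm => Hi; apply/exists_inP; apply: contraR Hi => /exists_inPn Hn.
  have Hn' j : j \in A -> ~~ conf i j by move=> Hj; apply: Hn; rewrite Hm.
  have /maxsetsup E1 := HA.
  rewrite -(E1 (i |: A)) ?setU11 ?subsetUr //.
  apply/forall_inP => j Hj; apply/forall_inP => k Hk; move: Hj Hk; rewrite !inE.
  case/orP => [/eqP ->|Hj]; case/orP => [/eqP ->|Hk].
  + by rewrite /conf !eqxx andbF.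
  + exact: Hn'.
  + by rewrite conf_sym Hn'.
  + by move/forall_inP: Hpr => /(_ _ Hj) /forall_inP /(_ _ Hk).
Qed.

Lemma good_layout E O s : uniq s -> free s -> good E O s ->
  exists E', layout E' /\ inter E' s = inter E s.
Proof.
move=> Hu Hs HG; have [r [Hru Hr Hmax]] := maximal_free Hu Hs.
have [E1 [O1 [HG1 HE1]]] := good_extend Hru Hr HG.
have [E2 [HL HE2]] := good_complete Hr HG1 Hmax.
exists E2; split=> //; apply: eq_big_seq => i Hi.
by rewrite HE2 ?HE1 // mem_cat Hi orbT.
Qed.

Lemma layout_lo s : uniq s -> free s -> exists E, layout E /\ #|inter E s| <= N - loss s.
Proof.
move=> Hu Hs; have [E [O [HG HC]]] := good_loss Hu Hs.
by have [E' [HL HE']] := good_layout Hu Hs HG; exists E'; rewrite HE'.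
Qed.

Lemma layout_hi s : uniq s -> free s ->
  exists E, layout E /\ foldr minn N (map P s) <= #|inter E s|.
Proof.
move=> Hu Hs; pose seg p : {set 'I_N} := slice [set: 'I_N] 0 p.
have Hseg p : p <= N -> #|seg p| = p by move=> H; apply: card_slice; rewrite cardsT card_ord.
(* Presence fills the sample space from the left and the reserved regions fill it from the right;
   [room] keeps them apart. *)
have HG : good (fun i => seg (P i)) (fun i => ~: seg (N - blocked i)) s.
  split=> [i _|i _|i _|i j Hi Hj Hg].
  - by apply: Hseg; have := room i; lia.
  - by rewrite cardsCs setCK card_ord Hseg; have := room i; lia.
  - by rewrite disjoints_subset setCK slice0_sub //; have := room i; lia.
  - by rewrite (blocked_eq (grp_cls Hg (Hs _ _ Hi Hj))).
have [E' [HL HE']] := good_layout Hu Hs HG; exists E'; split=> //; rewrite HE'.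
have Hmin : foldr minn N (map P s) <= N.
  by elim: (s) => //= i t IH; apply: leq_trans (geq_minr _ _) IH.
rewrite -{1}(Hseg _ Hmin) subset_leq_card //.
elim: (s) => [|i t IH] /=; first by rewrite /inter big_nil subsetT.
rewrite /inter big_cons subsetI slice0_sub ?geq_minl //=.
exact: subset_trans (slice0_sub _ (geq_minr _ _)) IH.
Qed.

End Layouts.


(** * Extremal probabilities over all models *)

Section Models.
Local Open Scope ring_scope.
Variables (R : realFieldType) (n N : nat) (P : 'I_n -> nat).
Variables (K1 K2 : eqType) (gk : 'I_n -> K1) (ck : 'I_n -> K2) (ld : 'I_n -> 'I_n).
Local Notation conf := (conf gk ck).
Local Notation cls := (cls gk ck).
Local Notation blocked := (blocked P gk ck ld).
Local Notation loss := (loss N P gk ck ld).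
Local Notation grp := (grp gk).

Hypothesis N_gt0 : (0 < N)%N.
Hypothesis ld_cls : forall i, cls i (ld i).
Hypothesis ld_max : forall i, (P i <= P (ld i))%N.
Hypothesis ld_eq : forall i j, cls i j -> ld i = ld j.

Definition model_of (M : {ffun {set 'I_n} -> R}) : Prop :=
  [/\ forall w, 0 <= M w, \sum_w M w = 1,
      forall i, \sum_(w : {set 'I_n} | i \in w) M w = (P i)%:R / N%:R
    & forall (w : {set 'I_n}) i j, i \in w -> j \in w -> conf i j -> M w = 0].

Definition prob (M : {ffun {set 'I_n} -> R}) (s : seq 'I_n) : R :=
  \sum_(w : {set 'I_n} | all (fun i => i \in w) s) M w.

Definition indic i (w : {set 'I_n}) : R := (i \in w)%:R.
Definition bl i w := \sum_(l | (ld l == l) && conf i l) indic l w.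
(** The random variable with expectation [loss s / N]. *)
Fixpoint lossR (s : seq 'I_n) (w : {set 'I_n}) : R :=
  if s is f :: s' then (1 - indic f w - (if has (grp f) s' then bl f w else 0)) + lossR s' w
  else 0.

Lemma NR : N%:R != 0 :> R. Proof. by rewrite pnatr_eq0 -lt0n. Qed.

Section OneModel.
Variables (M : {ffun {set 'I_n} -> R}) (HM : model_of M).
Let Ex (X : {set 'I_n} -> R) := \sum_w M w * X w.

Lemma Ex_indic i : Ex (indic i) = (P i)%:R / N%:R.
Proof.
have [_ _ <- _] := HM; rewrite big_mkcond; apply: eq_bigr => w _.
by rewrite /indic; case: (i \in w); rewrite /= ?mulr1 ?mulr0.
Qed.

Lemma Ex_bl i : Ex (bl i) = (blocked i)%:R / N%:R.
Proof.
rewrite /Ex /bl; under eq_bigr do rewrite mulr_sumr.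
rewrite exchange_big /= natr_sum mulr_suml; apply: eq_bigr => l _; exact: Ex_indic.
Qed.

Lemma Ex_one : Ex (fun=> 1) = 1.
Proof. by rewrite /Ex; under eq_bigr do rewrite mulr1; have [] := HM. Qed.

Lemma Ex_le X Y : (forall w, M w != 0 -> X w <= Y w) -> Ex X <= Ex Y.
Proof.
have [H0 _ _ _] := HM; move=> H; apply: ler_sum => w _.
by have [->|Hw] := eqVneq (M w) 0; rewrite ?mul0r // ler_wpM2l // H.
Qed.

Lemma support_free (w : {set 'I_n}) i j : M w != 0 -> i \in w -> j \in w -> ~~ conf i j.
Proof.
have [_ _ _ Hc] := HM; move=> Hw Hi Hj; apply: contra Hw => Hij; apply/eqP.
exact: Hc Hi Hj Hij.
Qed.

Lemma bl_ge0 i w : 0 <= bl i w.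
Proof. by apply: sumr_ge0 => l _; apply: ler0n. Qed.

Lemma bl_eq0 i (w : {set 'I_n}) : M w != 0 -> i \in w -> bl i w = 0.
Proof.
move=> Hw Hi; apply: big1 => l /andP[_ Hc]; rewrite /indic.
by case: (boolP (l \in w)) => // Hl; have := support_free Hw Hi Hl; rewrite Hc.
Qed.

(** A world of positive weight contains at most one class of each group, and a class has only one
    leader. *)
Lemma indic_bl i w : M w != 0 -> indic i w + bl i w <= 1.
Proof.
move=> Hw; rewrite {1}/indic; case: (boolP (i \in w)) => Hi.
  by rewrite bl_eq0 ?addr0.
rewrite add0r; case: (pickP (fun l => [&& ld l == l, conf i l & l \in w])) => [k /and3P[Hk Hc Hkw]|Hn].
  rewrite /bl (bigD1 k) /=; last by rewrite Hk.
  rewrite big1 ?addr0; first by rewrite /indic Hkw.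
  move=> l /andP[/andP[Hl Hcl] Hlk]; rewrite /indic; case: (boolP (l \in w)) => // Hlw.
  have Hnc := support_free Hw Hlw Hkw.
  have Hg : grp l k.
    by move: Hc Hcl => /andP[/eqP E1 _] /andP[/eqP E2 _]; apply/eqP; rewrite -E1 -E2.
  have := ld_eq (grp_cls Hg Hnc); rewrite (eqP Hl) (eqP Hk) => E.
  by rewrite E eqxx in Hlk.
rewrite /bl big1 // => l /andP[Hl Hc]; rewrite /indic.
by move: (Hn l); rewrite Hl Hc /= => ->.
Qed.

(** The expectation of [indic_bl]. This is how the mere existence of a model yields the hypothesis
    [room] of the layouts. *)
Lemma model_room i : (P i + blocked i <= N)%N.
Proof.
have := @Ex_le (fun w => indic i w + bl i w) (fun=> 1) (@indic_bl i).
rewrite Ex_one /Ex; under eq_bigr do rewrite mulrDr.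
rewrite big_split /= -!/(Ex _) Ex_indic Ex_bl -mulrDl -natrD.
by rewrite ler_pdivrMr ?ltr0n // mul1r ler_nat.
Qed.

Lemma prob_Ex s : prob M s = Ex (fun w => (all (fun i => i \in w) s)%:R).
Proof.
rewrite /prob big_mkcond; apply: eq_bigr => w _.
by case: ifP; rewrite /= ?mulr1 ?mulr0.
Qed.

(** The seed [N] gives the empty minimum the probability 1, the right value for a query without
    atoms. *)
Lemma prob_le s : prob M s <= (foldr minn N (map P s))%:R / N%:R.
Proof.
have : prob M s <= 1.
  by rewrite prob_Ex -[leRHS]Ex_one; apply: Ex_le => w _; rewrite /= lern1 leq_b1.
have : forall i, i \in s -> prob M s <= (P i)%:R / N%:R.
  move=> i Hi; rewrite prob_Ex -Ex_indic; apply: Ex_le => w _.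
  rewrite /indic ler_nat; case: (boolP (all _ _)) => // /allP Ha.
  by rewrite Ha.
elim: (s) (prob M s) => [|i t IH] x H H1 /=; first by rewrite divff ?NR.
rewrite /minn; case: ifP => _; first by rewrite H ?inE ?eqxx.
by apply: IH => // j Hj; apply: H; rewrite inE Hj orbT.
Qed.

Lemma prob_conf s i j : i \in s -> j \in s -> conf i j -> prob M s = 0.
Proof.
have [_ _ _ Hc] := HM; move=> Hi Hj Hij; apply: big1 => w /allP Ha.
by apply: Hc Hij; apply: Ha.
Qed.

(* If [f] is the only tuple of [f :: s] missing from [w] and some [g] in [s] is in the
   group of [f], then [g] keeps every tuple that conflicts with [f] out of [w]. *)
Lemma lossR_ge s w : free gk ck s -> M w != 0 ->
  (~~ all (fun i => i \in w) s)%:R <= lossR s w.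
Proof.
move=> Hs Hw; elim: s Hs => [|f s IH] Hs //=.
have {}IH : (~~ all (fun i => i \in w) s)%:R <= lossR s w.
  by apply: IH => i j Hi Hj; apply: Hs; rewrite inE ?Hi ?Hj orbT.
have H1 := indic_bl f Hw; have H2 := bl_ge0 f w.
set b := if _ then _ else _.
have Hb : 0 <= b <= bl f w by rewrite /b; case: ifP; rewrite ?lexx ?H2.
case: (boolP (all _ s)) IH => Ha /= IH; last first.
  by rewrite andbF /= in IH *; lra.
rewrite andbT; case: (boolP (f \in w)) => Hf /=; first by rewrite /= in IH; lra.
rewrite (_ : b = 0); first by rewrite /indic (negPf Hf) /=; lra.
rewrite /b; case: hasP => // -[g gs fg].
have Hc : cls f g by apply: grp_cls => //; apply: Hs; rewrite !inE ?eqxx ?gs ?orbT.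
have -> : bl f w = bl g w by apply: eq_bigl => l; rewrite (cls_conf _ Hc).
by apply: bl_eq0 => //; apply: (allP Ha).
Qed.

(** Linearity of expectation; [model_room] makes the truncated subtractions in [loss] exact. *)
Lemma Ex_lossR s : Ex (lossR s) = (loss s)%:R / N%:R.
Proof.
elim: s => [|f s IH] /=.
  by rewrite mul0r; apply: big1 => w _; rewrite mulr0.
have Hr := model_room f.
rewrite /Ex; under eq_bigr do rewrite mulrDr.
rewrite big_split /= -!/(Ex _) IH natrD mulrDl; congr (_ + _).
transitivity (Ex (fun=> 1) - Ex (indic f) - (if has (grp f) s then Ex (bl f) else 0)).
  rewrite /Ex -!sumrB; case: ifP => _; rewrite -?sumrB ?subr0.
    by apply: eq_bigr => w _; ring.
  by apply: eq_bigr => w _; rewrite subr0; ring.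
rewrite Ex_one Ex_indic Ex_bl; have HN := NR.
case: ifP => _; last by rewrite !subr0 subn0 natrB ?mulrBl ?divff //; lia.
by rewrite !natrB ?mulrBl ?divff //; lia.
Qed.

Lemma prob_ge s : free gk ck s -> (N - loss s)%:R / N%:R <= prob M s.
Proof.
move=> Hs; have HN := NR.
have H0 : 0 <= prob M s by have [H _ _ _] := HM; apply: sumr_ge0.
have H1 : 1 - prob M s <= (loss s)%:R / N%:R.
  rewrite -Ex_lossR prob_Ex -[X in X - _]Ex_one /Ex -sumrB.
  apply: le_trans (_ : Ex (fun w => (~~ all (fun i => i \in w) s)%:R) <= _); last first.
    by apply: Ex_le => w; apply: lossR_ge.
  rewrite le_eqVlt; apply/orP; left; apply/eqP; apply: eq_bigr => w _.
  by case: (all _ s); rewrite /=; ring.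
case: (leqP (loss s) N) => Hl; last by rewrite (eqP (_ : N - loss s == 0)%N) ?mul0r // subn_eq0 ltnW.
by rewrite natrB // mulrBl divff //; lra.
Qed.

End OneModel.

(** A uniform sample point determines the world of the tuples present at it; [M] is the distribution
    of this random world. *)
Lemma layout_model E : layout P gk ck E -> exists M,
  model_of M /\ forall s, prob M s = #|inter (N := N) E s|%:R / N%:R.
Proof.
move=> [HE Hd]; pose W (x : 'I_N) : {set 'I_n} := [set i | x \in E i].
pose M := [ffun w : {set 'I_n} => #|[set x | W x == w]|%:R / N%:R : R].
have HM (Q : pred {set 'I_n}) : \sum_(w | Q w) M w = #|[set x | Q (W x)]|%:R / N%:R.
  under eq_bigr do rewrite ffunE.
  rewrite -mulr_suml -natr_sum; congr (_%:R / _).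
  rewrite -sum1_card (partition_big W Q) /=; last by move=> x; rewrite inE.
  apply: eq_bigr => w Hw; rewrite -sum1_card; apply: eq_bigl => x; rewrite !inE.
  by case: eqP => [->|]; rewrite ?Hw ?andbF.
exists M; split; last first.
  move=> s; rewrite /prob HM; congr (_%:R / _); congr #|pred_of_set _|.
  apply/setP => x; rewrite inE /inter; elim: s => [|i s IH] /=.
    by rewrite big_nil inE.
  by rewrite big_cons in_setI -IH inE.
split.
- by move=> w; rewrite ffunE divr_ge0 ?ler0n.
- by rewrite HM cardsT card_ord divff ?NR.
- move=> i; rewrite HM -(HE i); congr (_%:R / _); congr #|pred_of_set _|.
  by apply/setP => x; rewrite !inE.
- move=> w i j Hi Hj Hij; rewrite ffunE; suff -> : [set x | W x == w] = set0.
    by rewrite cards0 mul0r.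
  apply/setP => x; rewrite !inE; apply/eqP => E1; move: Hi Hj; rewrite -E1 !inE => Hi Hj.
  by have := Hd _ _ Hij; rewrite disjoint_subset => /subsetP /(_ _ Hi); rewrite inE Hj.
Qed.

Section Extremal.
Variables (s : seq 'I_n) (M0 : {ffun {set 'I_n} -> R}).
Hypotheses (s_uniq : uniq s) (s_free : free gk ck s) (HM0 : model_of M0).

Lemma min_attained : exists M, model_of M /\ prob M s = (N - loss s)%:R / N%:R.
Proof.
have [E [HL HE]] := layout_lo ld_cls ld_max ld_eq (model_room HM0) s_uniq s_free.
have [M [HM Hp]] := layout_model HL; exists M; split=> //.
apply/eqP; rewrite eq_le prob_ge // andbT Hp ler_pM2r ?invr_gt0 ?ltr0n //.
by rewrite ler_nat.
Qed.

Lemma max_attained : exists M, model_of M /\ prob M s = (foldr minn N (map P s))%:R / N%:R.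
Proof.
have [E [HL HE]] := layout_hi ld_cls ld_max ld_eq (model_room HM0) s_uniq s_free.
have [M [HM Hp]] := layout_model HL; exists M; split=> //.
apply/eqP; rewrite eq_le prob_le //= Hp ler_pM2r ?invr_gt0 ?ltr0n //.
by rewrite ler_nat.
Qed.

End Extremal.
End Models.


(** * The query answering algorithm *)

Section Keys.
Variables (IC : seq fd).
(** With one dependency per relation, only its values are collected. A relation without dependency
    gets empty keys: a single group with a single class, and no conflict. *)
Definition fd_values (side : fd -> seq nat) (f : fact) : seq nat :=
  flatten [seq (if fd_rel d == f.1 then [seq nth 0 f.2 a | a <- side d] else [::]) | d <- IC].
Definition gkey (f : fact) : nat * seq nat := (f.1, fd_values fd_lhs f).
Definition ckey (f : fact) : seq nat := fd_values fd_rhs f.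

Lemma eq_flatten_map (A : Type) (B : eqType) (F G : A -> seq B) s :
  (forall a, size (F a) = size (G a)) ->
  (flatten (map F s) == flatten (map G s)) = all (fun a => F a == G a) s.
Proof. by move=> H; elim: s => //= a s IH; rewrite eqseq_cat // IH. Qed.

Lemma fd_values_eq side (f g : fact) : f.1 = g.1 ->
  (fd_values side f == fd_values side g) =
  all (fun d => (fd_rel d == f.1) ==> all (fun a => nth 0 f.2 a == nth 0 g.2 a) (side d)) IC.
Proof.
move=> E; rewrite /fd_values -E eq_flatten_map; last by move=> d; case: ifP; rewrite ?size_map.
apply: eq_all => d; case: (fd_rel d == f.1) => //=.
by elim: (side d) => //= a s IH; rewrite eqseq_cons IH.
Qed.

Lemma viol_keys f g : one_fd_per_relation IC ->
  has (fun d => fd_viol d f g) IC = (gkey f == gkey g) && (ckey f != ckey g).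
Proof.
move=> H1; rewrite /gkey xpair_eqE; case: (f.1 =P g.1) => E /=; last first.
  apply/hasP => -[d _ /and4P[/eqP Hf /eqP Hg _ _]]; by rewrite Hf Hg in E.
rewrite /ckey !fd_values_eq // -has_predC; apply/hasP/andP.
  move=> [d Hd /and4P[/eqP Hf /eqP Hg Hl Hr]]; split.
    by apply/allP => d' Hd'; apply/implyP => /eqP Hf'; rewrite (H1 d' d) // Hf' Hf.
  apply/hasP; exists d => //=; rewrite Hf eqxx /=.
  by case/hasP: Hr => b Hb Hb'; apply/negP => /allP /(_ b Hb); apply/negP.
move=> [/allP Hl /hasP[d Hd /=]]; rewrite negb_imply => /andP[Hf Hr]; exists d => //.
rewrite /fd_viol -E eq_sym Hf /= (implyP (Hl d Hd) Hf) /=.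
by rewrite -has_predC in Hr.
Qed.
End Keys.

Definition entry := (fact * nat)%type.

Section Answer.
Variables (IC : seq fd) (Q : cq).

Definition econf (e e' : entry) := (gkey IC e.1 == gkey IC e'.1) && (ckey IC e.1 != ckey IC e'.1).
Definition egrp (e e' : entry) := gkey IC e.1 == gkey IC e'.1.
Definition ecls (e e' : entry) := (gkey IC e.1 == gkey IC e'.1) && (ckey IC e.1 == ckey IC e'.1).
Definition elead (E : seq entry) (e : entry) : entry :=
  head e [seq y <- E | ecls e y && all (fun z => ecls e z ==> (z.2 <= y.2)) E].
Definition eblocked (E : seq entry) (e : entry) : nat :=
  sumn [seq l.2 | l <- [seq l <- E | (elead E l == l) && econf e l]].
Definition eloss_term (N : nat) (E : seq entry) (f : entry) (s : seq entry) :=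
  N - f.2 - (if has (egrp f) s then eblocked E f else 0).
(** The term of [f] depends on the entries after it, so the fold rebuilds the suffix along with the
    sum. *)
Definition eloss (N : nat) (E s : seq entry) : nat :=
  (foldr (fun f z => (f :: z.1, eloss_term N E f z.1 + z.2)) ([::], 0) s).2.

Definition qfacts (t : seq nat) : seq fact :=
  [seq (a.1, [seq eval_term (val_of Q t) u | u <- a.2]) | a <- cq_atoms Q].
Definition esat (E : seq entry) (t : seq nat) : bool :=
  [&& [seq val_of Q t v | v <- cq_head Q] == t,
      all (fun f => f \in [seq e.1 | e <- E]) (qfacts t)
    & all (eval_cmp (val_of Q t)) (cq_cmps Q)].
Definition support (E : seq entry) (t : seq nat) : seq entry :=
  [seq e <- E | e.1 \in qfacts t].
(** The width [k] of the head is fixed with the query, so the candidates are polynomially many. *)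
Definition cands (dom : seq nat) (k : nat) : seq (seq nat) :=
  iter k (fun c => flatten [seq [seq v :: u | u <- c] | v <- dom]) [:: [::]].
(** [enc_rat] writes lowest terms, so the output must be reduced. *)
Definition reduce (a b : nat) : nat * nat := (a %/ gcdn a b, b %/ gcdn a b).
Definition bounds (N : nat) (E s : seq entry) : nat * nat :=
  if has (fun e => has (econf e) s) s then (0, 0)
  else (N - eloss N E s, foldr minn N [seq e.2 | e <- s]).
Definition answers (N : nat) (E : seq entry) : seq (seq nat * (nat * nat)) :=
  [seq (t, bounds N E (support E t)) | t <-
    undup [seq t <- cands (flatten [seq e.1.2 | e <- E]) (size (cq_head Q)) | esat E t]].

(** The plain product of the denominators is a good enough common denominator: its bit length is at
    most the sum of theirs. Probabilities are then integers in units of [1 / N]. *)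
Definition solve (D : seq (fact * (nat * nat))) : seq (seq nat * ((nat * nat) * (nat * nat))) :=
  let N := prodn [seq e.2.2 | e <- D] in
  let E := [seq (e.1, e.2.1 * (N %/ e.2.2)) | e <- D] in
  [seq (a.1, (reduce a.2.1 N, reduce a.2.2 N)) | a <- answers N E].

End Answer.

(** A loop over a fixed piece of syntax is unrolled into the program, so [T] needs no code. *)
Lemma PT_map_const {X B T} {cX : Coded X} {cB : Coded B} (F : X -> T -> B) (s : seq T) :
  (forall a, PT (fun x => F x a)) -> PT (fun x => map (F x) s).
Proof.
move=> H; elim: s => [|a s IH]; first exact: PT_const.
by apply (PT_cons (f := fun x => F x a) (g := fun x => map (F x) s)).
Qed.

Lemma PT_all_const {X T} {cX : Coded X} (F : X -> T -> bool) (s : seq T) :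
  (forall a, PT (fun x => F x a)) -> PT (fun x => all (F x) s).
Proof.
move=> H; elim: s => [|a s IH]; first exact: PT_const.
by apply (PT_andb (p := fun x => F x a) (q := fun x => all (F x) s)).
Qed.

(** * The algorithm runs in polynomial time *)

Section AnswerPT.
Variables (IC : seq fd) (Q : cq).

Lemma PT_fd_values side : PT (fd_values IC side).
Proof.
apply PT_flatten, PT_map_const => d; apply PT_if; [by pt| |by pt].
by apply PT_map_const => a; pt.
Qed.

Lemma PT_gkey : PT (gkey IC).
Proof. by have H := PT_fd_values fd_lhs; unfold gkey; pt. Qed.

Lemma PT_ckey : PT (ckey IC).
Proof. exact: PT_fd_values. Qed.

Lemma PT_econf : PT (fun z : entry * entry => econf IC z.1 z.2).
Proof. by have H1 := PT_gkey; have H2 := PT_ckey; unfold econf; pt. Qed.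
Lemma PT_egrp : PT (fun z : entry * entry => egrp IC z.1 z.2).
Proof. by have H1 := PT_gkey; unfold egrp; pt. Qed.
Lemma PT_ecls : PT (fun z : entry * entry => ecls IC z.1 z.2).
Proof. by have H1 := PT_gkey; have H2 := PT_ckey; unfold ecls; pt. Qed.

Lemma PT_elead : PT (fun z : seq entry * entry => elead IC z.1 z.2).
Proof. have H1 := PT_ecls; unfold elead; pt. Qed.

Lemma PT_eblocked : PT (fun z : seq entry * entry => eblocked IC z.1 z.2).
Proof. have H1 := PT_elead; have H2 := PT_econf; unfold eblocked; pt. Qed.

Lemma PT_eloss : PT (fun z : nat * (seq entry * seq entry) => eloss IC z.1 z.2.1 z.2.2).
Proof.
have H1 := PT_eblocked; have H2 := PT_egrp; unfold eloss; apply PT_snd.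
apply (PT_foldr (X := (nat * (seq entry * seq entry))%type) (i := fun=> ([::], 0))
  (h := fun x f z => (f :: z.1, eloss_term IC x.1 x.2.1 f z.1 + z.2))
  (q := PA PX (PC 7))); pt.
  by unfold eloss_term; pt.
move=> [N [E s]] [t m] f; rewrite !csize_pair csize_cons [ev _ _]/= !csize_nat /=.
have := nb_add (eloss_term IC N E f t) m.
have : nb (eloss_term IC N E f t) <= nb N by apply: nb_le; rewrite /eloss_term; lia.
lia.
Qed.

Lemma PT_eval_term u : PT (fun t => eval_term (val_of Q t) u).
Proof. by case: u => [v|c] /=; unfold val_of; pt. Qed.

Lemma PT_eval_cmp c : PT (fun t => eval_cmp (val_of Q t) c).
Proof.
case: c => [[op u] v]; have H1 := PT_eval_term u; have H2 := PT_eval_term v.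
by unfold eval_cmp; case: op; cbn [fst snd]; pt.
Qed.

Lemma PT_qfacts : PT (qfacts Q).
Proof.
apply PT_map_const => a; apply PT_pair; first by pt.
by apply PT_map_const => u; apply: PT_eval_term.
Qed.

Lemma PT_esat : PT (fun z : seq entry * seq nat => esat Q z.1 z.2).
Proof.
have H1 := PT_qfacts; unfold esat; apply PT_andb; last apply PT_andb.
- refine (PT_eq _ _); last by pt.
  by apply PT_map_const => v; unfold val_of; pt.
- by pt.
- apply PT_all_const => c.
  by apply (PT_comp (g := fun t => eval_cmp (val_of Q t) c)); [exact: PT_eval_cmp|pt].
Qed.

Lemma PT_support : PT (fun z : seq entry * seq nat => support Q z.1 z.2).
Proof. by have H1 := PT_qfacts; unfold support; pt. Qed.

(** The induction on [k] takes place outside the machine: each [k] has its own program and its own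
    polynomial. *)
Lemma PT_cands k : PT (fun dom => cands dom k).
Proof.
elim: k => [|k IH]; first exact (PT_const [:: [::]]).
apply (PT_ext (f := fun dom => flatten [seq [seq v :: u | u <- cands dom k] | v <- dom])) => //.
by pt; apply (PT_comp IH); pt.
Qed.

Lemma PT_bounds : PT (fun z : nat * (seq entry * seq entry) => bounds IC z.1 z.2.1 z.2.2).
Proof.
have H1 := PT_econf; have H2 := PT_eloss; unfold bounds; pt.
apply (PT_foldr (X := (nat * (seq entry * seq entry))%type) (h := fun _ => minn) (q := PC 0)); pt.
move=> x b a; rewrite addn0 !csize_nat; have := nb_le (geq_minr a b); lia.
Qed.

Lemma PT_answers : PT (fun z : nat * seq entry => answers IC Q z.1 z.2).
Proof.
have H1 := PT_bounds; have H2 := PT_support; have H3 := PT_esat.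
have H4 := PT_cands (size (cq_head Q)); unfold answers; pt.
by apply (PT_comp H4); pt.
Qed.

Lemma PT_solve : PT (solve IC Q).
Proof.
have H1 := PT_answers; unfold solve, reduce; pt.
Qed.

End AnswerPT.


(** * Reading the input and writing the output *)

(** The input is a sequence of binary numbers, each ended by [symH]; the sign letter of a
    nonnegative numerator passes as a leading zero. *)
Definition tok_step (z : nat * seq nat) (a : 'I_3) : nat * seq nat :=
  if a == symH then (0, z.1 :: z.2) else ((a == sym1) + z.1.*2, z.2).
Definition tokens (w : seq 'I_3) : seq nat := rev (foldl tok_step (0, [::]) w).2.

Lemma PT_tokens : PT tokens.
Proof.
unfold tokens; apply PT_rev, PT_snd.
apply (PT_foldl (l := id) (i := fun=> (0, [::])) (h := fun _ => tok_step) (q := PC 6)); pt.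
  by unfold tok_step; pt.
move=> x [c o] a; rewrite /tok_step /=; case: ifP => _.
  by rewrite !csize_pair csize_cons !csize_nat (_ : nb 0 = 0) //=; lia.
by rewrite !csize_pair !csize_nat /=; have := nb_bit (a == sym1) c; move: (nb (_ + _)); lia.
Qed.

Lemma tok_nat n o w : foldl tok_step (0, o) (enc_nat n ++ w) = foldl tok_step (0, n :: o) w.
Proof.
rewrite /enc_nat -catA foldl_cat.
have main s c : foldl tok_step (c, o) [seq (if b : bool then sym1 else sym0) | b <- s] =
    (foldl (fun n (b : bool) => b + n.*2) c s, o).
  by elim: s c => //= b s IH c; rewrite -IH; case: b.
by rewrite main -/(bits n) -/(msbv _) bitsK.
Qed.

Lemma tok_sign o w : foldl tok_step (0, o) (sym0 :: w) = foldl tok_step (0, o) w.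
Proof. by []. Qed.

Definition raw_entry := (fact * (nat * nat))%type.
Definition fact_tokens (e : raw_entry) : seq nat :=
  [:: e.1.1, size e.1.2 & e.1.2 ++ [:: e.2.1; e.2.2]].

Definition parse_step (z : seq nat * seq raw_entry) : seq nat * seq raw_entry :=
  if nilp z.1 then z else
  (behead (behead (drop (head 0 (behead z.1)) (behead (behead z.1)))),
   ((head 0 z.1, take (head 0 (behead z.1)) (behead (behead z.1))),
    (head 0 (drop (head 0 (behead z.1)) (behead (behead z.1))),
     head 0 (behead (drop (head 0 (behead z.1)) (behead (behead z.1)))))) :: z.2).
Definition parse_tokens (s : seq nat) : seq raw_entry :=
  (* The leading token is the number of entries and is dropped; the token list itself supplies
     enough rounds. *)
  rev (foldl (fun z _ => parse_step z) (behead s, [::]) s).2.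
Definition parse (w : seq 'I_3) := parse_tokens (tokens w).

Lemma csize_uncons (s : seq nat) : csize (head 0 s) + csize (behead s) <= (csize s).+1.
Proof. by case: s => // a s; rewrite csize_cons /=; lia. Qed.

(** Cutting a list costs only one more end marker, so regrouping tokens adds a constant per round,
    as [PT_foldl] requires. *)
Lemma csize_split (s : seq nat) k : csize (take k s) + csize (drop k s) <= (csize s).+1.
Proof.
elim: s k => // a s IH [|k]; first by rewrite take0 drop0 csize_nil add1n.
by rewrite [take _ _]/= [drop _ _]/= !csize_cons; have := IH k; lia.
Qed.

Lemma PT_parse : PT parse.
Proof.
have H := PT_tokens; unfold parse, parse_tokens; apply PT_rev, PT_snd.
apply (PT_foldl (l := tokens) (i := fun w => (behead (tokens w), [::]))
  (h := fun _ z _ => parse_step z) (q := PC 20)); pt.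
  by unfold parse_step; pt.
move=> x [s o] a; rewrite /parse_step /=; case: nilP => _; first by rewrite leq_addr.
rewrite !csize_pair csize_cons !csize_pair.
set k := head 0 (behead s); set r := behead (behead s).
have := csize_uncons s; have := csize_uncons (behead s); have := csize_split r k.
have := csize_uncons (drop k r); have := csize_uncons (behead (drop k r)).
rewrite -/k -/r; lia.
Qed.

Lemma parse_stepP e s o : parse_step (fact_tokens e ++ s, o) = (s, e :: o).
Proof.
case: e => [[r v] [p q]]; rewrite /parse_step /= -!catA.
by rewrite !drop_size_cat // !take_size_cat.
Qed.

Lemma parse_tokensP D k : parse_tokens (k :: flatten (map fact_tokens D)) = D.
Proof.
rewrite /parse_tokens [behead _]/=.
have stuck o (t : seq nat) : foldl (fun z _ => parse_step z) ([::], o) t = ([::], o) by elim: t.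
suff main (t : seq nat) o : size D <= size t -> foldl (fun z _ => parse_step z)
    (flatten (map fact_tokens D), o) t = ([::], rev D ++ o).
  rewrite main ?cats0 ?revK //=; apply: leqW.
  by elim: (D) => //= e t IH; rewrite size_cat; lia.
elim: D t o => [|e D IH] t o; first by move=> _; apply: stuck.
case: t => //= a t Ht; rewrite parse_stepP IH // rev_cons cat_rcons //.
Qed.

Lemma PT_enc_nat : PT enc_nat.
Proof.
apply (PT_ext (f := fun n => [seq (if b : bool then sym1 else sym0) | b <- rev (bits n)] ++ [:: symH])) => //.
by pt.
Qed.

Lemma PT_enc_list {A} {cA : Coded A} (f : A -> seq 'I_3) : PT f -> PT (enc_list f).
Proof.
move=> Hf; have H := PT_enc_nat.
by apply (PT_ext (f := fun s => enc_nat (size s) ++ flatten (map f s))) => //; pt.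
Qed.

Definition enc_frac (q : nat * nat) := sym0 :: enc_nat q.1 ++ enc_nat q.2.
Definition print (L : seq (seq nat * ((nat * nat) * (nat * nat)))) : seq 'I_3 :=
  enc_list (fun a => enc_list enc_nat a.1 ++ enc_frac a.2.1 ++ enc_frac a.2.2) L.

Lemma PT_print : PT print.
Proof.
have H1 := PT_enc_nat; have H2 := PT_enc_list H1; apply PT_enc_list.
by unfold enc_frac; pt.
Qed.

Section Rationals.
Local Open Scope ring_scope.

Definition frac (q : nat * nat) : rat := q.1%:R / q.2%:R.

Lemma frac_int q : frac q = (q.1%:Z)%:~R / (q.2%:Z)%:~R.
Proof. by []. Qed.

Lemma enc_rat_frac q : (0 < q.2)%N -> coprime q.1 q.2 -> enc_rat (frac q) = enc_frac q.
Proof.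
move=> H0 Hc; rewrite /enc_rat frac_int coprimeq_num // coprimeq_den //=.
rewrite gtr0_sg ?ltz_nat // mul1r; case: eqP => // E.
by move: H0; rewrite -ltz_nat E.
Qed.

Lemma reduce_frac a b : (0 < b)%N -> frac (reduce a b) = a%:R / b%:R :> rat.
Proof.
move=> Hb; rewrite /frac /reduce /=.
have Hg : (0 < gcdn a b)%N by rewrite gcdn_gt0 Hb orbT.
have aux (u v g : nat) : (0 < g)%N -> u%:R / v%:R = (u * g)%:R / (v * g)%:R :> rat.
  by move=> H; rewrite !natrM invfM mulrACA divff ?mulr1 // pnatr_eq0 -lt0n.
by rewrite (aux _ _ _ Hg) !divnK ?dvdn_gcdl ?dvdn_gcdr.
Qed.

Lemma reduce_coprime a b : (0 < b)%N -> coprime (reduce a b).1 (reduce a b).2.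
Proof.
move=> Hb; rewrite /reduce /=; have Hg : (0 < gcdn a b)%N by rewrite gcdn_gt0 Hb orbT.
rewrite /coprime -(eqn_pmul2r Hg) mul1n muln_gcdl.
by rewrite !divnK ?dvdn_gcdl ?dvdn_gcdr.
Qed.

Lemma reduce_den a b : (0 < b)%N -> (0 < (reduce a b).2)%N.
Proof.
move=> Hb; rewrite /reduce /= divn_gt0; first by rewrite dvdn_leq // dvdn_gcdr.
by rewrite gcdn_gt0 Hb orbT.
Qed.

Definition raw_of (D : pdb) : seq raw_entry :=
  [seq (fp.1, (absz (numq fp.2), absz (denq fp.2))) | fp <- D].

Lemma parse_enc (D : pdb) : all (fun fp => 0 <= fp.2) D -> parse (enc_pdb D) = raw_of D.
Proof.
move=> Hp; rewrite /parse.
suff -> : tokens (enc_pdb D) = size D :: flatten (map fact_tokens (raw_of D)).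
  exact: parse_tokensP.
have Hlist (v o : seq nat) w : foldl tok_step (0%N, o) (flatten (map enc_nat v) ++ w) =
    foldl tok_step (0%N, rev v ++ o) w.
  elim: v o => //= a v IH o; rewrite -catA tok_nat IH rev_cons cat_rcons //.
rewrite /tokens /enc_pdb /enc_list tok_nat.
suff main o w : foldl tok_step (0%N, o) (flatten [seq enc_fact fp.1 ++ enc_rat fp.2 | fp <- D] ++ w) =
    foldl tok_step (0%N, rev (flatten (map fact_tokens (raw_of D))) ++ o) w.
  by rewrite -[flatten _]cats0 main /= rev_cat revK.
elim: D o Hp => //= [[[r v] p] D] IH o /andP[Hp0 HD].
have -> u : ((enc_fact (r, v) ++ enc_rat p) ++ u) ++ w = enc_nat r ++ (enc_nat (size v) ++
    (flatten (map enc_nat v) ++ (enc_int (numq p) ++ (enc_nat (absz (denq p)) ++ (u ++ w))))).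
  by rewrite /enc_fact /enc_rat /enc_list /= !catA.
rewrite tok_nat tok_nat Hlist.
move: Hp0; rewrite -numq_ge0; case: (numq p) => // m _.
rewrite [enc_int _]/= cat_cons tok_sign !tok_nat IH //.
by rewrite /= !rev_cons !rev_cat -!cats1 /= -!catA.
Qed.

End Rationals.


(** * Correctness *)

Lemma head_mem (T : eqType) (x : T) s : s != [::] -> head x s \in s.
Proof. by case: s => //= a s _; rewrite inE eqxx. Qed.

Lemma mem_cands dom k t :
  (t \in cands dom k) = (size t == k) && all (fun v => v \in dom) t.
Proof.
elim: k t => [|k IH] t; first by rewrite inE; case: t.
rewrite [cands _ _]/=; apply/flatten_mapP/idP => [[v Hv /mapP[u]]|].
  by rewrite IH => /andP[/eqP <- Hu] ->; rewrite /= eqxx Hv.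
case: t => // v t /= /and3P[Ht Hv Ha]; exists v => //.
by apply/mapP; exists t => //; rewrite IH Ha andbT.
Qed.

Lemma prodn_dvd s a : a \in s -> a %| prodn s.
Proof.
elim: s => //= b s IH; rewrite inE => /orP[/eqP ->|/IH H]; first exact: dvdn_mulr.
exact: dvdn_mull.
Qed.

Lemma prodn_gt0 s : all (fun a => 0 < a) s -> 0 < prodn s.
Proof. by elim: s => //= a s IH /andP[Ha /IH Hs]; rewrite muln_gt0 Ha. Qed.

Section Correct.
Variables (sch : schema) (IC : seq fd) (Q : cq) (D : pdb).
Hypotheses (IC_one : one_fd_per_relation IC) (Q_wf : wf_cq sch Q) (D_wf : wf_pdb sch D).

Local Notation n := (size D).
Let N := prodn [seq absz (denq fp.2) | fp <- D].
Let Pn (i : 'I_n) : nat := absz (numq (prob_at i)) * (N %/ absz (denq (prob_at i))).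
Let ent (i : 'I_n) : entry := (fact_at i, Pn i).
Let E : seq entry := [seq (e.1, e.2.1 * (N %/ e.2.2)) | e <- raw_of D].
Let gk (i : 'I_n) := gkey IC (fact_at i).
Let ck (i : 'I_n) := ckey IC (fact_at i).
Let ld (i : 'I_n) := head i [seq y <- enum 'I_n |
  cls gk ck i y && all (fun z => cls gk ck i z ==> (Pn z <= Pn y)) (enum 'I_n)].

(** The dictionary between the algorithm on lists of entries and the combinatorics on indices. *)
Lemma E_ent : E = [seq ent i | i <- enum 'I_n].
Proof.
have ED : D = [seq nth dflt_tp D (val i) | i <- enum 'I_n].
  by rewrite (map_comp (nth dflt_tp D) val) val_enum_ord -/(mkseq _ _) mkseq_nth.
pose g (fp : fact * rat) : entry := (fp.1, absz (numq fp.2) * (N %/ absz (denq fp.2))).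
have -> : E = map g D by rewrite /E /raw_of -map_comp.
transitivity (map g [seq nth dflt_tp D (val i) | i <- enum 'I_n]). by congr map.

by rewrite -map_comp.
Qed.

Lemma N_pos : 0 < N.
Proof.
apply: prodn_gt0; apply/allP => a /mapP[fp _ ->]; by rewrite absz_gt0 denq_neq0.
Qed.

Lemma fact_at_inj : injective (@fact_at D).
Proof.
move=> i j Hij; apply/ord_inj/eqP; have /and3P[Hu _ _] := D_wf.
rewrite -(nth_uniq (fact_at i) _ _ Hu) ?size_map //.
by rewrite !(nth_map dflt_tp) ?ltn_ord //; apply/eqP.
Qed.

Lemma ent_inj : injective ent.
Proof. by move=> i j [/fact_at_inj]. Qed.

Lemma prob_at_ge0 (i : 'I_n) : (0 <= prob_at i)%R.
Proof.
have /and3P[_ _ /allP H] := D_wf.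
by have /andP[] := H _ (mem_nth dflt_tp (ltn_ord i)).
Qed.

Lemma prob_at_frac (i : 'I_n) : prob_at i = ((Pn i)%:R / N%:R)%R.
Proof.
have Hd : absz (denq (prob_at i)) %| N.
  apply: prodn_dvd; apply/mapP; exists (nth dflt_tp D i) => //; exact: mem_nth.
have H0 := prob_at_ge0 i; rewrite -{1}[prob_at i]divq_num_den /Pn.
set d := absz _ in Hd *; set m := absz _.
have d0 : (d%:R != 0 :> rat)%R by rewrite pnatr_eq0 absz_eq0 denq_neq0.
have -> : ((numq (prob_at i))%:~R = m%:R :> rat)%R.
  by rewrite -[RHS]/((Posz m)%:~R)%R gez0_abs // numq_ge0.
have -> : ((denq (prob_at i))%:~R = d%:R :> rat)%R.
  by rewrite -[RHS]/((Posz d)%:~R)%R gez0_abs // denq_ge0.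
have HN := N_pos; rewrite -[in X in (_ / X)%R](divnK Hd) !natrM.
have q0 : ((N %/ d)%:R != 0 :> rat)%R.
  by rewrite pnatr_eq0 -lt0n divn_gt0 ?(dvdn_leq HN Hd) // lt0n absz_eq0 denq_neq0.
by field; rewrite d0 q0.
Qed.

Lemma ld_nonempty i : [seq y <- enum 'I_n |
  cls gk ck i y && all (fun z => cls gk ck i z ==> (Pn z <= Pn y)) (enum 'I_n)] != [::].
Proof.
have Hi : cls gk ck i i by rewrite /cls !eqxx.
case: (arg_maxnP Pn Hi) => j Hj Hmax.
have : j \in [seq y <- enum 'I_n |
  cls gk ck i y && all (fun z => cls gk ck i z ==> (Pn z <= Pn y)) (enum 'I_n)].
  rewrite mem_filter mem_enum andbT Hj /=; apply/allP => z _; apply/implyP; exact: Hmax.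
by case: (filter _ _).
Qed.

Lemma ldP i : cls gk ck i (ld i) /\ forall z, cls gk ck i z -> Pn z <= Pn (ld i).
Proof.
have := head_mem i (ld_nonempty i); rewrite mem_filter => /andP[/andP[H1 /allP H2] _].
by split=> // z; apply/implyP/H2; rewrite mem_enum.
Qed.

Lemma ld_cls i : cls gk ck i (ld i). Proof. by case: (ldP i). Qed.
Lemma ld_max i : Pn i <= Pn (ld i).
Proof. by case: (ldP i) => _; apply; rewrite /cls !eqxx. Qed.
(** The filtered list depends only on the class, and it is nonempty, so the default of [head] never
    shows. *)
Lemma ld_eq i j : cls gk ck i j -> ld i = ld j.
Proof.
move=> Hij; have := ld_nonempty j; rewrite /ld.
have Hc z : cls gk ck i z = cls gk ck j z by move: Hij => /andP[/eqP E1 /eqP E2]; rewrite /cls E1 E2.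
rewrite (@eq_filter _ _ (fun y => cls gk ck j y &&
  all (fun z => cls gk ck j z ==> (Pn z <= Pn y)) (enum 'I_n))).
  by case: (filter _ _).
by move=> y; rewrite Hc; congr (_ && _); apply: eq_all => z; rewrite Hc.
Qed.

Lemma elead_ent i : elead IC E (ent i) = ent (ld i).
Proof.
rewrite /elead E_ent filter_map /ld.
rewrite (@eq_filter _ _ (fun y => cls gk ck i y &&
  all (fun z => cls gk ck i z ==> (Pn z <= Pn y)) (enum 'I_n))).
  by case: (filter _ _).
by move=> y; rewrite /= all_map.
Qed.

Lemma eblocked_ent i : eblocked IC E (ent i) = blocked Pn gk ck ld i.
Proof.
rewrite /eblocked /blocked sumnE big_map big_filter E_ent big_map big_enum_cond /=.
by apply: eq_bigl => l; rewrite -E_ent elead_ent (inj_eq ent_inj).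
Qed.

Lemma eloss_ent s : eloss IC N E (map ent s) = loss N Pn gk ck ld s.
Proof.
rewrite /eloss; suff -> : foldr (fun f z => (f :: z.1, eloss_term IC N E f z.1 + z.2))
    ([::], 0) (map ent s) = (map ent s, loss N Pn gk ck ld s) by [].
elim: s => //= i s ->; congr (_, _ + _).
by rewrite /eloss_term eblocked_ent has_map.
Qed.

Let sup (t : seq nat) : seq 'I_n := [seq i <- enum 'I_n | fact_at i \in qfacts Q t].

Lemma support_ent t : support Q E t = map ent (sup t).
Proof. by rewrite /support E_ent filter_map. Qed.

Lemma sup_uniq t : uniq (sup t).
Proof. by rewrite filter_uniq // enum_uniq. Qed.

Lemma facts_E : [seq e.1 | e <- E] = [seq fact_at i | i <- enum 'I_n].
Proof. by rewrite E_ent -map_comp. Qed.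

Lemma sat_esat (w : world D) t : sat Q w t = esat Q E t && all (fun i => i \in w) (sup t).
Proof.
rewrite /sat /esat /qfacts facts_E; case: eqP => //= _.
rewrite [RHS]andbC andbA [RHS]andbC andbC; congr (_ && _).
rewrite -/(qfacts Q t).
have -> : all (fun a => [exists i in w, fact_at i == (a.1, [seq eval_term (val_of Q t) u | u <- a.2])])
    (cq_atoms Q) = all (fun f => [exists i in w, fact_at i == f]) (qfacts Q t).
  by rewrite all_map.
apply/allP/andP => [H|[/allP Hs /allP Hf]].
  split; last first.
    apply/allP => f Hf; have /exists_inP[i _ /eqP <-] := H f Hf.
    by rewrite map_f // mem_enum.
  apply/allP => i; rewrite mem_filter mem_enum andbT => /H /exists_inP[j Hj /eqP Hji].
  by rewrite -(fact_at_inj Hji).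
move=> f Hft; have /mapP[i _ Hi] := Hf f Hft.
apply/exists_inP; exists i; last by rewrite -Hi.
by apply: Hs; rewrite mem_filter mem_enum andbT -Hi.
Qed.

Lemma ex_sat t : (exists w : world D, sat Q w t) <-> esat Q E t.
Proof.
split=> [[w]|H]; first by rewrite sat_esat => /andP[].
(* Possible worlds may violate [IC], so the full world is a witness; answers with both bounds 0 are
   therefore listed too. *)
by exists setT; rewrite sat_esat H; apply/allP => i _; rewrite inE.
Qed.

Lemma atom_vars_facts t v : v \in atom_vars Q ->
  exists2 f, f \in qfacts Q t & val_of Q t v \in f.2.
Proof.
rewrite /atom_vars /qfacts; elim: (cq_atoms Q) => //= a s IH; rewrite mem_cat => /orP[Hv|/IH].
  exists (a.1, [seq eval_term (val_of Q t) u | u <- a.2]); first by rewrite inE eqxx.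
  elim: (a.2) Hv => //= u us IHu; rewrite mem_cat inE => /orP[|/IHu -> //]; last by rewrite orbT.
  by case: u => //= x; rewrite inE => /eqP ->; rewrite eqxx.
by case=> f Hf Hvf; exists f; rewrite // inE Hf orbT.
Qed.

(** By [wf_cq] each head variable occurs in an atom, so its value occurs in a tuple of the
    database. *)
Lemma esat_cands t : esat Q E t ->
  t \in cands (flatten [seq e.1.2 | e <- E]) (size (cq_head Q)).
Proof.
case/and3P => /eqP Ht /allP Hf _; rewrite mem_cands -{1}Ht size_map eqxx /=.
rewrite -{1}Ht all_map; apply/allP => v Hv /=.
have [_ Hsub] := Q_wf; have [f Hft Hvf] := atom_vars_facts t (Hsub _ Hv).
by have /mapP[e He Ee] := Hf _ Hft; apply/flatten_mapP; exists e; rewrite -?Ee.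
Qed.

Section Prob.
Variable R : realFieldType.
Hypothesis D_cons : consistent R IC D.

Lemma violatesP (w : world D) :
  reflect (exists i j, [/\ i \in w, j \in w & conf gk ck i j]) (violates IC w).
Proof.
apply: (iffP hasP) => [[d Hd /exists_inP[i Hi /exists_inP[j Hj Hv]]]|[i [j [Hi Hj Hc]]]].
  exists i, j; split=> //; rewrite /conf -(viol_keys _ _ IC_one).
  by apply/hasP; exists d.
move: Hc; rewrite /conf -(viol_keys _ _ IC_one) => /hasP[d Hd Hv]; exists d => //.
by apply/exists_inP; exists i => //; apply/exists_inP; exists j.
Qed.

Lemma is_modelP (M : {ffun world D -> R}) : is_model IC M <-> model_of N Pn gk ck M.
Proof.
have Hr i : ratr (prob_at i) = ((Pn i)%:R / N%:R)%R :> R.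
  by rewrite prob_at_frac rmorphM fmorphV /= !ratr_nat.
split=> [[[H1 H2 H3] H4]|[H1 H2 H3 H4]].
  split=> //; first by move=> i; rewrite H3 Hr.
  by move=> w i j Hi Hj Hc; apply: H4; apply/violatesP; exists i, j.
split; first by split=> // i; rewrite Hr.
by move=> w /violatesP[i [j [Hi Hj Hc]]]; apply: H4 Hi Hj Hc.
Qed.

Lemma pQ_prob (M : {ffun world D -> R}) t : esat Q E t -> pQ Q M t = prob M (sup t).
Proof. by move=> H; apply: eq_bigl => w; rewrite sat_esat H. Qed.

Let b (t : seq nat) := bounds IC N E (support Q E t).
Let L : seq (seq nat * rat * rat) :=
  [seq (a.1, frac (reduce a.2.1 N), frac (reduce a.2.2 N)) | a <- answers IC Q N E].

Lemma bounds_correct t : esat Q E t ->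
  [/\ exists M : {ffun world D -> R}, is_model IC M /\ pQ Q M t = ((b t).1%:R / N%:R)%R,
      forall M : {ffun world D -> R}, is_model IC M -> ((b t).1%:R / N%:R <= pQ Q M t)%R,
      exists M : {ffun world D -> R}, is_model IC M /\ pQ Q M t = ((b t).2%:R / N%:R)%R
    & forall M : {ffun world D -> R}, is_model IC M -> (pQ Q M t <= (b t).2%:R / N%:R)%R].
Proof.
move=> Ht; have [M0 HM0] := D_cons; have HM0' := proj1 (is_modelP M0) HM0.
rewrite /b support_ent /bounds eloss_ent -map_comp.
case: ifP => Hc /=.
  have [i [j [Hi Hj Hij]]] : exists i j, [/\ i \in sup t, j \in sup t & conf gk ck i j].
    move: Hc; rewrite has_map => /hasP[i Hi]; rewrite /= has_map => /hasP[j Hj Hij].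
    by exists i, j.
  have H0 (M : {ffun world D -> R}) : is_model IC M -> pQ Q M t = 0%R.
    by move=> /(proj1 (is_modelP M)) HM; rewrite pQ_prob // (prob_conf HM Hi Hj Hij).
  rewrite mul0r; split; try by exists M0; rewrite H0.
  - by move=> M /H0 ->.
  - by move=> M /H0 ->.
have Hfree : free gk ck (sup t).
  move=> i j Hi Hj; apply/negP => Hij; move/negP: Hc; apply.
  rewrite has_map; apply/hasP; exists i => //=.
  by rewrite has_map; apply/hasP; exists j.
have Hu := sup_uniq t; split.
- have [M [HM Hp]] := min_attained N_pos ld_cls ld_max ld_eq Hu Hfree HM0'.
  by exists M; split; [apply: (proj2 (is_modelP M))|rewrite pQ_prob].
- move=> M /(proj1 (is_modelP M)) HM; rewrite pQ_prob //.
  exact: (prob_ge N_pos ld_eq HM Hfree).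
- have [M [HM Hp]] := max_attained N_pos ld_cls ld_max ld_eq Hu Hfree HM0'.
  by exists M; split; [apply: (proj2 (is_modelP M))|rewrite pQ_prob].
- move=> M /(proj1 (is_modelP M)) HM; rewrite pQ_prob //.
  exact: (prob_le N_pos HM).
Qed.

Lemma solve_correct : is_Ans R IC Q D L.
Proof.
have EL : map (fun a => a.1.1) L =
    undup [seq t <- cands (flatten [seq e.1.2 | e <- E]) (size (cq_head Q)) | esat Q E t].
  by rewrite /L /answers -!map_comp /= map_id.
split.
- by rewrite EL undup_uniq.
- move=> t; rewrite EL mem_undup mem_filter ex_sat.
  by split=> [/andP[]|H] //; rewrite H esat_cands.
- move=> a /mapP[x Hx ->].
  have /mapP[t] := Hx; rewrite mem_undup mem_filter => /andP[Ht _] ->.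
  have Hr k : ratr (frac (reduce k N)) = (k%:R / N%:R)%R :> R.
    by rewrite reduce_frac ?N_pos // rmorphM fmorphV /= !ratr_nat.
  rewrite /= !Hr; exact: bounds_correct.
Qed.

Lemma enc_ans_print : enc_ans L = print (solve IC Q (raw_of D)).
Proof.
have -> : solve IC Q (raw_of D) =
    [seq (a.1, (reduce a.2.1 N, reduce a.2.2 N)) | a <- answers IC Q N E].
  by rewrite /solve /N /E /raw_of -map_comp.
rewrite /enc_ans /print /enc_list /L !size_map -!map_comp; congr (_ ++ flatten _).
apply: eq_map => a; rewrite /= !enc_rat_frac ?reduce_den ?N_pos //.
  by apply/reduce_coprime/N_pos.
by apply/reduce_coprime/N_pos.
Qed.

Lemma solve_spec : exists L, enc_ans L = print (solve IC Q (parse (enc_pdb D)))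
  /\ is_Ans R IC Q D L.
Proof.
exists L; rewrite enc_ans_print parse_enc; first by split=> //; apply: solve_correct.
by have /and3P[_ _] := D_wf; apply: sub_all => fp /andP[].
Qed.

End Prob.
End Correct.

Local Open Scope ring_scope.

(* Schema, IC and Q are fixed; the input is D^p; there is a single Turing
   machine running in time polynomial in the size of the encoding of D^p that
   outputs (an encoding of) Ans(Q, D^p, IC). *)
Theorem theorem14 (sch : schema) (IC : seq fd) (Q : cq) :
  all (wf_fd sch) IC -> one_fd_per_relation IC ->
  wf_cq sch Q -> projection_free Q ->
  exists (M : TM) (c k : nat),
    forall D : pdb, wf_pdb sch D ->
    forall R : realFieldType, consistent R IC D ->
    exists (T : nat) (L : seq (seq nat * rat * rat)),
      [/\ (T <= c * (size (enc_pdb D)) ^ k + c)%N,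
          halted (run T (init M (enc_pdb D))),
          output_is (run T (init M (enc_pdb D))) (enc_ans L)
        & is_Ans R IC Q D L].
Proof.
move=> _ IC_one Q_wf _.
have HPT : PT (fun w => print (solve IC Q (parse w))).
  exact (PT_comp PT_print (PT_comp (PT_solve IC Q) PT_parse)).
have [M [c [k HM]]] := TM_of_PT HPT.
exists M, c, k => D D_wf R D_cons.
have [T [H1 H2 H3]] := HM (enc_pdb D).
have [L [HL1 HL2]] := solve_spec IC_one Q_wf D_wf D_cons.
by exists T, L; rewrite HL1.
Qed.
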